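(* Let $w$ be a weight on the unit disc $\mathbb{D}$ which is almost constant on top halves. Then the properties (P1), (P2), (P3), (P4), (P5), (P6), (P7), (P8) are equivalent for $w$.
   Context: $\mathbb{D}=\{z\in\mathbb{C}:|z|<1\}$ carries normalized area measure and $\mathbb{T}=\{|z|=1\}$ carries normalized arc length measure; $|\cdot|$ denotes these measures. $I\subset\mathbb{T}$ always means that $I$ is an interval (arc) of $\mathbb{T}$ of positive length, possibly all of $\mathbb{T}$. The Carleson square of $I$ is $Q_I=\{z\in\mathbb{D}\setminus\{0\}: z/|z|\in I,\ 1-|z|<|I|\}$ and its top half is $T_I=\{z\in\mathbb{D}\setminus\{0\}: z/|z|\in I,\ |I|/2<1-|z|<|I|\}$. For measurable $f$ on $\mathbb{D}$, $Mf(z)=\sup_{I\subset\mathbb{T}:\,z\in Q_I}\frac{1}{|Q_I|}\int_{Q_I}|f|$. A weight on $\mathbb{D}$ is a measurable $w:\mathbb{D}\to[0,\infty]$ with $0<w<\infty$ a.e.; $w(A)=\int_A w$ and $w_A=w(A)/|A|$. The median $m(w;Q_I)$ is a number $t\in(0,\infty)$ with $|\{z\in Q_I:w(z)<t\}|\le|Q_I|/2$ and $|\{z\in Q_I:w(z)>t\}|\le|Q_I|/2$ (the set of such $t$ is a closed interval and it does not matter which of its points is chosen). $\log^+x=\max(\log x,0)$; $p'=p/(p-1)$. A weight $w$ is almost constant on top halves if there is $C\ge1$ with $\operatorname{ess\,sup}_{T_I}w\le C\operatorname{ess\,inf}_{T_I}w$ for all $I\subset\mathbb{T}$. Properties of an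 integrable weight $w$ on $\mathbb{D}$ (only integrable weights can have them): (P1) There are $1<p<\infty$, $C>0$ such that for every $I\subset\mathbb{T}$, $\left(\frac1{|Q_I|}\int_{Q_I}w\right)\left(\frac1{|Q_I|}\int_{Q_I}w^{1-p'}\right)^{p-1}\le C$. (P2) There is $C>0$ such that for every $I\subset\mathbb{T}$, $\frac1{|Q_I|}\int_{Q_I}w\le C\exp\left(\frac1{|Q_I|}\int_{Q_I}\log w\right)$. (P3) There are $1<q<\infty$, $C>0$ such that for every $I\subset\mathbb{T}$, $\left(\frac1{|Q_I|}\int_{Q_I}w^q\right)^{1/q}\le\frac{C}{|Q_I|}\int_{Q_I}w$. (P4) There are $\alpha,\beta\in(0,1)$ such that for every $I\subset\mathbb{T}$ and every measurable $E\subset Q_I$, $|E|<\alpha|Q_I|$ implies $w(E)<\beta w(Q_I)$. (P5) There is $C>0$ such that for every $I\subset\mathbb{T}$, $w_{Q_I}\le C\,m(w;Q_I)$. (P6) There is $C>0$ such that for every $I\subset\mathbb{T}$, $\int_{Q_I}w\log^+\left(\frac{w}{w_{Q_I}}\right)\le C\,w(Q_I)$. (P7) There is $C>0$ such that for every $I\subset\mathbb{T}$, $\int_{Q_I}M(w1_{Q_I})\le C\,w(Q_I)$. (P8) There are $\beta,C>0$ such that for every $I\subset\mathbb{T}$ and every $\lambda>w_{Q_I}$, $w(\{z\in Q_I:w(z)>\lambda\})\le C\lambda\,|\{z\in Q_I:w(z)>\beta\lambda\}|$. *)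

(* Defs.v *)
From HB Require Import structures.
From mathcomp Require Import all_boot all_order all_algebra.
From mathcomp Require Import all_classical all_reals all_analysis.
From mathcomp Require Import measurable_realfun.

Set Implicit Arguments.
Unset Strict Implicit.
Unset Printing Implicit Defensive.

Import Order.TTheory GRing.Theory Num.Theory.
Import numFieldNormedType.Exports.

Local Open Scope classical_set_scope.
Local Open Scope ring_scope.
Local Open Scope ereal_scope.

(* The complex plane as R * R, with the sigma-algebra of Lebesgue measurable
   sets (the completion of the Borel sets), obtained as in the library's
   completed_lebesgue_measure. *)
Definition plane (R : realType) : Type :=
  caratheodory_type ((@lebesgue_measure R \x @lebesgue_measure R)^*)%mu.
HB.instance Definition _ (R : realType) := Measurable.on (plane R).

Definition lebesgue_measure2 (R : realType) : set (plane R) -> \bar R :=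
  @completed_measure_extension _ _ _ (@lebesgue_measure R \x @lebesgue_measure R).
HB.instance Definition _ (R : realType) := Measure.on (@lebesgue_measure2 R).

Lemma invr_pi_ge0 (R : realType) : (0 <= (pi : R)^-1)%R.
Proof. by rewrite invr_ge0 pi_ge0. Qed.

(* Normalized so that the unit disc has area 1; defined on the whole plane, but
   only ever used on subsets of the disc. *)
Definition area (R : realType) : set (plane R) -> \bar R :=
  mscale (NngNum (invr_pi_ge0 R)) (@lebesgue_measure2 R).
HB.instance Definition _ (R : realType) := Measure.on (@area R).

Section CarlesonSquares.
Variable R : realType.

(* Euclidean modulus; the library norm on R * R is the max norm *)
Definition cmod (z : plane R) : R := Num.sqrt (z.1 ^+ 2 + z.2 ^+ 2).

Definition direction (z : plane R) : R * R := (z.1 / cmod z, z.2 / cmod z)%R.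

Definition disc : set (plane R) := [set z | (cmod z < 1)%R].

Definition cis (t : R) : R * R := (cos t, sin t).

Definition arc_length (I : set (R * R)) : \bar R :=
  (@lebesgue_measure R) (`[0%R, (2 * pi)%R[ `&` cis @^-1` I) / (2 * pi)%:E.

(* Open, closed and half-open arcs, possibly the whole circle. *)
Definition is_arc (I : set (R * R)) : Prop :=
  0 < arc_length I /\ exists2 J : set R, is_interval J & I = cis @` J.

Definition carleson_square (I : set (R * R)) : set (plane R) :=
  [set z | [/\ disc z, cmod z != 0%R, I (direction z) &
               (1 - cmod z)%:E < arc_length I]].

Definition top_half (I : set (R * R)) : set (plane R) :=
  [set z | [/\ disc z, cmod z != 0%R, I (direction z) &
               arc_length I / 2%:E < (1 - cmod z)%:E < arc_length I]].

Implicit Types (w f : plane R -> \bar R) (A : set (plane R)).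

Definition mass w A : \bar R := \int[@area R]_(z in A) w z.

Definition average f A : \bar R := (\int[@area R]_(z in A) f z) / area A.

Definition maximal f (z : plane R) : \bar R :=
  ereal_sup [set average (fun x => `|f x|) (carleson_square I) |
             I in [set I | is_arc I /\ carleson_square I z]].

Definition log_plus (x : \bar R) : \bar R := maxe (lne x) 0.

Definition conj_exponent (p : R) : R := (p / (p - 1))%R.

(* Values of w outside the disc are irrelevant. *)
Definition weight w : Prop :=
  [/\ measurable_fun disc w,
      forall z, disc z -> 0 <= w z &
      {ae @area R, forall z, disc z -> 0 < w z < +oo}].

Definition is_median w A (t : R) : Prop :=
  [/\ (0 < t)%R,
      area [set z | A z /\ w z < t%:E] <= area A / 2%:E &
      area [set z | A z /\ t%:E < w z] <= area A / 2%:E].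

(* ess_sup and ess_inf for the restriction of the area measure to A *)
Definition ess_sup_on A f : \bar R :=
  ereal_inf [set y | \forall z \ae @area R, A z -> f z <= y].
Definition ess_inf_on A f : \bar R :=
  ereal_sup [set y | \forall z \ae @area R, A z -> y <= f z].

Definition almost_constant_on_top_halves w : Prop :=
  exists2 C : R, (1 <= C)%R & forall I, is_arc I ->
    ess_sup_on (top_half I) w <= C%:E * ess_inf_on (top_half I) w.

Definition integrable_weight w : Prop := (@area R).-integrable disc w.

(* The library power takes finite junk values at 0 and +oo when the exponent
   1 - p' is negative, but a weight lies in ]0, +oo[ almost everywhere. *)
Definition propP1 w : Prop := integrable_weight w /\
  exists p C : R, [/\ (1 < p)%R, (0 < C)%R & forall I, is_arc I ->
    average w (carleson_square I) *
    (average (fun z => w z `^ (1 - conj_exponent p)) (carleson_square I))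
      `^ (p - 1) <= C%:E].

Definition propP2 w : Prop := integrable_weight w /\
  exists2 C : R, (0 < C)%R & forall I, is_arc I ->
    average w (carleson_square I) <=
    C%:E * expeR (average (fun z => lne (w z)) (carleson_square I)).

Definition propP3 w : Prop := integrable_weight w /\
  exists q C : R, [/\ (1 < q)%R, (0 < C)%R & forall I, is_arc I ->
    (average (fun z => w z `^ q) (carleson_square I)) `^ (q^-1) <=
    C%:E * average w (carleson_square I)].

Definition propP4 w : Prop := integrable_weight w /\
  exists a b : R, [/\ (0 < a < 1)%R, (0 < b < 1)%R &
    forall I (E : set (plane R)), is_arc I -> measurable E ->
      E `<=` carleson_square I ->
      area E < a%:E * area (carleson_square I) ->
      mass w E < b%:E * mass w (carleson_square I)].

(* m is a choice of medians: m A is the chosen median of w on A. *)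
Definition propP5 w (m : set (plane R) -> R) : Prop := integrable_weight w /\
  exists2 C : R, (0 < C)%R & forall I, is_arc I ->
    average w (carleson_square I) <= (C * m (carleson_square I))%:E.

Definition propP6 w : Prop := integrable_weight w /\
  exists2 C : R, (0 < C)%R & forall I, is_arc I ->
    \int[@area R]_(z in carleson_square I)
      (w z * log_plus (w z / average w (carleson_square I))) <=
    C%:E * mass w (carleson_square I).

Definition propP7 w : Prop := integrable_weight w /\
  exists2 C : R, (0 < C)%R & forall I, is_arc I ->
    \int[@area R]_(z in carleson_square I)
      maximal (w \_ (carleson_square I)) z <=
    C%:E * mass w (carleson_square I).

Definition propP8 w : Prop := integrable_weight w /\
  exists b C : R, [/\ (0 < b)%R, (0 < C)%R &
    forall I (l : R), is_arc I -> average w (carleson_square I) < l%:E ->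
      mass w [set z | carleson_square I z /\ l%:E < w z] <=
      (C * l)%:E * area [set z | carleson_square I z /\ (b * l)%:E < w z]].

End CarlesonSquares.

(* Main.v *)
Require Import Defs.
From mathcomp Require Import all_boot all_order all_algebra.
From mathcomp Require Import all_classical all_reals all_analysis.
From mathcomp Require Import measurable_realfun ring lra.

(** For every arc [I] choose a constant [v I] comparable to [w] almost everywhere on the top
    half of [I]. All the properties are equivalent to one inequality, [top_dominated]: the
    mean of [w] over the Carleson square [Q I] is at most [K * v I], uniformly in [I].

    Halving an arc splits its square into a top part, which has at least a quarter of the
    area, and the squares of the two halves. Iterating, [Q I] becomes a binary tree. What is
    left below [n] generations of tops is a strip of area at most [(3 / 4) ^ n] times that
    of [Q I], and [v] changes by at most a factor [C] from a node to its children
    ([top_value_close]), so that [w] is comparable to [v I], up to [C ^ n], outside a strip as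
    thin as desired. Three quantities are therefore controlled by [v I] for every weight:
    the median ([median_top]); the averages of [w `^ e] and [w `^ (- e)] for small [e],
    because the decay of the area prevails over the growth [C `^ e] of these powers
    ([small_power_averages]); and the exponential of the mean of [ln w], because a logarithm
    is bounded by small powers ([log_mean_close]). This settles the properties stated with
    medians and with logarithmic means. It also gives the Muckenhoupt condition from
    [top_dominated], with [1 - p' = - e]; the converse only uses the contribution of the top
    to the average of [w `^ (1 - p')].

    If [top_dominated] holds, every top carries a fixed fraction of the mass of its node, so
    the mass too decays geometrically along the tree and [w `^ (1 + e)] is integrable with
    the right bound ([tree_growth], [gain_integrability]): the reverse Hoelder inequality and
    the logarithmic bound follow. Each of these two implies that the part of [w] far above
    its mean carries at most a quarter of the mass, hence that sets of small relative area
    have at most a fixed fraction of the mass. Applied to a thin strip, this bounds the mass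
    of [Q I] by that of its first generations, which is at most of the order of [v I] times
    the area, and [top_dominated] is recovered ([strip_top_dominated]).

    The level set condition follows from [top_dominated] by stopping the descent in the tree
    when the weight reaches the level ([top_dominated_level_set]), and implies it because a
    mean far above [v I] would have to come from a thin strip ([level_set_top_dominated]).
    The maximal function of [w] restricted to [Q I] is at least the mean of [w] over [Q J] on
    the top of every node [J], so its integral is at least a multiple of [n] times the mass
    of the [n]-th strip; conversely, under [top_dominated], it is at most of the order of the
    largest [v J] over the nodes [J] containing the point ([local_maximal_le]), and the sum
    of all these [v J] has an integral at most of the order of the mass of [Q I].

    The geometry rests on the area of the sectors [r1 < |z| < r2] over an arc, which is
    [r2 ^ 2 - r1 ^ 2] times a constant depending on the arc alone, with comparable constants
    for comparable arcs. Invariance of area under rotations and its behaviour under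
    dilations suffice to prove this. *)

Set Implicit Arguments.
Unset Strict Implicit.
Unset Printing Implicit Defensive.

Import Order.TTheory GRing.Theory Num.Theory.
Import numFieldNormedType.Exports.

Local Open Scope classical_set_scope.
Local Open Scope ring_scope.

(** * Invariance of area under rotations and dilations *)

Section PlaneMeasure.
Variable R : realType.
Local Notation leb := (@lebesgue_measure R).
Local Notation leb2 := (leb \x leb)%E.
Local Notation mR := (measurableTypeR R).
Implicit Types (A : set (mR * mR)).

Lemma lebesgue_measure_shift (c : R) (A : set R) : measurable A ->
  leb ((fun x => x + c) @^-1` A) = leb A.
Proof.
move=> mA.
have mf : measurable_fun [set: R] ((fun x : R => x + c) : R -> measurableTypeR R).
  exact: measurable_funD.
apply/esym.
apply: (@lebesgue_measure_unique R
  (pushforward leb ((fun x : R => x + c) : R -> measurableTypeR R))) => // _ [[a b]] _ <-.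
rewrite /pushforward /=.
rewrite [X in _ = lebesgue_measure X](_ : _ = `]a - c, b - c]%classic); last first.
  by apply/seteqP; split => x /=; rewrite !in_itv/=; lra.
rewrite !lebesgue_measure_itv/= !lte_fin ltrD2r; case: ifP => // _.
by rewrite -!EFinB; congr EFin; lra.
Qed.

Lemma lebesgue_measure_dilation (c : R) (A : set R) : 0 < c -> measurable A ->
  (c%:E * leb ((fun x => (c * x)%R) @^-1` A))%E = leb A.
Proof.
move=> c0 mA.
have mf : measurable_fun [set: R] ((fun x : R => c * x) : R -> measurableTypeR R).
  exact: measurable_funM.
apply/esym.
apply: (@lebesgue_measure_unique R (mscale (NngNum (ltW c0))
  (pushforward leb ((fun x : R => c * x) : R -> measurableTypeR R)))) => // _ [[a b]] _ <-.
rewrite /mscale /= /pushforward /=.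
rewrite [X in _ = (_ * lebesgue_measure X)%E](_ : _ = `]a / c, b / c]%classic); last first.
  apply/seteqP; split => x /=; rewrite !in_itv/=.
    by rewrite ltr_pdivrMr// ler_pdivlMr// mulrC.
  by rewrite ltr_pdivrMr// ler_pdivlMr// mulrC.
rewrite !lebesgue_measure_itv/= !lte_fin ltr_pM2r ?invr_gt0//; case: ifP => // _.
  by rewrite -!EFinB -EFinM; congr EFin; field; rewrite gt_eqF.
by rewrite mule0.
Qed.

Lemma leb2_shear_snd (c : R) A : measurable A ->
  leb2 ((fun z => (z.1, z.2 + c * z.1)) @^-1` A) = leb2 A.
Proof.
move=> mA; rewrite /product_measure1; apply: eq_integral => x _ /=.
rewrite -[RHS](lebesgue_measure_shift (c * x)); last exact: measurable_xsection.
by congr (leb _); apply/seteqP; split => y /=; rewrite /xsection/= !inE.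
Qed.

Lemma leb2_swap A : measurable A -> leb2 A = (leb \x^ leb)%E A.
Proof.
move=> mA; apply: (@product_measure_unique _ _ _ _ _ leb leb (leb \x^ leb)%E) => // B C mB mC.
exact: product_measure2E.
Qed.

Lemma leb2_shear_fst (c : R) A : measurable A ->
  leb2 ((fun z => (z.1 + c * z.2, z.2)) @^-1` A) = leb2 A.
Proof.
move=> mA; rewrite !leb2_swap//; last first.
  rewrite -[X in measurable X]setTI; apply: measurable_fun_pair => //=.
  by apply: measurable_funD => //; exact: measurable_funM.
rewrite /product_measure2; apply: eq_integral => y _ /=.
rewrite -[RHS](lebesgue_measure_shift (c * y)); last exact: measurable_ysection.
by congr (leb _); apply/seteqP; split => x /=; rewrite /ysection/= !inE.
Qed.

Lemma leb2_dilation (c : R) A : 0 < c -> measurable A ->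
  ((c ^+ 2)%:E * leb2 ((fun z => (c * z.1, c * z.2)%R) @^-1` A))%E = leb2 A.
Proof.
move=> c0 mA; have c20 : 0 <= c ^+ 2 by rewrite exprn_ge0// ltW.
have mf : measurable_fun [set: mR * mR] (fun z : mR * mR => ((c * z.1, c * z.2) : mR * mR)).
  by apply: measurable_fun_pair; exact: measurable_funM.
pose mu' := (mscale (NngNum c20) (pushforward leb2 (fun z : mR * mR => ((c * z.1, c * z.2) : mR * mR))) :
  {measure set (mR * mR) -> \bar R}).
suff H : forall B C, measurable B -> measurable C -> mu' mf (B `*` C) = (leb B * leb C)%E.
  by rewrite (@product_measure_unique _ _ _ _ _ leb leb (mu' mf) H A mA).
move=> B C mB mC; rewrite /mu' /=.
rewrite /mscale /= /pushforward /=.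
have -> : (fun z : mR * mR => (c * z.1, c * z.2)) @^-1` (B `*` C) =
  ((fun x => c * x) @^-1` B) `*` ((fun x => c * x) @^-1` C) by [].
have mc X : measurable X -> measurable ((fun x : R => c * x) @^-1` X).
  by move=> mX; rewrite -[X in measurable X]setTI; exact: measurable_funM.
transitivity ((c ^+ 2)%:E * (leb ((fun x => (c * x)%R) @^-1` B) * leb ((fun x => (c * x)%R) @^-1` C)))%E.
  by congr (_ * _)%E; apply: product_measure1E; exact: mc.
by rewrite expr2 EFinM muleACA !lebesgue_measure_dilation.
Qed.

Lemma measurable_preimage (f : mR * mR -> mR * mR) A :
  measurable_fun setT f -> measurable A -> measurable (f @^-1` A).
Proof. by move=> mf mA; rewrite -[X in measurable X]setTI; exact: mf. Qed.

Definition rotation (t : R) (z : mR * mR) : mR * mR :=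
  (z.1 * cos t - z.2 * sin t, z.1 * sin t + z.2 * cos t).

Lemma measurable_rotation t : measurable_fun [set: mR * mR] (rotation t).
Proof.
by apply: measurable_fun_pair => /=;
  [apply: measurable_funB|apply: measurable_funD]; apply: measurable_funM.
Qed.

Lemma rotationD s t z : rotation s (rotation t z) = rotation (s + t) z.
Proof. by rewrite /rotation/= sinD cosD; congr (_, _); ring. Qed.

(** Rotations preserve area because, half-turns apart, they are products of three shears,
    and a shear only translates the sections of a set. *)
Lemma rotation_shears (s : R) (z : mR * mR) : cos (s / 2) != 0 ->
  let a := - (sin (s / 2) / cos (s / 2)) in
  rotation s z = (z.1 + a * z.2 + a * (z.2 + sin s * (z.1 + a * z.2)),
                  z.2 + sin s * (z.1 + a * z.2)).
Proof.
move=> cs a.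
have cs1 := cos2Dsin2 (s / 2).
rewrite /rotation [sin s](_ : _ = sin (s / 2 + s / 2)); last by rewrite -splitr.
rewrite [cos s](_ : _ = cos (s / 2 + s / 2)); last by rewrite -splitr.
rewrite sinD cosD.
set u := sin (s / 2) in a cs1 *; set v := cos (s / 2) in a cs cs1 *.
have av : a * v = - u by rewrite /a; field.
have uu : u * u = 1 - v * v by rewrite -!expr2; lra.
have aS : a * (u * v + v * u) = - 2 * (1 - v * v).
  by rewrite (_ : a * _ = 2 * (a * v) * u); [rewrite av -uu|]; ring.
have aC : a * (v * v - u * u) = - a - (u * v + v * u).
  by rewrite uu (_ : a * _ = 2 * (a * v) * v - a); [rewrite av|]; ring.
have e2 : z.2 + (u * v + v * u) * (z.1 + a * z.2) =
    z.1 * (u * v + v * u) + z.2 * (v * v - u * u).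
  by rewrite mulrDr mulrA [_ * a]mulrC aS uu; ring.
congr pair; last by rewrite e2.
have e3 : a * (z.1 * (u * v + v * u) + z.2 * (v * v - u * u)) =
    z.1 * (- 2 * (1 - v * v)) + z.2 * (- a - (u * v + v * u)).
  by rewrite -aS -aC; ring.
by rewrite e2 e3 uu; ring.
Qed.

Lemma leb2_rotation (t : R) A : measurable A ->
  leb2 (rotation t @^-1` A) = leb2 A.
Proof.
have key (s : R) B : cos (s / 2) != 0 -> measurable B ->
    leb2 (rotation s @^-1` B) = leb2 B.
  move=> cs mB; pose a := - (sin (s / 2) / cos (s / 2)).
  have m1 : measurable_fun [set: mR * mR] (fun z : mR * mR => (z.1 + a * z.2, z.2)).
    apply: measurable_fun_pair => //=.
    by apply: measurable_funD => //; exact: measurable_funM.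
  have m2 : measurable_fun [set: mR * mR] (fun z : mR * mR => (z.1, z.2 + sin s * z.1)).
    apply: measurable_fun_pair => //=.
    by apply: measurable_funD => //; exact: measurable_funM.
  have mB1 := measurable_preimage m1 mB.
  have mB2 := measurable_preimage m2 mB1.
  apply: etrans (leb2_shear_fst a mB); apply: etrans (leb2_shear_snd (sin s) mB1).
  apply: etrans (leb2_shear_fst a mB2).
  congr (product_measure1 _ _ _).
  by apply/seteqP; split => z /=; rewrite (rotation_shears z cs).
(* A half-turn is twice a quarter-turn. *)
move=> mA; have [c0|c0] := eqVneq (cos (t / 2)) 0; last exact: key.
have c1 : cos (t / 2 / 2) != 0.
  apply/eqP => c1; move: c0; rewrite (_ : t / 2 = t / 2 / 2 + t / 2 / 2); last lra.
  by have := cos2Dsin2 (t / 2 / 2); rewrite cosD c1; lra.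
have -> : rotation t @^-1` A = rotation (t / 2) @^-1` (rotation (t / 2) @^-1` A).
  by apply/seteqP; split => z /=; rewrite rotationD -splitr.
rewrite !key//.
exact: (measurable_preimage (measurable_rotation _)).
Qed.

End PlaneMeasure.

(** * Measurability of sets given in polar coordinates *)

Section PolarSets.
Variable R : realType.
Local Notation leb := (@lebesgue_measure R).
Local Notation leb2 := (leb \x leb)%E.
Local Notation mR := (measurableTypeR R).

(** An open set is the union of the countably many squares with rational centre and radius
    that it contains. *)
Lemma measurable_open2 (U : set (R * R)) : open U -> measurable (U : set (mR * mR)).
Proof.
move=> oU; pose B (q : rat * rat * rat) : set (mR * mR) :=
  ball (ratr q.1.1 : R) (ratr q.2) `*` ball (ratr q.1.2 : R) (ratr q.2).
have -> : U = \bigcup_(q in [set q | B q `<=` U]) B q.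
  apply/seteqP; split => [[x y] Uxy|z [q /= qU qz]]; last exact: qU.
  have /nbhs_ballP[e/= e0 exy] : nbhs (x, y) U by exact: open_nbhs_nbhs.
  (* The distance to the rational centre and the radius are both at most [ratr q], which is
     less than [e / 2]. *)
  have [q /andP[]] : exists q : rat, (ratr q : R) \in `]e / 4, e / 2[%R.
    by apply: rat_in_itvoo; lra.
  rewrite !bnd_simp => q1 q2.
  have nearrat (u : R) : exists p : rat, ball (ratr p : R) (ratr q) u.
    have [|p] := @rat_in_itvoo R (u - ratr q) u; first by lra.
    rewrite in_itv/= => /andP[p1 p2]; exists p.
    by rewrite /ball/= ler0_norm; lra.
  have [p1 hp1] := nearrat x; have [p2 hp2] := nearrat y.
  exists (p1, p2, q); last by split.
  move=> [x' y'] [/= h1 h2]; apply: exy; split => /=.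
    by move: hp1 h1; rewrite /ball/= !ltr_norml; lra.
  by move: hp2 h2; rewrite /ball/= !ltr_norml; lra.
rewrite bigcup_mkcond; apply: countable_bigcupT_measurable.
  exact: countableP.
move=> q; case: ifP => _ //; apply: measurableX; exact: measurable_ball.
Qed.

Lemma measurable_compact2 (K : set (R * R)) : compact K -> measurable (K : set (mR * mR)).
Proof.
move=> /compact_closed cK; rewrite -[K]setCK; apply: measurableC.
apply: measurable_open2; rewrite openC; apply: cK.
exact: (@norm_hausdorff R (R * R)%type).
Qed.

Definition polar (p : R * R) : mR * mR := (p.1 * cos p.2, p.1 * sin p.2).

Lemma continuous_polar : continuous (polar : R * R -> R * R).
Proof.
move=> p.
have c1 : (fun q : R * R => q.1 * cos q.2) @ p --> p.1 * cos p.2.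
  apply: cvgM; first exact: cvg_fst.
  by apply: (@continuous_comp _ _ _ snd cos); [exact: cvg_snd|exact: continuous_cos].
have c2 : (fun q : R * R => q.1 * sin q.2) @ p --> p.1 * sin p.2.
  apply: cvgM; first exact: cvg_fst.
  by apply: (@continuous_comp _ _ _ snd sin); [exact: cvg_snd|exact: continuous_sin].
exact: (cvg_pair c1 c2).
Qed.

(** Shared by open, closed and half-open intervals, and preserved by continuous maps, even if
    like [polar] they are not injective: images are thus measurable. *)
Definition sigma_compact (X : set R) :=
  exists2 F : (set R)^nat, (forall n, compact (F n)) & X = \bigcup_n F n.

Lemma measurable_polar_image (P X : set R) : sigma_compact P -> sigma_compact X ->
  measurable (polar @` (P `*` X)).
Proof.
move=> [F cF ->] [G cG ->]; rewrite setX_bigcupl image_bigcup.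
apply: bigcupT_measurable => m; rewrite setX_bigcupr image_bigcup.
apply: bigcupT_measurable => n; apply: measurable_compact2.
apply: continuous_compact; last exact: compact_setX.
by apply: continuous_subspaceT; exact: continuous_polar.
Qed.

Lemma sigma_compact_itv (a b : R) (X : set R) :
  `]a, b[ `<=` X -> X `<=` `[a, b] -> sigma_compact X.
Proof.
move=> aX Xb.
(* The end points, when they belong to [X], are the first two pieces. *)
exists (fun n => match n with
  | 0 => [set x | X a /\ x = a] | 1 => [set x | X b /\ x = b]
  | n.+2 => `[a + n.+1%:R^-1, b - n.+1%:R^-1]%classic end).
  have c1 (P : Prop) c : compact [set x : R | P /\ x = c].
    have [h|h] := pselect P.
      rewrite (_ : [set _ | _] = [set c]); first exact: compact_set1.
      by apply/seteqP; split => x/= => [[]|].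
    rewrite (_ : [set _ | _] = set0); first exact: compact0.
    by apply/seteqP; split => x/= => [[]|].
  by case => [|[|n]]; [exact: c1|exact: c1|exact: segment_compact].
apply/seteqP; split => x.
  move=> Xx; have [xa|xa] := eqVneq x a.
    by exists 0%N => //=; rewrite -xa.
  have [xb|xb] := eqVneq x b; first by exists 1%N => //=; rewrite -xb.
  have := Xb _ Xx; rewrite /= in_itv/= => /andP[]; rewrite !le_eqVlt.
  rewrite (eq_sym a) (negbTE xa) (negbTE xb)/= => ax xb'.
  pose e := Num.min (x - a) (b - x).
  have e0 : 0 < e by rewrite lt_min !subr_gt0 ax xb'.
  have [n _ ne] := near_infty_natSinv_lt (PosNum e0).
  exists n.+2 => //=; rewrite in_itv/=.
  have := ne n (leqnn _); rewrite /= lt_min => /andP[n1 n2].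
  by rewrite -lerBrDl (ltW n1)/= lerBrDr -lerBrDl ltW.
move=> [[|[|n]] _ /=]; [by case=> ? ->|by case=> ? ->|].
rewrite in_itv/= => /andP[x1 x2]; apply: aX; rewrite /= in_itv/=.
have : 0 < n.+1%:R^-1 :> R by rewrite invr_gt0.
move: (n.+1%:R^-1) x1 x2 => e x1 x2 e0; apply/andP; split; lra.
Qed.

End PolarSets.

Arguments polar {R} p.

(** * The area of a sector *)

Section SectorArea.
Variable R : realType.
Local Notation leb := (@lebesgue_measure R).
Local Notation leb2 := (leb \x leb)%E.
Local Notation mR := (measurableTypeR R).
Implicit Types (P X : set R).

Lemma measurable_plane (A : set (mR * mR)) : measurable A -> measurable (A : set (plane R)).
Proof. exact: caratheodory_measurable_mu_ext. Qed.

Lemma areaE (A : set (mR * mR)) : measurable A ->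
  area (A : set (plane R)) = (pi^-1%:E * leb2 A)%E.
Proof.
move=> mA; rewrite /area /mscale /=; congr (_ * _)%E.
rewrite /lebesgue_measure2 /completed_measure_extension.
exact: measurable_mu_extE.
Qed.

Lemma rotation_polar (t r s : R) : rotation t (polar (r, s)) = polar (r, s + t).
Proof. by rewrite /rotation /polar /= cosD sinD; congr pair; ring. Qed.

Lemma leb2_polar_shift P X t : sigma_compact P -> sigma_compact X ->
  leb2 (polar @` (P `*` [set s | X (s + t)])) = leb2 (polar @` (P `*` X)).
Proof.
move=> cP cX; have mPX := measurable_polar_image cP cX.
rewrite -(leb2_rotation t mPX); congr (product_measure1 _ _ _).
apply/seteqP; split => [_ [[r s] /= [Pr Xs] <-]|z [[r s] /= [Pr Xs] e]].
  by exists (r, s + t); [split|rewrite rotation_polar].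
exists (r, s - t); first by split => //=; rewrite subrK.
by rewrite -(rotation_polar (- t)) e rotationD addNr /rotation cos0 sin0; case: z {e} => x y /=;
  congr pair; ring.
Qed.

Lemma leb2_polar_dilation P X c : 0 < c -> sigma_compact P -> sigma_compact X ->
  ((c ^+ 2)%:E * leb2 (polar @` ([set r | P (c * r)%R] `*` X)))%E = leb2 (polar @` (P `*` X)).
Proof.
move=> c0 cP cX; have mPX := measurable_polar_image cP cX.
rewrite -(leb2_dilation c0 mPX); congr (_ * product_measure1 _ _ _)%E.
apply/seteqP; split => [_ [[r s] /= [Pr Xs] <-]|z [[r s] /= [Pr Xs] e]].
  by exists (c * r, s) => //; rewrite /polar /= !mulrA.
exists (r / c, s); first by split => //=; rewrite mulrCA divff ?mulr1// gt_eqF.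
rewrite /polar/=; case: z e => x y; rewrite /polar /= => -[ex ey].
by congr pair; rewrite mulrAC ?ex ?ey mulrC mulKf// gt_eqF.
Qed.

Lemma polar_norm (p : R * R) : (polar p).1 ^+ 2 + (polar p).2 ^+ 2 = p.1 ^+ 2.
Proof. by rewrite /polar/= !exprMn -mulrDr cos2Dsin2 mulr1. Qed.

Lemma polar_radius_inj (p q : R * R) : 0 <= p.1 -> 0 <= q.1 -> polar p = polar q -> p.1 = q.1.
Proof.
move=> p0 q0 pq; apply/eqP; rewrite -(@eqrXn2 _ 2)//.
by rewrite -(polar_norm p) pq polar_norm.
Qed.

Lemma sigma_compact1 (r : R) : sigma_compact [set r].
Proof.
exists (fun=> [set r]); first by move=> _; exact: compact_set1.
by apply/seteqP; split => [x xr|x [n]//]; exists 0%N.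
Qed.

(** A vertical line meets a circle in at most two points. *)
Lemma leb2_polar_circle (r : R) X : sigma_compact X ->
  leb2 (polar @` ([set r] `*` X)) = 0%E.
Proof.
move=> cX; rewrite /product_measure1; apply: integral0_eq => x _ /=.
apply: countable_lebesgue_measure0.
apply: (@sub_countable _ _ _ ([set Num.sqrt (r ^+ 2 - x ^+ 2)] `|` [set - Num.sqrt (r ^+ 2 - x ^+ 2)])).
  apply: subset_card_le => y; rewrite /xsection/= inE => -[[_ s] /= [-> _]] e.
  have := polar_norm (r, s); rewrite e/= => e'.
  have /eqP : y ^+ 2 = Num.sqrt (r ^+ 2 - x ^+ 2) ^+ 2.
    rewrite sqr_sqrtr; first by rewrite -e'; ring.
    by rewrite -e' addrAC subrr add0r sqr_ge0.
  by rewrite eqf_sqr => /orP[/eqP|/eqP]; [left|right].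
by apply: finite_set_countable; rewrite finite_setU.
Qed.

Definition sector (r1 r2 : R) X : set (mR * mR) := polar @` (`]r1, r2[ `*` X).

Lemma sigma_compact_oo (a b : R) : sigma_compact `]a, b[.
Proof.
by apply: (@sigma_compact_itv _ a b) => //; exact: subset_itv_oo_cc.
Qed.

Lemma measurable_sector r1 r2 X : sigma_compact X -> measurable (sector r1 r2 X).
Proof. by move=> cX; apply: measurable_polar_image => //; exact: sigma_compact_oo. Qed.

(** By dilation, the areas of all the sectors with directions in [X] are multiples of this
    one. *)
Definition sector_area X : R := fine (leb2 (sector 0 1 X)).

Lemma sector01_fin X : sigma_compact X -> leb2 (sector 0 1 X) \is a fin_num.
Proof.
move=> cX; rewrite ge0_fin_numE//.
have m1 : measurable (`[-1, 1]%classic : set mR) by exact: measurable_itv.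
apply: (@le_lt_trans _ _ (leb2 (`[-1, 1]%classic `*` `[-1, 1]%classic))).
  apply: le_measure; rewrite ?inE; [exact: measurable_sector|exact: measurableX|].
  move=> z [[r s] /= [+ _] <-]; rewrite !in_itv/= => /andP[r0 r1].
  have r2 : `|r| <= 1 by rewrite gtr0_norm// ltW.
  split; rewrite /polar/= ?in_itv/= -?ler_norml normrM mulr_ile1//.
    by rewrite ler_norml cos_geN1 cos_le1.
  by rewrite ler_norml sin_geN1 sin_le1.
rewrite (product_measure1E leb leb m1 m1 : leb2 _ = leb _ * leb _)%E.
by rewrite !lebesgue_measure_itv/=; case: ifP => _; rewrite ?mule0 ?mul0e// -!EFinB -EFinM ltry.
Qed.

Lemma sector_area_ge0 X : 0 <= sector_area X.
Proof. exact: fine_ge0. Qed.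

Lemma leb2_sector0 r X : 0 <= r -> sigma_compact X ->
  leb2 (sector 0 r X) = (r ^+ 2 * sector_area X)%:E.
Proof.
rewrite le_eqVlt => /predU1P[<-|r0] cX.
  rewrite expr0n mul0r /sector (_ : _ @` _ = set0) ?measure0//.
  by apply/seteqP; split => z // [[x y] /= [+ _]]; rewrite in_itv/= => /andP[x0 /(lt_trans x0)]; rewrite ltxx.
rewrite EFinM /sector_area fineK ?sector01_fin//.
rewrite -(leb2_polar_dilation r0 (sigma_compact_oo _ _) cX); congr (_ * leb2 _)%E.
apply/seteqP; split => z [[x y] /= [+ Xy] <-] => h; exists (x, y) => //; split => //=; move: h.
  by rewrite !in_itv/= pmulr_rgt0// -ltr_pdivlMl// mulVf ?gt_eqF.
by rewrite !in_itv/= pmulr_rgt0// -ltr_pdivlMl// mulVf ?gt_eqF.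
Qed.

(** The sector of radius [r2] is made of the sector of radius [r1], a piece of circle, which
    is a null set, and the sector in between. *)
Lemma leb2_sector r1 r2 X : 0 <= r1 < r2 -> sigma_compact X ->
  leb2 (sector r1 r2 X) = ((r2 ^+ 2 - r1 ^+ 2) * sector_area X)%:E.
Proof.
move=> /andP[r10 r12] cX; have r20 := le_lt_trans r10 r12.
have m1 : measurable (polar @` ([set r1] `*` X)).
  by apply: measurable_polar_image => //; exact: sigma_compact1.
have m2 := measurable_sector 0 r1 cX.
have m3 := measurable_sector r1 r2 cX.
have [r1z|r1n] := eqVneq r1 0.
  by rewrite r1z leb2_sector0 ?(ltW r20)// expr0n subr0.
have r1p : 0 < r1 by rewrite lt_def r1n.
have : leb2 (sector 0 r2 X) =
    (leb2 (sector 0 r1 X) + (leb2 (polar @` ([set r1] `*` X)) + leb2 (sector r1 r2 X)))%E.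
  rewrite -measureU//; last first.
    apply/seteqP; split => z // [[p [/= p1 _] <-] [q [/= + _]]].
    rewrite in_itv/= => /andP[q1 q2] e.
    by have := polar_radius_inj _ _ e; rewrite p1 => /(_ _ _)/=; lra.
  rewrite -measureU//; [|exact: measurableU|].
    congr (leb2 _); apply/seteqP; split => z.
      move=> [[x y] /= [+ Xy] <-]; rewrite in_itv/= => /andP[x0 x2].
      have [xr|xr|xr] := ltgtP x r1.
      - by left; exists (x, y) => //=; rewrite in_itv/= x0 xr.
      - by right; right; exists (x, y) => //=; rewrite in_itv/= x2 xr.
      - by right; left; exists (x, y).
    move=> [|[|]] [[x y] /= [+ Xy] <-].
    - by rewrite in_itv/= => /andP[x0 x2]; exists (x, y) => //=; rewrite in_itv/=; split => //; lra.
    - by move=> ->; exists (r1, y) => //=; rewrite in_itv/= r1p r12.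
    - by rewrite in_itv/= => /andP[x0 x2]; exists (x, y) => //=; rewrite in_itv/=; split => //; lra.
  apply/seteqP; split => z // -[[p [/= + _] <-]]; rewrite in_itv/= => /andP[p1 p2].
  move=> [|] [q [/= + _]].
    by move=> q1 e; have := polar_radius_inj _ _ e; rewrite q1 => /(_ _ _)/=; lra.
  rewrite in_itv/= => /andP[q1 q2] e.
  by have := polar_radius_inj _ _ e => /(_ _ _)/=; lra.
rewrite leb2_polar_circle// add0e !leb2_sector0 ?(ltW r20)// => e.
have : leb2 (sector r1 r2 X) \is a fin_num.
  rewrite ge0_fin_numE//; apply: (@le_lt_trans _ _ (r2 ^+ 2 * sector_area X)%:E); last exact: ltry.
  by rewrite e leeDr// lee_fin mulr_ge0 ?sector_area_ge0// exprn_ge0.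
move=> /fineK; set x := fine _ => e'; move: e; rewrite -e' -EFinD => -[e].
by congr EFin; rewrite mulrBl e addrC addKr.
Qed.

End SectorArea.

(** * Comparison of sectors over comparable arcs *)

Section SectorComparison.
Variable R : realType.
Local Notation leb := (@lebesgue_measure R).
Local Notation leb2 := (leb \x leb)%E.
Local Notation mR := (measurableTypeR R).
Implicit Types (X Y : set R) (a b c d : R).

Lemma sectorU r1 r2 X Y : sector r1 r2 (X `|` Y) = sector r1 r2 X `|` sector r1 r2 Y.
Proof.
rewrite /sector -image_setU; congr image; apply/seteqP; split => -[x y] /=; tauto.
Qed.

Lemma sigma_compactU X Y : sigma_compact X -> sigma_compact Y -> sigma_compact (X `|` Y).
Proof.
move=> [F cF ->] [G cG ->]; exists (fun n => F n `|` G n).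
  by move=> n; exact: compactU.
apply/seteqP; split => x.
  by move=> [[n _ h]|[n _ h]]; exists n => //; [left|right].
by move=> [n _ [h|h]]; [left|right]; exists n.
Qed.

Lemma le_sector_area X Y : sigma_compact X -> sigma_compact Y -> X `<=` Y ->
  sector_area X <= sector_area Y.
Proof.
move=> cX cY XY; apply: fine_le; rewrite ?sector01_fin//.
apply: le_measure; rewrite ?inE; try exact: measurable_sector.
by move=> z [[x y] /= [hx /XY hy] <-]; exists (x, y).
Qed.

Lemma sector_areaU X Y : sigma_compact X -> sigma_compact Y ->
  sector_area (X `|` Y) <= sector_area X + sector_area Y.
Proof.
move=> cX cY; have cXY := sigma_compactU cX cY.
have mX := measurable_sector 0 1 cX; have mY := measurable_sector 0 1 cY.
rewrite -lee_fin EFinD /sector_area; do 3 (rewrite fineK; last exact: sector01_fin).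
by rewrite sectorU; exact: (measureU2 leb2 mX mY).
Qed.

(** A lift of an arc to an interval of angles of at most one turn; the end points may or may
    not belong to it. *)
Definition arc_lift a b X := [/\ a < b, b - a <= 2 * pi, `]a, b[ `<=` X & X `<=` `[a, b]].

Lemma arc_lift_compact a b X : arc_lift a b X -> sigma_compact X.
Proof. by move=> [_ _ h1 h2]; exact: sigma_compact_itv h1 h2. Qed.

Lemma arc_lift_shift a b X t : arc_lift a b X ->
  arc_lift (a - t) (b - t) [set s | X (s + t)].
Proof.
move=> [h1 h2 h3 h4]; split; [lra|lra| |] => x /=.
  by rewrite in_itv/= => hx; apply: h3; rewrite /= in_itv/=; lra.
by move=> /h4; rewrite /= !in_itv/=; lra.
Qed.

Lemma sector_area_shift t X : sigma_compact X ->
  sector_area [set s | X (s + t)] = sector_area X.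
Proof. by move=> cX; rewrite /sector_area /sector leb2_polar_shift//; exact: sigma_compact_oo. Qed.

(** Because [Y] may lack its end points, one translate of [Y] need not cover [X]; two
    overlapping translates do. *)
Lemma sector_area_le2 a b c d X Y : arc_lift a b X -> arc_lift c d Y -> b - a <= d - c ->
  sector_area X <= 2 * sector_area Y.
Proof.
move=> lX lY abcd.
(* The translates start at [a - (d - c) / 2] and at [a + (d - c) / 4]. *)
pose t1 := c - a + (d - c) / 2; pose t2 := c - a - (d - c) / 4.
have cX := arc_lift_compact lX; have cY := arc_lift_compact lY.
have c1 := arc_lift_compact (arc_lift_shift t1 lY).
have c2 := arc_lift_compact (arc_lift_shift t2 lY).
rewrite mulr_natl mulr2n -{1}(sector_area_shift t1 cY) -(sector_area_shift t2 cY).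
apply: le_trans (sector_areaU c1 c2); apply: le_sector_area => //.
  exact: sigma_compactU.
move: lX lY => [ab _ _ hX] [cd _ hY _] x /hX; rewrite /= in_itv/= => /andP[x1 x2].
have [h|h] := leP x (a + (d - c) / 3).
  by left; apply: hY; rewrite /= in_itv/= /t1; lra.
by right; apply: hY; rewrite /= in_itv/= /t2; lra.
Qed.

Definition left_half a b X := X `&` [set x | x <= (a + b) / 2].
Definition right_half a b X := X `&` [set x | (a + b) / 2 < x].

Lemma halvesU a b X : left_half a b X `|` right_half a b X = X.
Proof.
apply/seteqP; split => x; first by move=> [[]|[]].
by move=> Xx; have [h|h] := leP x ((a + b) / 2); [left|right].
Qed.

Lemma arc_lift_left a b X : arc_lift a b X -> arc_lift a ((a + b) / 2) (left_half a b X).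
Proof.
move=> [h1 h2 h3 h4]; split; [lra|lra| |] => x.
  rewrite /= in_itv/= => /andP[x1 x2]; split => /=; last lra.
  by apply: h3; rewrite /= in_itv/=; lra.
by move=> [/h4 /= + /= h]; rewrite !in_itv/= h andbT => /andP[].
Qed.

Lemma arc_lift_right a b X : arc_lift a b X -> arc_lift ((a + b) / 2) b (right_half a b X).
Proof.
move=> [h1 h2 h3 h4]; split; [lra|lra| |] => x.
  rewrite /= in_itv/= => /andP[x1 x2]; split => /=; last lra.
  by apply: h3; rewrite /= in_itv/=; lra.
by move=> [/h4 /= + /= h]; rewrite !in_itv/= (ltW h) /= => /andP[].
Qed.

(** Halving [X] repeatedly cuts it into [2 ^ n] arcs that are no longer than [Y]. *)
Lemma sector_area_comparable n a b c d X Y : arc_lift a b X -> arc_lift c d Y ->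
  b - a <= 2 ^+ n * (d - c) -> sector_area X <= 2 ^+ n.+1 * sector_area Y.
Proof.
elim: n a b X => [|n IH] a b X lX lY h.
  by rewrite expr1; apply: (sector_area_le2 lX lY); rewrite expr0 mul1r in h.
have lL := arc_lift_left lX; have lR := arc_lift_right lX.
rewrite -{1}(halvesU a b X).
apply: le_trans (sector_areaU (arc_lift_compact lL) (arc_lift_compact lR)) _.
rewrite exprS -mulrA mulr_natl mulr2n; rewrite exprS in h; apply: lerD.
  by apply: IH lL lY _; rewrite -mulrA in h; lra.
by apply: IH lR lY _; rewrite -mulrA in h; lra.
Qed.

Lemma arc_lift_circle : arc_lift 0 (2 * pi) (`[0, 2 * pi[%classic : set R).
Proof.
have p0 := pi_gt0 R; split; [lra|lra| |].
  exact: subset_itv_oo_co.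
exact: subset_itv_co_cc.
Qed.

(** The unit disc contains a square. *)
Lemma sector_area_circle_gt0 : 0 < sector_area (`[0, 2 * pi[%classic : set R).
Proof.
have cC := arc_lift_compact arc_lift_circle.
rewrite -lte_fin /sector_area fineK ?sector01_fin//.
have m1 : measurable (`]0, 2^-1[%classic : set mR) by exact: measurable_itv.
apply: (@lt_le_trans _ _ (leb2 (`]0, 2^-1[%classic `*` `]0, 2^-1[%classic))).
  rewrite (product_measure1E leb leb m1 m1 : leb2 _ = leb _ * leb _)%E.
  have h0 : 0 < 2^-1 :> R by rewrite invr_gt0.
  by rewrite !lebesgue_measure_itv/= lte_fin h0 oppr0 adde0 -EFinM lte_fin mulr_gt0.
apply: le_measure; rewrite ?inE; [exact: measurableX|exact: measurable_sector|].
move=> -[x y] /= []; rewrite !in_itv/= => /andP[x0 x1] /andP[y0 y1].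
pose r := Num.sqrt (x ^+ 2 + y ^+ 2).
have xy0 : 0 < x ^+ 2 + y ^+ 2 by rewrite addr_gt0// exprn_gt0.
have r0 : 0 < r by rewrite sqrtr_gt0.
have r2 : r ^+ 2 = x ^+ 2 + y ^+ 2 by rewrite sqr_sqrtr// ltW.
have xr : -1 <= x / r <= 1.
  have : x / r <= 1.
    rewrite ler_pdivrMr// mul1r -(@ler_pXn2r _ 2)// ?nnegrE ?ltW// r2.
    by rewrite ltrDl exprn_gt0.
  have : 0 < x / r by rewrite divr_gt0.
  lra.
exists (r, acos (x / r)) => /=.
  split => /=; rewrite in_itv/=.
    rewrite r0/= -(@ltr_pXn2r _ 2)// ?nnegrE ?ltW// r2 expr1n.
    by rewrite !expr2; nra.
  by have := acos_ge0 xr; have := acos_lepi xr; have := pi_gt0 R; lra.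
rewrite /polar/= acosK// sin_acos//; congr pair.
  by rewrite mulrC divfK// gt_eqF.
have -> : 1 - (x / r) ^+ 2 = (y / r) ^+ 2.
  have <- : (x ^+ 2 + y ^+ 2) / r ^+ 2 = 1 by rewrite -r2 divff// gt_eqF ?exprn_gt0.
  by rewrite !expr_div_n mulrDl addrAC subrr add0r.
by rewrite sqrtr_sqr gtr0_norm ?divr_gt0// mulrC divfK// gt_eqF.
Qed.

(** If this area vanished, so would that of every other arc, including the whole circle. *)
Lemma sector_area_gt0 a b X : arc_lift a b X -> 0 < sector_area X.
Proof.
move=> lX; have [ab _ _ _] := lX.
have [n hn] : exists n, 2 * pi - 0 <= 2 ^+ n * (b - a).
  exists (Num.truncn (2 * pi / (b - a))).+1.
  rewrite -ler_pdivrMr ?subr_gt0// subr0.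
  have := truncnS_gt (2 * pi / (b - a)) => /ltW /le_trans; apply.
  by rewrite -natrX ler_nat ltnW// ltn_expl.
have := sector_area_comparable arc_lift_circle lX hn.
move/(lt_le_trans sector_area_circle_gt0).
by rewrite pmulr_rgt0// exprn_gt0.
Qed.

End SectorComparison.

(** * Arcs of the circle and their lengths *)

Section Arcs.
Variable R : realType.
Local Notation leb := (@lebesgue_measure R).
Implicit Types (X Y : set R) (a b c d s t : R).
Local Notation tau := (2 * pi : R).
Local Notation cis := (@Defs.cis R).

Lemma tau_gt0 : 0 < tau.
Proof. by rewrite mulr_gt0 ?pi_gt0. Qed.

Lemma cis_period s (k : int) : cis (s + tau * k%:~R) = cis s.
Proof.
have hn (n : nat) u : cis (u + tau * n%:R) = cis u.
  have -> : tau * n%:R = (pi *+ 2) *+ n by rewrite -mulr_natr -[RHS]mulr_natr; congr (_ * _); lra.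
  by rewrite /cis (periodicn (@cosD2pi R)) (periodicn (@sinD2pi R)).
case: k => n; first exact: hn.
rewrite -(hn n.+1 (s + _)); congr cis; rewrite NegzE mulrNz mulrN; lra.
Qed.

Lemma mod_tau a t : exists k : int, a <= t + tau * k%:~R < a + tau.
Proof.
have t0 := tau_gt0; exists (- Num.floor ((t - a) / tau)).
have := floor_itv ((t - a) / tau).
rewrite ler_pdivlMr// ltr_pdivrMr// !intrD mulrNz => /andP[h1 h2].
by apply/andP; split; lra.
Qed.

Lemma cis_inj s t : `|s - t| < tau -> cis s = cis t -> s = t.
Proof.
wlog st : s t / t <= s.
  move=> H; have [h|h] := leP t s; first exact: H.
  by rewrite distrC => h1 /esym h2; apply/esym/H => //; exact: ltW.
rewrite ger0_norm ?subr_ge0// => h e; apply: contrapT => /eqP ne.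
have u0 : 0 < (s - t) / 2 < pi.
  have : t < s by rewrite lt_def ne st.
  by move=> ?; apply/andP; split; lra.
have s0 := sin_gt0_pi u0.
have : cos (s - t) = 1.
  by case: e => e1 e2; rewrite cosB e1 e2 -!expr2 cos2Dsin2.
rewrite [s - t]splitr cosD => c1.
have := cos2Dsin2 ((s - t) / 2); rewrite !expr2 => c2.
have : sin ((s - t) / 2) * sin ((s - t) / 2) > 0 by rewrite mulr_gt0.
lra.
Qed.

Lemma cis_eq_mod s t : cis s = cis t -> exists k : int, s = t + tau * k%:~R.
Proof.
move=> e; have [k /andP[k1 k2]] := mod_tau (s : R) t; exists k.
apply: cis_inj; last by rewrite cis_period.
by rewrite distrC ger0_norm; lra.
Qed.

Lemma cis_image_shift X (k : int) : cis @` [set s | X (s + tau * k%:~R)] = cis @` X.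
Proof.
apply/seteqP; split => _ [s /= Xs <-].
  by exists (s + tau * k%:~R) => //; exact: cis_period.
exists (s - tau * k%:~R); first by rewrite /= subrK.
by rewrite -(cis_period _ k) subrK.
Qed.

Lemma arc_lift_interval a b X : arc_lift a b X -> is_interval X.
Proof.
move=> [ab _ h1 h2] x y Xx Xy z /andP[xz zy].
have [->//|nx] := eqVneq z x; have [->//|ny] := eqVneq z y.
have /= := h2 _ Xx; have /= := h2 _ Xy; rewrite !in_itv/= => /andP[y1 y2] /andP[x1 x2].
apply: h1; rewrite /= in_itv/= (le_lt_trans x1) ?(lt_le_trans _ y2)// lt_def.
  by rewrite eq_sym ny zy.
by rewrite nx xz.
Qed.

(** The angles in [0, tau[ of points of the arc are those of [X] itself and, when [X] extends
    beyond [tau], those of the excess brought back by one turn. *)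
Let arc_measure_aux a b X : arc_lift a b X -> 0 <= a < tau ->
  leb (`[0, tau[ `&` cis @^-1` (cis @` X)) = (b - a)%:E.
Proof.
move=> lX /andP[a0 atau]; have [ab btau h1 h2] := lX; have t0 := tau_gt0.
set E := _ `&` _.
have EE : E = (`[0, tau[ `&` X) `|` (`[0, tau[ `&` [set s | X (s + tau)]).
  apply/seteqP; split => [s [s0 [x Xx]]|s [[s0 Xs]|[s0 Xs]]]; last first.
    by split => //; exists (s + tau) => //; rewrite -[tau]mulr1 (cis_period _ 1).
    by split => //; exists s.
  move=> /cis_eq_mod[k xk]; have /= := h2 _ Xx; move: (s0) => /=; rewrite !in_itv/=.
  move=> /andP[s1 s2] /andP[x1 x2].
  have km1 : (-1)%:~R < k%:~R :> R.
    by rewrite -(ltr_pM2l t0); rewrite mulrN1z; lra.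
  have k2 : k%:~R < 2%:~R :> R.
    by rewrite -(ltr_pM2l t0); rewrite (_ : 2%:~R = 2 :> R)//; lra.
  move: km1 k2; rewrite !ltr_int; case: k xk => [[|[|n]]|n]// xk _ _.
    by left; split => //; rewrite mulr0 addr0 in xk; rewrite -xk.
  by right; split => //=; rewrite mulr1 in xk; rewrite -xk.
have mi (J : set R) : is_interval J -> measurable (J : set (measurableTypeR R)).
  exact: is_interval_measurable.
have mitv c d (p q : bool) : measurable ([set` Interval (BSide p c) (BSide q d)] : set (measurableTypeR R)).
  exact: measurable_itv.
have mE : measurable (E : set (measurableTypeR R)).
  rewrite EE; apply: measurableU; apply: measurableI => //.
    by apply: mi; exact: arc_lift_interval lX.
  apply: mi => x y /= Xx Xy z xyz.
  by apply: (arc_lift_interval lX Xx Xy); lra.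
have le_leb (A B : set (measurableTypeR R)) : measurable A -> measurable B -> A `<=` B ->
    (leb A <= leb B)%E by move=> mA mB AB; apply: le_measure; rewrite ?inE.
have lebU (A B : set (measurableTypeR R)) : measurable A -> measurable B ->
    (leb (A `|` B) <= leb A + leb B)%E by exact: measureU2.
have lebU0 (A B : set (measurableTypeR R)) : measurable A -> measurable B -> A `&` B = set0 ->
    leb (A `|` B) = (leb A + leb B)%E by exact: measureU.
apply/eqP; rewrite eq_le; apply/andP; split.
- have [hb|hb] := leP b tau.
    apply: (@le_trans _ _ (leb (`[a, b] `|` `[0, 0]))).
      apply: le_leb => //; first exact: measurableU.
      rewrite EE => s [[/= + /h2]|[/= + /h2]]; rewrite /= !in_itv/=; first by left.
      by move=> /andP[s1 s2] /andP[s3 s4]; right; apply/andP; split; lra.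
    apply: (le_trans (lebU _ _ (mitv _ _ _ _) (mitv _ _ _ _))).
    by rewrite !lebesgue_measure_itv/= !lte_fin ab ltxx adde0.
  apply: (@le_trans _ _ (leb (`[a, tau] `|` `[0, b - tau]))).
    apply: le_leb => //; first exact: measurableU.
    rewrite EE => s [[/= + /h2]|[/= + /h2]]; rewrite /= !in_itv/=.
      by move=> /andP[s1 s2] /andP[s3 s4]; left; apply/andP; split; lra.
    by move=> /andP[s1 s2] /andP[s3 s4]; right; apply/andP; split; lra.
  apply: (le_trans (lebU _ _ (mitv _ _ _ _) (mitv _ _ _ _))).
  rewrite !lebesgue_measure_itv/= !lte_fin atau subr_gt0 hb -!EFinB -EFinD lee_fin; lra.
- have [hb|hb] := leP b tau.
    rewrite (_ : (b - a)%:E = leb `]a, b[); last first.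
      by rewrite lebesgue_measure_itv/= lte_fin ab.
    apply: le_leb => //; rewrite EE => s sab; left; split; last exact: h1.
    by move: sab; rewrite /= !in_itv/= => /andP[s1 s2]; apply/andP; split; lra.
  rewrite (_ : (b - a)%:E = leb (`]a, tau[ `|` `[0, b - tau[)); last first.
    rewrite lebU0//.
      rewrite !lebesgue_measure_itv/= !lte_fin atau subr_gt0 hb -!EFinB -EFinD.
      by congr EFin; lra.
    apply/seteqP; split => s //= []; rewrite !in_itv/= => /andP[s1 s2] /andP[s3 s4]; lra.
  apply: le_leb => //; first exact: measurableU.
  rewrite EE => s [|] /=; rewrite in_itv/= => /andP[s1 s2].
    left; split; first by rewrite /= in_itv/=; apply/andP; split; lra.
    by apply: h1; rewrite /= in_itv/=; apply/andP; split; lra.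
  right; split; first by rewrite /= in_itv/=; apply/andP; split; lra.
  by apply: h1; rewrite /= in_itv/=; apply/andP; split; lra.
Qed.

Lemma arc_lengthE a b X : arc_lift a b X -> arc_length (cis @` X) = ((b - a) / tau)%:E.
Proof.
move=> lX; have [k hk] := mod_tau 0 a.
have lX' := arc_lift_shift (- (tau * k%:~R)) lX.
rewrite /arc_length -(cis_image_shift X (- k)).
rewrite mulrNz mulrN in lX' *.
rewrite (arc_measure_aux lX'); last by rewrite opprK; rewrite add0r in hk.
rewrite inver gt_eqF ?tau_gt0// -EFinM; congr (EFin (_ / _)); lra.
Qed.

Lemma arc_lift_arc a b X : arc_lift a b X -> is_arc (cis @` X).
Proof.
move=> lX; split; last by exists X => //; exact: arc_lift_interval lX.
by rewrite (arc_lengthE lX) lte_fin divr_gt0 ?tau_gt0// subr_gt0; case: lX.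
Qed.

(** Parametrising an arc injectively: an interval that is too long for that wraps
    around, and then its image is the whole circle. *)
Lemma is_arcP (I : set (R * R)) : is_arc I -> exists a b X,
  [/\ arc_lift a b X, I = cis @` X & forall s t, X s -> X t -> `|s - t| < tau].
Proof.
have t0 := tau_gt0.
move=> [I0 [J iJ IJ]]; have [[x [y [Jx Jy xy]]]|short] :=
    pselect (exists x y, [/\ J x, J y & x + tau <= y]).
  exists 0, tau, `[0, tau[%classic; split; first exact: arc_lift_circle.
  - rewrite IJ; apply/seteqP; split => _ [t /= Jt <-].
      have [k hk] := mod_tau 0 t; exists (t + tau * k%:~R); last exact: cis_period.
      by rewrite /= in_itv/=; rewrite add0r in hk.
    have [k /andP[k1 k2]] := mod_tau x t; exists (t + tau * k%:~R); last exact: cis_period.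
    by apply: (iJ _ _ Jx Jy); rewrite k1/= ltW// (lt_le_trans k2).
  - move=> s t; rewrite /= !in_itv/= => /andP[s1 s2] /andP[u1 u2].
    by rewrite ltr_norml; apply/andP; split; lra.
have close s t : J s -> J t -> `|s - t| < tau.
  have aux u v : J u -> J v -> u - v < tau.
    move=> Ju Jv; rewrite ltNge; apply/negP => h; apply: short; exists v, u; split => //; lra.
  by move=> Js Jt; have := aux _ _ Js Jt; have := aux _ _ Jt Js; rewrite ltr_norml => ? ?; apply/andP; split; lra.
have [x0 Jx0] : J !=set0.
  apply/set0P/eqP => J0; move: I0; rewrite IJ J0 image_set0 /arc_length preimage_set0 setI0.
  by rewrite measure0 mul0e ltxx.
have near s : J s -> x0 - tau <= s <= x0 + tau.
  by move=> /close/(_ Jx0); rewrite ltr_norml => /andP[h1 h2]; apply/andP; split; lra.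
have hinf : has_inf J.
  by split; [exists x0|exists (x0 - tau) => s /near /andP[]].
have hsup : has_sup J.
  by split; [exists x0|exists (x0 + tau) => s /near /andP[]].
exists (inf J), (sup J), J; split => //.
have Jin s : J s -> inf J <= s <= sup J.
  move=> Js; apply/andP; split; first exact: (ge_inf hinf.2).
  exact: (ub_le_sup hsup.2).
split => //.
- rewrite ltNge; apply/negP => ba.
  have Jone s : J s -> s = x0.
    by move=> /Jin /andP[s1 s2]; have /andP[u1 u2] := Jin _ Jx0; lra.
  move: I0; rewrite IJ /arc_length countable_lebesgue_measure0 ?mul0e ?ltxx//.
  have [k hk] := mod_tau 0 x0.
  apply: (@sub_countable _ _ _ [set x0 + tau * k%:~R]); last exact: finite_set_countable.
  apply: subset_card_le => s [/= + [u /Jone ->]]; rewrite in_itv/= => hs e.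
  apply: cis_inj; last by rewrite cis_period.
  by move: hs hk => /andP[s1 s2] /andP[k1 k2]; rewrite ltr_norml; apply/andP; split; lra.
- rewrite lerBlDr; apply: ge_sup; first by exists x0.
  move=> s Js; rewrite -lerBlDl; apply: lb_le_inf; first by exists x0.
  by move=> t Jt; have := close _ _ Js Jt; rewrite ltr_norml => /andP[h1 h2]; lra.
- move=> s; rewrite /= in_itv/= => /andP[s1 s2].
  have s3 : 0 < s - inf J by lra.
  have s4 : 0 < sup J - s by lra.
  have [u Ju us] := inf_adherent s3 hinf; have [v Jv vs] := sup_adherent s4 hsup.
  by apply: (iJ _ _ Ju Jv); apply/andP; split; lra.
Qed.

End Arcs.

(** * Binary trees of sets exhausted by their tops *)

Section CarlesonTree.
Local Open Scope ereal_scope.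
Context d (T : measurableType d) (R : realType) (mu : {measure set T -> \bar R}).
Variables (A : Type) (Q : A -> set T) (l r : A -> A) (D : set T).

Definition top_part I : set T := Q I `\` (Q (l I) `|` Q (r I)).

(** The tops of the first [n] generations, on which a weight stays within a factor [C ^ n] of
    its value at the top of [I]; [strip] is what remains, near the boundary. *)
Fixpoint body n I : set T :=
  if n is n'.+1 then top_part I `|` (body n' (l I) `|` body n' (r I)) else set0.

Definition strip n I : set T := Q I `\` body n I.

(** What the analysis retains of Carleson squares and of the halving of arcs. As every top
    takes a fixed fraction of the measure of its node, the measure of the strips decays
    geometrically. *)
Record carleson_tree (eps : R) : Prop := CarlesonTree {
  tree_mD : measurable D;
  tree_QD : forall I, Q I `<=` D;
  tree_mQ : forall I, measurable (Q I);
  tree_left : forall I, Q (l I) `<=` Q I;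
  tree_right : forall I, Q (r I) `<=` Q I;
  tree_disj : forall I, Q (l I) `&` Q (r I) = set0;
  tree_pos : forall I, 0 < mu (Q I);
  tree_fin : forall I, mu (Q I) < +oo;
  tree_exhaust : forall I z, Q I z -> exists n, body n I z;
  tree_eps : (0 < eps < 1)%R;
  tree_top : forall I, eps%:E * mu (Q I) <= mu (top_part I) }.

Variable eps : R.
Hypothesis tree : carleson_tree eps.
Implicit Types (F G : T -> \bar R) (I : A) (n : nat).

Let mD := tree_mD tree.
Let mQ := tree_mQ tree.
Let QD := tree_QD tree.

Lemma measurable_top I : measurable (top_part I).
Proof. by apply: measurableD => //; exact: measurableU. Qed.

Lemma measurable_body n I : measurable (body n I).
Proof.
elim: n I => [|n IH] I /=; first exact: measurable0.
by apply: measurableU; [exact: measurable_top|exact: measurableU].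
Qed.

Lemma body_sub n I : body n I `<=` Q I.
Proof.
elim: n I => [|n IH] I //= z [[]//|[/IH|/IH]].
  exact: (tree_left tree).
exact: (tree_right tree).
Qed.

Lemma measurable_strip n I : measurable (strip n I).
Proof. by apply: measurableD => //; exact: measurable_body. Qed.

Lemma top_sub I : top_part I `<=` Q I. Proof. by move=> z []. Qed.

Lemma QE I : Q I = top_part I `|` (Q (l I) `|` Q (r I)).
Proof.
apply/seteqP; split => z; last first.
  by move=> [[]//|[]]; [exact: (tree_left tree)|exact: (tree_right tree)].
by move=> Qz; have [h|h] := pselect ((Q (l I) `|` Q (r I)) z); [right|left].
Qed.

Lemma stripS n I : strip n.+1 I = strip n (l I) `|` strip n (r I).
Proof.
have dis := tree_disj tree I; have Il := tree_left tree (I := I).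
have Ir := tree_right tree (I := I).
have nlr z : Q (l I) z -> Q (r I) z -> False.
  by move=> h1 h2; have : (Q (l I) `&` Q (r I)) z by []; rewrite dis.
apply/seteqP; split => z; rewrite /strip /=.
  move=> [Qz nb]; have [h|h] := pselect ((Q (l I) `|` Q (r I)) z); last first.
    by exfalso; apply: nb; left.
  by case: h => h; [left|right]; split => // hb; apply: nb; right; [left|right].
move=> [[h nb]|[h nb]]; (split; first by [exact: Il|exact: Ir]).
  move=> [[_]|[|]]; [by apply; left|exact: nb|].
  by move=> /body_sub; exact: nlr.
move=> [[_]|[|]]; [by apply; right| |exact: nb].
by move=> /body_sub h'; exact: nlr h' h.
Qed.

Lemma measurable_fun_Q I F : measurable_fun D F -> measurable_fun (Q I) F.
Proof. by move=> mF; apply: measurable_funS mF => //; exact: QD. Qed.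

Section Integrals.
Variable F : T -> \bar R.
Hypothesis mF : measurable_fun D F.
Hypothesis F0 : forall z, D z -> 0 <= F z.
Local Notation int B := (\int[mu]_(z in B) F z).

Lemma integral_sub_ge0 (B : set T) : B `<=` D -> 0 <= int B.
Proof. by move=> BD; apply: integral_ge0 => z /BD /F0. Qed.

Lemma integral_disjU (B1 B2 : set T) : B1 `<=` D -> B2 `<=` D -> measurable B1 ->
  measurable B2 -> B1 `&` B2 = set0 -> int (B1 `|` B2) = int B1 + int B2.
Proof.
move=> B1D B2D mB1 mB2 B12; apply: ge0_integral_setU => //.
- by apply: measurable_funS mF => //; rewrite subUset.
- by move=> z [/B1D|/B2D]; exact: F0.
- exact/disj_set2P.
Qed.

Lemma integral_mono (B1 B2 : set T) : B1 `<=` B2 -> B2 `<=` D -> measurable B1 ->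
  measurable B2 -> int B1 <= int B2.
Proof.
move=> B12 B2D mB1 mB2; apply: ge0_subset_integral => //.
- exact: measurable_funS mF.
- by move=> z /B2D; exact: F0.
Qed.

Lemma integral_nodeU (B1 B2 B3 : set T) I : measurable B1 -> measurable B2 -> measurable B3 ->
  B1 `<=` top_part I -> B2 `<=` Q (l I) -> B3 `<=` Q (r I) ->
  int (B1 `|` (B2 `|` B3)) = int B1 + (int B2 + int B3).
Proof.
move=> m1 m2 m3 s1 s2 s3.
have D2 : B2 `<=` D by apply: subset_trans s2 _; exact: QD.
have D3 : B3 `<=` D by apply: subset_trans s3 _; exact: QD.
rewrite integral_disjU//.
- rewrite (integral_disjU D2 D3)//; apply/seteqP; split => z // [/s2 h2 /s3 h3].
  by rewrite -(tree_disj tree I).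
- by move=> z /s1 /top_sub; exact: QD.
- by move=> z [/D2|/D3].
- exact: measurableU.
- by apply/seteqP; split => z // [/s1 [_ h] [/s2|/s3] h']; apply: h; [left|right].
Qed.

Lemma integral_Q I : int (Q I) = int (top_part I) + (int (Q (l I)) + int (Q (r I))).
Proof. by rewrite {1}QE (@integral_nodeU _ _ _ I)//; exact: measurable_top. Qed.

Lemma integral_bodyS n I :
  int (body n.+1 I) = int (top_part I) + (int (body n (l I)) + int (body n (r I))).
Proof.
by apply: (@integral_nodeU _ _ _ I); [exact: measurable_top|exact: measurable_body|
  exact: measurable_body|by []|exact: body_sub|exact: body_sub].
Qed.

Lemma integral_Q_strip n I : int (Q I) = int (body n I) + int (strip n I).
Proof.
rewrite -integral_disjU.
- by congr (integral _ _ _); rewrite setDUK//; exact: body_sub.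
- by move=> z /body_sub; exact: QD.
- by move=> z []; move/QD.
- exact: measurable_body.
- exact: measurable_strip.
- exact: setDIK.
Qed.

Lemma integral_stripS n I : int (strip n.+1 I) = int (strip n (l I)) + int (strip n (r I)).
Proof.
rewrite stripS integral_disjU//.
- by move=> z [] /QD.
- by move=> z [] /QD.
- exact: measurable_strip.
- exact: measurable_strip.
- apply/seteqP; split => z // [[h1 _] [h2 _]].
  by rewrite -(tree_disj tree I).
Qed.

(** Bounds on the integral over a node may thus be proved by induction on the number of
    generations. *)
Lemma integral_le_body I (b : \bar R) : (forall n, int (body n I) <= b) -> int (Q I) <= b.
Proof.
move=> hb; have -> : Q I = \bigcup_n body n I.
  apply/seteqP; split => [z /(tree_exhaust tree) [n]|z [n _ /body_sub]//].
  by exists n.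
have inc k J : body k J `<=` body k.+1 J.
  elim: k J => [|k IH] J //= z [?|[/IH|/IH] ?]; [by left|by right; left|by right; right].
have cv : (int (body n I)) @[n --> \oo] --> int (\bigcup_n body n I).
  apply: ge0_nondecreasing_set_cvg_integral.
  - by apply/nondecreasing_seqP => n; apply/subsetPset; exact: inc.
  - by move=> n; exact: measurable_body.
  - by move=> n; apply: measurable_funS mF => //; move=> z /body_sub; exact: QD.
  - by move=> n z /body_sub /QD; exact: F0.
by rewrite -(cvg_lim _ cv)//; apply: lime_le; [apply/cvg_ex; eexists; exact: cv|exact: nearW].
Qed.

End Integrals.

Lemma mu_finE I : mu (Q I) = (fine (mu (Q I)))%:E.
Proof. by rewrite fineK// ge0_fin_numE//; exact: (tree_fin tree). Qed.

Lemma fine_mu_gt0 I : (0 < fine (mu (Q I)))%R.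
Proof. by rewrite -lte_fin -mu_finE; exact: (tree_pos tree). Qed.

Lemma mu_sub_Q (B : set T) I : measurable B -> B `<=` Q I -> mu B <= mu (Q I).
Proof. by move=> mB BQ; apply: le_measure; rewrite ?inE. Qed.

Lemma mu_sub_finE (B : set T) I : measurable B -> B `<=` Q I -> mu B = (fine (mu B))%:E.
Proof.
move=> mB BQ; rewrite fineK// ge0_fin_numE//; apply: le_lt_trans (tree_fin tree I).
exact: mu_sub_Q.
Qed.

Lemma mu_children I : mu (Q (l I)) + mu (Q (r I)) <= (1 - eps)%:E * mu (Q I).
Proof.
have := tree_top tree I.
have mt := measurable_top I.
have : mu (Q I) = mu (top_part I) + (mu (Q (l I)) + mu (Q (r I))).
  rewrite -(measureU mu (mQ _) (mQ _) (tree_disj tree I)).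
  rewrite -(measureU mu mt (measurableU _ _ (mQ _) (mQ _))) -?QE//.
  by rewrite setIC; exact: setDIK.
rewrite (mu_sub_finE mt (@top_sub I)) (mu_finE I) (mu_finE (l I)) (mu_finE (r I)).
rewrite -!EFinD => -[e]; rewrite -!EFinM !lee_fin; lra.
Qed.

Lemma mu_strip n I : mu (strip n I) <= ((1 - eps) ^+ n)%:E * mu (Q I).
Proof.
have /andP[e0 e1] := tree_eps tree.
elim: n I => [|n IH] I.
  by rewrite expr0 mul1e; apply: mu_sub_Q; [exact: measurable_strip|by move=> z []].
rewrite stripS; apply: le_trans (measureU2 mu (measurable_strip _ _) (measurable_strip _ _)) _.
apply: le_trans (leeD (IH _) (IH _)) _.
rewrite -ge0_muleDr// exprSr EFinM -muleA.
by apply: lee_wpmul2l; [rewrite lee_fin exprn_ge0// subr_ge0 ltW|exact: mu_children].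
Qed.

(** The factor [U] grows by at most [rho] per generation, while the mass of [G] left for the
    children shrinks by the factor [1 - kappa]: the contributions of the generations to the integral
    of [F] are dominated by a geometric series of ratio [rho * (1 - kappa)]. *)
Lemma tree_growth F G (U : A -> R) (rho kappa : R) I :
  measurable_fun D F -> (forall z, D z -> 0 <= F z) ->
  measurable_fun D G -> (forall z, D z -> 0 <= G z) ->
  (forall J, \int[mu]_(z in Q J) G z < +oo) ->
  (forall J, 0 < U J)%R -> (0 <= rho)%R -> (rho * (1 - kappa) < 1)%R ->
  (forall J, U (l J) <= rho * U J)%R -> (forall J, U (r J) <= rho * U J)%R ->
  (forall J, \int[mu]_(z in top_part J) F z <= (U J)%:E * \int[mu]_(z in top_part J) G z) ->
  (forall J, kappa%:E * \int[mu]_(z in Q J) G z <= \int[mu]_(z in top_part J) G z) ->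
  \int[mu]_(z in Q I) F z <= (U I / (1 - rho * (1 - kappa)))%:E * \int[mu]_(z in Q I) G z.
Proof.
move=> mF F0 mG G0 Gfin U0 rho0 rk1 Ul Ur FG Gtop.
set den := (1 - rho * (1 - kappa))%R; have den0 : (0 < den)%R by rewrite subr_gt0.
apply: integral_le_body => // n; elim: n I => [|n IH] I.
  rewrite integral_set0 mule_ge0//; first by rewrite lee_fin divr_ge0 ?ltW.
  exact: integral_sub_ge0.
rewrite integral_bodyS//.
have gfin (B : set T) : B `<=` Q I -> measurable B ->
    \int[mu]_(z in B) G z = (fine (\int[mu]_(z in B) G z))%:E.
  move=> BQ mB; have BD : B `<=` D by apply: subset_trans BQ _; exact: QD.
  rewrite fineK// ge0_fin_numE; last exact: integral_sub_ge0.
  by apply: le_lt_trans (Gfin I); apply: integral_mono.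
have gt := gfin _ (@top_sub I) (measurable_top I).
have gl := gfin _ (tree_left tree (I := I)) (mQ _).
have gr := gfin _ (tree_right tree (I := I)) (mQ _).
have gI := gfin _ (@subset_refl _ _) (mQ _).
have g0 (B : set T) : B `<=` Q I -> (0 <= fine (\int[mu]_(z in B) G z))%R.
  by move=> BQ; apply: fine_ge0; apply: integral_sub_ge0 => //; apply: subset_trans BQ _; exact: QD.
have gt0 := g0 _ (@top_sub I); have gl0 := g0 _ (tree_left tree (I := I)).
have gr0 := g0 _ (tree_right tree (I := I)).
apply: le_trans (leeD (FG I) (leeD (IH (l I)) (IH (r I)))) _.
have := Gtop I; have := integral_Q mG G0 I.
rewrite gt gl gr gI.
set a := fine _ in gt0 *; set b := fine _ in gl0 *; set c := fine _ in gr0 *; set q := fine _.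
rewrite -?EFinM -!EFinD => -[qE]; rewrite !lee_fin => kq.
have U1 := U0 I.
have h1 : (U (l I) / den * b <= rho * U I / den * b)%R.
  by rewrite ler_wpM2r// ler_wpM2r ?invr_ge0 ?(ltW den0).
have h2 : (U (r I) / den * c <= rho * U I / den * c)%R.
  by rewrite ler_wpM2r// ler_wpM2r ?invr_ge0 ?(ltW den0).
apply: (@le_trans _ _ (U I * a + (rho * U I / den * b + rho * U I / den * c)))%R.
  by rewrite lerD2l lerD.
have -> : (U I * a + (rho * U I / den * b + rho * U I / den * c) =
   U I / den * (den * a + rho * (b + c)))%R by field; rewrite gt_eqF.
rewrite ler_wpM2l ?divr_ge0 ?(ltW U1) ?(ltW den0)//.
have bc : (b + c <= (1 - kappa) * q)%R by lra.
have h3 : (rho * (b + c) <= rho * ((1 - kappa) * q))%R by rewrite ler_wpM2l.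
have h4 : (den * a <= den * q)%R by rewrite ler_wpM2l ?(ltW den0)//; lra.
have : (den * q + rho * ((1 - kappa) * q) = q)%R by rewrite /den; ring.
lra.
Qed.

(** * Weights almost constant on tops *)

Variables (w : T -> \bar R) (v : A -> R) (C : R).

(** [v I] stands for the value of [w] on the top of [I]. Its control from a node to its
    children has to be assumed, because the tops are disjoint. *)
Record tree_weight : Prop := TreeWeight {
  weight_mf : measurable_fun D w;
  weight_ge0 : forall z, D z -> 0 <= w z;
  weight_C : (1 <= C)%R;
  weight_v : forall I, (0 < v I)%R;
  weight_left : forall I, (v I <= C * v (l I) /\ v (l I) <= C * v I)%R;
  weight_right : forall I, (v I <= C * v (r I) /\ v (r I) <= C * v I)%R;
  weight_top : forall I, {ae mu, forall z, top_part I z -> (v I)%:E <= w z <= (C * v I)%:E} }.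

Hypothesis tw : tree_weight.
Let mw := weight_mf tw.
Let w0 := weight_ge0 tw.
Let C1 := weight_C tw.
Let v0 := weight_v tw.
Let C0 : (0 < C)%R. Proof. exact: lt_le_trans C1. Qed.

Lemma body_bounds n I : {ae mu, forall z, body n I z ->
  (v I / C ^+ n)%:E <= w z <= (C ^+ n * v I)%:E}.
Proof.
elim: n I => [|n IH] I; first exact: aeW.
have Cn m : (0 < C ^+ m)%R by rewrite exprn_gt0.
have [l1 l2] := weight_left tw I; have [r1 r2] := weight_right tw I.
have child J : (v I <= C * v J)%R -> (v J <= C * v I)%R ->
    (v I / C ^+ n.+1 <= v J / C ^+ n /\ C ^+ n * v J <= C ^+ n.+1 * v I)%R.
  move=> h1 h2; split; last by rewrite exprSr -mulrA ler_wpM2l// ltW.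
  by rewrite ler_pdivrMr// mulrAC ler_pdivlMr// exprS mulrA [(v J * _)%R]mulrC ler_wpM2r// ltW.
have [ll lu] := child _ l1 l2; have [rl ru] := child _ r1 r2.
have [h1 h2] : (v I / C ^+ n.+1 <= v I /\ C * v I <= C ^+ n.+1 * v I)%R.
  split; first by rewrite ler_pdivrMr// ler_peMr ?(ltW (v0 _))// exprn_ege1.
  by rewrite exprS -mulrA ler_wpM2l ?(ltW C0)// ler_peMl ?(ltW (v0 _))// exprn_ege1.
have wt := weight_top tw I.
apply: filterS3 wt (IH (l I)) (IH (r I)) => z a1 a2 a3 /= [/a1|[/a2|/a3]] /andP[u1 u2];
  by apply/andP; split; [apply: le_trans u1|apply: (le_trans u2)]; rewrite lee_fin.
Qed.

Lemma weight_pos_fin I : {ae mu, forall z, Q I z -> exists2 x : R, (0 < x)%R & w z = x%:E}.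
Proof.
have := ae_foralln (fun n => body_bounds n I); apply: filterS => z h Qz.
have [n /h/andP[h1 h2]] := tree_exhaust tree Qz.
have p0 : (0 < v I / C ^+ n)%R by rewrite divr_gt0// exprn_gt0.
case: (w z) h1 h2 => [x||]//; rewrite !lee_fin => h1 _.
by exists x => //; exact: lt_le_trans h1.
Qed.

(** The pivot of all the equivalences. The opposite inequality, up to a constant, holds
    for every weight: see [integral_Q_ge]. *)
Definition top_dominated := exists2 K : R, (0 < K)%R &
  forall I, \int[mu]_(z in Q I) w z <= (K * v I)%:E * mu (Q I).

Lemma integral_body_le n I :
  \int[mu]_(z in body n I) w z <= (C ^+ n * v I)%:E * mu (Q I).
Proof.
have vn : 0 <= (C ^+ n * v I)%:E by rewrite lee_fin mulr_ge0 ?exprn_ge0 ?ltW.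
have mb := measurable_body n I.
have bD : body n I `<=` D by move=> z /body_sub; exact: QD.
apply: (@le_trans _ _ (\int[mu]_(z in body n I) cst (C ^+ n * v I)%:E z)).
  apply: ae_ge0_le_integral => //.
  - by move=> z /bD; exact: w0.
  - exact: measurable_funS mw.
  - by apply: filterS (body_bounds n I) => z h /h /andP[].
rewrite integral_cst//; apply: lee_wpmul2l => //.
by apply: mu_sub_Q => //; exact: body_sub.
Qed.

Lemma integral_top_ge I : (v I)%:E * mu (top_part I) <= \int[mu]_(z in top_part I) w z.
Proof.
have mt := measurable_top I.
have tD : top_part I `<=` D by move=> z /top_sub; exact: QD.
rewrite -integral_cst//; apply: ae_ge0_le_integral => //.
- by move=> z _; rewrite lee_fin ltW.
- by move=> z /tD; exact: w0.
- exact: measurable_funS mw.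
- by apply: filterS (weight_top tw I) => z h /h /andP[].
Qed.

Lemma integral_Q_ge I : (eps * v I)%:E * mu (Q I) <= \int[mu]_(z in Q I) w z.
Proof.
apply: (@le_trans _ _ (\int[mu]_(z in top_part I) w z)); last first.
  by apply: integral_mono => //; [exact: top_sub|exact: measurable_top].
apply: le_trans (integral_top_ge I); rewrite mulrC EFinM -muleA.
by apply: lee_wpmul2l; [rewrite lee_fin ltW|exact: (tree_top tree)].
Qed.

Hypothesis wfin : forall I, \int[mu]_(z in Q I) w z < +oo.

Lemma weight_finE I (B : set T) : measurable B -> B `<=` Q I ->
  \int[mu]_(z in B) w z = (fine (\int[mu]_(z in B) w z))%:E.
Proof.
move=> mB BQ; have BD : B `<=` D by apply: subset_trans BQ _; exact: QD.
rewrite fineK// ge0_fin_numE; last exact: integral_sub_ge0.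
by apply: le_lt_trans (wfin I); apply: integral_mono.
Qed.

Definition mean I : R := fine (\int[mu]_(z in Q I) w z) / fine (mu (Q I)).

Lemma integral_mean I : \int[mu]_(z in Q I) w z = (mean I * fine (mu (Q I)))%:E.
Proof.
rewrite (weight_finE (mQ I) (@subset_refl _ _)) /mean divfK//.
by rewrite gt_eqF// fine_mu_gt0.
Qed.

Lemma averageE I : \int[mu]_(z in Q I) w z / mu (Q I) = (mean I)%:E.
Proof.
rewrite integral_mean (mu_finE I) inver gt_eqF ?fine_mu_gt0// -EFinM; congr EFin.
by rewrite mulfK// gt_eqF// fine_mu_gt0.
Qed.

Lemma mean_ge I : (eps * v I <= mean I)%R.
Proof.
have := integral_Q_ge I; rewrite integral_mean (mu_finE I) -EFinM lee_fin.
by rewrite ler_pM2r// fine_mu_gt0.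
Qed.

Lemma mean_gt0 I : (0 < mean I)%R.
Proof.
have /andP[e0 _] := tree_eps tree.
by apply: lt_le_trans (mean_ge I); rewrite mulr_gt0.
Qed.

Lemma top_dominatedP : top_dominated <-> exists2 K : R, (0 < K)%R & forall I, (mean I <= K * v I)%R.
Proof.
by split=> -[K K0 h]; exists K => // I; have := h I;
  rewrite integral_mean (mu_finE I) -EFinM lee_fin ler_pM2r ?fine_mu_gt0.
Qed.

(** The mass that is not near the boundary sits in finitely many generations, where the
    weight is comparable to [v I]. *)
Lemma strip_top_dominated n (b : R) : (b < 1)%R ->
  (forall I, \int[mu]_(z in strip n I) w z <= b%:E * \int[mu]_(z in Q I) w z) ->
  top_dominated.
Proof.
move=> b1 h; apply/top_dominatedP; exists (C ^+ n / (1 - b))%R.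
  by rewrite divr_gt0 ?exprn_gt0 ?subr_gt0.
move=> I; have hs := h I; have hb := integral_body_le n I.
have := integral_Q_strip mw w0 n I; move: hs hb.
rewrite (weight_finE (measurable_body n I) (@body_sub n I)).
rewrite (@weight_finE I _ (measurable_strip n I)); last by move=> z [].
rewrite (mu_finE I) integral_mean -!EFinM -EFinD !lee_fin.
have q0 := fine_mu_gt0 I; set q := fine (mu _) in q0 *.
set x := fine _; set y := fine _ => h1 h2 [h3].
rewrite mulrAC ler_pdivlMr ?subr_gt0// -(ler_pM2r q0).
by move: h1 h2 h3; lra.
Qed.

(** * Uniform integrability *)

Lemma measurable_lne : measurable_fun [set: \bar R] (@lne R).
Proof.
have -> : @lne R = (fun x => if x <= 0 then -oo else if x == +oo then +oo else (ln (fine x))%:E).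
  by apply/funext => -[x| |] /=; rewrite ?lee_fin ?leNye.
apply: measurable_fun_ifT => //=.
  apply: (measurable_fun_bool true); rewrite (_ : _ @^-1` _ = [set x | x <= 0])//.
  exact: (@emeasurable_fun_infty_c _ _ _ _ id measurableT).
apply: measurable_fun_ifT => //=.
  apply: (measurable_fun_bool true); rewrite setTI (_ : _ @^-1` _ = [set +oo])//.
  by apply/seteqP; split => x /= /eqP.
apply/measurable_EFinP; apply: measurableT_comp; first exact: measurable_ln.
exact: fine_measurable.
Qed.

Lemma weight_poweR_mf (p : R) : measurable_fun D (fun z => w z `^ p).
Proof. exact: (measurableT_comp (measurable_poweR p) mw). Qed.

(** A form of uniform integrability of [w / mean I] on [Q I]: up to a quarter of its mass, [w]
    is bounded by [K * mean I]. *)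
Definition uniformly_integrable := exists2 K : R, (0 < K)%R &
  forall I (E : set T), measurable E -> E `<=` Q I ->
    \int[mu]_(z in E) w z <= (K * mean I)%:E * mu E + (4^-1)%:E * \int[mu]_(z in Q I) w z.

(** Only the excess [g] over the level [K * mean I] can concentrate on a small set. *)
Lemma excess_uniformly_integrable (K : R) : (0 < K)%R ->
  (forall I, exists g : T -> \bar R, [/\ measurable_fun (Q I) g,
     forall z, Q I z -> 0 <= g z,
     {ae mu, forall z, Q I z -> w z <= (K * mean I)%:E + g z} &
     \int[mu]_(z in Q I) g z <= (4^-1)%:E * \int[mu]_(z in Q I) w z]) ->
  uniformly_integrable.
Proof.
move=> K0 h; exists K => // I E mE EQ; have [g [mg g0 wg gint]] := h I.
have K1 : 0 <= (K * mean I)%:E by rewrite lee_fin mulr_ge0 ?ltW// mean_gt0.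
have mgE : measurable_fun E g by exact: measurable_funS mg.
apply: (@le_trans _ _ (\int[mu]_(z in E) ((K * mean I)%:E + g z))).
  apply: ae_ge0_le_integral => //.
  - by move=> z /EQ /QD; exact: w0.
  - by apply: measurable_funS mw => //; apply: subset_trans EQ _; exact: QD.
  - by move=> z /EQ /g0; exact: adde_ge0.
  - by apply: emeasurable_funD => //; exact: measurable_cst.
  - by apply: filterS wg => z hz /EQ; exact: hz.
rewrite ge0_integralD//; last by move=> z /EQ; exact: g0.
rewrite integral_cst//; apply: leeD => //; apply: le_trans gint.
exact: ge0_subset_integral.
Qed.

Definition absolutely_controlled := exists a b : R, [/\ (0 < a < 1)%R, (0 < b < 1)%R &
    forall I (E : set T), measurable E -> E `<=` Q I ->
      mu E < a%:E * mu (Q I) ->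
      \int[mu]_(z in E) w z < b%:E * \int[mu]_(z in Q I) w z].

Lemma uniformly_integrable_controlled : uniformly_integrable -> absolutely_controlled.
Proof.
(* With this choice the first term is at most a quarter of the mass. *)
move=> [K K0 h]; exists (4 * (K + 1))^-1%R, (3 / 4)%R.
have K4 : (0 < 4 * (K + 1))%R by lra.
split; [|by apply/andP; split; lra|].
  by rewrite invr_gt0 K4/= invf_lt1//; lra.
move=> I E mE EQ; have := h I E mE EQ; have m0 := mean_gt0 I; have q0 := fine_mu_gt0 I.
rewrite (mu_sub_finE mE EQ) (weight_finE mE EQ) (mu_finE I) integral_mean -!EFinM -EFinD lee_fin !lte_fin.
set q := fine (mu (Q I)) in q0 *; set e := fine (mu E); set m := mean I in m0 *.
rewrite ltr_pdivlMl// => h1 h2; apply: le_lt_trans h1 _.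
have h3 : (m * (4 * (K + 1) * e) < m * q)%R by rewrite ltr_pM2l.
have e0 : (0 <= e)%R by exact: fine_ge0.
have h4 : (0 <= m * e)%R by rewrite mulr_ge0// ltW.
have mq : (0 < m * q)%R by rewrite mulr_gt0.
rewrite (_ : m * (4 * (K + 1) * e) = 4 * (K * m * e) + 4 * (m * e))%R in h3; last by ring.
rewrite /=; lra.
Qed.

Lemma strip_small (a : R) : (0 < a)%R -> exists n, forall I, mu (strip n I) < a%:E * mu (Q I).
Proof.
move=> a0; have /andP[e0 e1] := tree_eps tree.
have : ((1 - eps) ^+ n @[n --> \oo] --> 0)%R.
  by apply: cvg_expr; rewrite ger0_norm; lra.
move=> /cvgrPdist_lt/(_ _ a0) [n _ /(_ n (leqnn _))/=].
rewrite sub0r normrN ger0_norm; last by rewrite exprn_ge0//; lra.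
move=> hn; exists n => I; apply: (le_lt_trans (mu_strip n I)).
by rewrite (mu_finE I) -!EFinM lte_fin ltr_pM2r// fine_mu_gt0.
Qed.

(** The condition is applied to a strip of small measure. *)
Lemma controlled_top_dominated : absolutely_controlled -> top_dominated.
Proof.
move=> [a [b [/andP[a0 _] /andP[_ b1] h]]]; have [n hn] := strip_small a0.
apply: (@strip_top_dominated n b) => // I; apply/ltW/h => //.
- exact: measurable_strip.
- by move=> z [].
Qed.

(** * Gain of integrability, reverse Hoelder inequality and logarithms *)

Local Notation avg f I := ((\int[mu]_(z in Q I) f z) / mu (Q I)).

Definition reverse_hoelder := exists q K : R, [/\ (1 < q)%R, (0 < K)%R &
  forall I, (avg (fun z => w z `^ q) I) `^ (q^-1) <= K%:E * avg w I].

Definition log_integrable := exists2 K : R, (0 < K)%R & forall I,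
  \int[mu]_(z in Q I) (w z * log_plus (w z / avg w I)) <= K%:E * \int[mu]_(z in Q I) w z.

Lemma avg_leE (x : \bar R) (b : R) I : (x / mu (Q I) <= b%:E) = (x <= b%:E * mu (Q I)).
Proof.
rewrite (mu_finE I); have q0 := fine_mu_gt0 I; set q := fine _ in q0 *.
rewrite inver gt_eqF// -EFinM; case: x => [x||].
- by rewrite -EFinM !lee_fin ler_pdivrMr.
- by rewrite gt0_mulye ?lte_fin ?invr_gt0.
- by rewrite gt0_mulNye ?lte_fin ?invr_gt0// !leNye.
Qed.

Lemma avg_geE (x : \bar R) (b : R) I : (b%:E <= x / mu (Q I)) = (b%:E * mu (Q I) <= x).
Proof.
rewrite (mu_finE I); have q0 := fine_mu_gt0 I; set q := fine _ in q0 *.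
rewrite inver gt_eqF// -EFinM; case: x => [x||].
- by rewrite -EFinM !lee_fin ler_pdivlMr.
- by rewrite gt0_mulye ?lte_fin ?invr_gt0// !leey.
- by rewrite gt0_mulNye ?lte_fin ?invr_gt0.
Qed.

(** As [e] tends to 0, [C `^ e] tends to 1. *)
Lemma small_exponent (kappa : R) : (0 < kappa)%R ->
  exists2 e : R, (0 < e)%R & (C `^ e * (1 - kappa) < 1)%R.
Proof.
move=> k0; have [k1|k1] := leP 1%R kappa.
  exists 1%R => //; apply: (@le_lt_trans _ _ 0%R) => //.
  by rewrite mulr_ge0_le0 ?powR_ge0// subr_le0.
have lC : (0 <= ln C)%R by rewrite ln_ge0.
have ly : (0 < - ln (1 - kappa))%R by rewrite oppr_gt0 ln_lt0//; lra.
exists (- ln (1 - kappa) / (ln C + 1))%R; first by rewrite divr_gt0//; lra.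
rewrite /powR gt_eqF// -[X in (_ * X)%R]lnK; last by rewrite posrE; lra.
rewrite -expRD -[ltRHS]expR0 ltr_expR.
have c1 : (0 < ln C + 1)%R by lra.
rewrite [ltLHS](_ : _ = ln (1 - kappa) / (ln C + 1))%R; last by field; rewrite gt_eqF.
by rewrite pmulr_llt0 ?invr_gt0// -oppr_gt0.
Qed.

(** A top carries at least the fraction [eps / K] of the mass of its node, so the mass decays
    geometrically, and for small [e] faster than [w `^ e] can grow. *)
Lemma gain_integrability : top_dominated -> exists e M : R, [/\ (0 < e)%R, (0 < M)%R &
  forall I, \int[mu]_(z in Q I) (w z `^ (1 + e)) <=
    (M * mean I `^ e)%:E * \int[mu]_(z in Q I) w z].
Proof.
move=> /top_dominatedP[K K0 hK]; have /andP[e0 e1] := tree_eps tree.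
have [e ep Ce] := small_exponent (divr_gt0 e0 K0).
have [d0 d1] : (0 < 1 - C `^ e * (1 - eps / K) /\ 0 < C `^ e)%R.
  by rewrite subr_gt0 powR_gt0.
exists e, ((C / eps) `^ e / (1 - C `^ e * (1 - eps / K)))%R; split => //.
  by apply: divr_gt0 => //; apply: powR_gt0; exact: divr_gt0.
move=> I; have mt := measurable_top.
have tD J : top_part J `<=` D by move=> z /top_sub; exact: QD.
have := @tree_growth (fun z => w z `^ (1 + e)) w (fun J => (C * v J) `^ e)%R (C `^ e) (eps / K) I.
move=> /(_ (weight_poweR_mf _) (fun _ _ => poweR_ge0 _ _) mw w0 wfin).
have grow J J' : (v J <= C * v J' -> (C * v J) `^ e <= C `^ e * (C * v J') `^ e)%R.
  move=> h; rewrite -powRM ?mulr_ge0 ?(ltW C0) ?(ltW (v0 _))//.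
  by apply: ge0_ler_powR; rewrite ?nnegrE ?mulr_ge0 ?(ltW ep) ?(ltW C0) ?(ltW (v0 _))// ler_wpM2l// ltW.
move=> h; apply: (le_trans (h _ _ Ce _ _ _ _)) => {h}.
- by move=> J; rewrite powR_gt0// mulr_gt0.
- exact: ltW.
- by move=> J; apply: grow; case: (weight_left tw J).
- by move=> J; apply: grow; case: (weight_right tw J).
- move=> J; have wJ := measurable_funS mD (@tD J) mw.
  rewrite -(ge0_integralZl mu (mt J) wJ (fun z h => w0 (@tD J z h))); last first.
    by rewrite lee_fin powR_ge0.
  apply: ae_ge0_le_integral => //.
  + by move=> z _; exact: poweR_ge0.
  + exact: measurable_funS (weight_poweR_mf _).
  + by move=> z /tD zD; rewrite mule_ge0 ?lee_fin ?powR_ge0// w0.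
  + exact: measurable_funeM.
  apply: filterS (weight_top tw J) => z h /h; case: (w z) => [x||]; rewrite ?leye_eq ?andbF//.
  rewrite !lee_fin => /andP[vx xv]; have x0 : (0 < x)%R by exact: lt_le_trans vx.
  rewrite ?poweR_EFin -?EFinM ?lee_fin powRD ?powRr1 ?(ltW x0)//; last first.
    by rewrite (gt_eqF x0) implybT.
  rewrite mulrC ler_wpM2r ?(ltW x0)//.
  by apply: ge0_ler_powR; rewrite ?nnegrE ?(ltW ep) ?(ltW x0)// mulr_ge0 ?(ltW C0) ?(ltW (v0 _)).
- move=> J; apply: le_trans (integral_top_ge J).
  have := tree_top tree J; rewrite -(@lee_pmul2l _ (v J)%:E) ?lte_fin//.
  apply: le_trans; rewrite (mu_finE J) integral_mean -!EFinM lee_fin.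
  rewrite [leRHS](_ : _ = eps * v J * fine (mu (Q J)))%R; last by rewrite /=; ring.
  rewrite mulrA; apply: ler_wpM2r; first exact/ltW/fine_mu_gt0.
  by rewrite mulrAC ler_pdivrMr// -mulrA ler_wpM2l ?(ltW e0)// mulrC hK.
rewrite lee_wpmul2r//; first exact: integral_sub_ge0.
rewrite lee_fin mulrAC ler_wpM2r ?invr_ge0 ?(ltW d0)//.
rewrite -(powRM _ (divr_ge0 (ltW C0) (ltW e0)) (ltW (mean_gt0 I))).
apply: ge0_ler_powR; rewrite ?nnegrE ?(ltW ep)//.
- exact: mulr_ge0 (ltW C0) (ltW (v0 _)).
- exact: mulr_ge0 (divr_ge0 (ltW C0) (ltW e0)) (ltW (mean_gt0 _)).
- by rewrite mulrAC -mulrA ler_wpM2l ?(ltW C0)// ler_pdivlMr// mulrC mean_ge.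
Qed.

Lemma top_dominated_reverse_hoelder : top_dominated -> reverse_hoelder.
Proof.
move=> /gain_integrability[e [M [e0 M0 hM]]].
have q0 : (0 < 1 + e)%R by lra.
exists (1 + e)%R, (M `^ (1 + e)^-1)%R; split; [lra|by rewrite powR_gt0|].
move=> I; rewrite averageE; have m0 := mean_gt0 I.
have -> : (M `^ (1 + e)^-1)%:E * (mean I)%:E = ((M * mean I `^ (1 + e))%:E) `^ (1 + e)^-1.
  rewrite poweR_EFin powRM ?(ltW M0) ?powR_ge0// -powRrM divff ?gt_eqF//.
  by rewrite powRr1 ?ltW// EFinM.
apply: gt0_ler_poweR.
- by rewrite invr_ge0 ltW.
- rewrite in_itv/= leey andbT mule_ge0 ?inve_ge0 ?(ltW (tree_pos tree I))//.
  by apply: integral_ge0 => z _; exact: poweR_ge0.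
- by rewrite in_itv/= leey andbT lee_fin mulr_ge0 ?(ltW M0)// powR_ge0.
rewrite avg_leE; apply: (le_trans (hM I)); rewrite (mu_finE I) integral_mean -!EFinM lee_fin.
rewrite powRD; last by rewrite (gt_eqF m0) implybT.
by rewrite powRr1 ?(ltW m0)// le_eqVlt; apply/orP; left; apply/eqP => /=; ring.
Qed.

Lemma reverse_hoelder_uniformly_integrable : reverse_hoelder -> uniformly_integrable.
Proof.
move=> [q [K [q1 K0 h]]]; have q0 : (0 < q)%R by lra.
(* Above the level [A0 * mean I], [w] is at most [w `^ q / (A0 * mean I) `^ (q - 1)], and
   for this [A0] the integral of that function is at most a quarter of the mass. *)
have Kq : (0 < 4 * K `^ q)%R by rewrite mulr_gt0// powR_gt0.
have [A0 A1 A2] : exists2 A0 : R, (0 < A0)%R & (A0 `^ (q - 1) = 4 * K `^ q)%R.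
  exists ((4 * K `^ q) `^ (q - 1)^-1)%R; first by rewrite powR_gt0.
  by rewrite -powRrM mulVf ?powRr1 ?(ltW Kq)// subr_eq0 gt_eqF.
apply: (@excess_uniformly_integrable A0) => // I; have m0 := mean_gt0 I.
have L0 : (0 < A0 * mean I)%R by rewrite mulr_gt0.
have c0 : 0 <= (((A0 * mean I) `^ (q - 1))^-1)%:E by rewrite lee_fin invr_ge0 powR_ge0.
have mq : measurable_fun (Q I) (fun z => w z `^ q) by apply: measurable_fun_Q; exact: weight_poweR_mf.
exists (fun z => (((A0 * mean I) `^ (q - 1))^-1)%:E * w z `^ q); split.
- exact: measurable_funeM.
- by move=> z _; rewrite mule_ge0 ?poweR_ge0.
- apply: filterS (weight_pos_fin I) => z hz /hz[x x0 ->].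
  rewrite poweR_EFin -EFinM -EFinD lee_fin.
  have [xL|Lx] := leP x (A0 * mean I)%R.
    by rewrite ler_wpDr// mulr_ge0 ?invr_ge0 ?powR_ge0.
  rewrite ler_wpDl ?(ltW L0)// mulrC ler_pdivlMr ?powR_gt0//.
  apply: (@le_trans _ _ (x * x `^ (q - 1)))%R; last by rewrite mulr_powRB1 ?(ltW x0).
  rewrite ler_wpM2l ?(ltW x0)//; apply: ge0_ler_powR; rewrite ?nnegrE ?(ltW L0) ?(ltW x0) ?(ltW Lx)//.
  by rewrite subr_ge0 ltW.
- rewrite ge0_integralZl//; last by move=> z _; exact: poweR_ge0.
  have := h I; rewrite averageE -EFinM => hI.
  have : (avg (fun z => w z `^ q) I) <= ((K * mean I) `^ q)%:E.
    have av0 : 0 <= avg (fun z => w z `^ q) I.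
      rewrite mule_ge0 ?inve_ge0 ?(ltW (tree_pos tree I))//.
      by apply: integral_ge0 => z _; exact: poweR_ge0.
    rewrite -[leLHS]poweRe1// -[X in _ `^ X](mulVf (lt0r_neq0 q0)) poweRrM -poweR_EFin.
    by apply: gt0_ler_poweR => //; rewrite ?(ltW q0)// in_itv/= leey andbT ?poweR_ge0// lee_fin mulr_ge0 ?ltW.
  rewrite avg_leE => hq; apply: (le_trans (lee_wpmul2l c0 hq)).
  rewrite (mu_finE I) integral_mean -!EFinM lee_fin /= [leLHS]mulrA [leRHS]mulrA.
  apply: ler_wpM2r; first exact/ltW/fine_mu_gt0.
  rewrite (powRM _ (ltW A1) (ltW m0)) (powRM _ (ltW K0) (ltW m0)) A2.
  rewrite -(mulr_powRB1 (ltW m0) q0).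
  have p1 : (0 < K `^ q)%R by rewrite powR_gt0.
  have p2 : (0 < mean I `^ (q - 1))%R by rewrite powR_gt0.
  by rewrite le_eqVlt; apply/orP; left; apply/eqP; field; rewrite !gt_eqF.
Qed.

Lemma log_plus_EFin (x : R) : (0 < x)%R -> log_plus x%:E = (Num.max (ln x) 0)%:E.
Proof. by move=> x0; rewrite /log_plus lne_EFin// EFin_max. Qed.

Lemma log_plus_ge0 (x : \bar R) : 0 <= log_plus x.
Proof. by rewrite /log_plus le_max lexx orbT. Qed.

Lemma measurable_log_excess I : measurable_fun (Q I) (fun z => w z * log_plus (w z / avg w I)).
Proof.
have mwI := measurable_fun_Q (I := I) mw.
apply: emeasurable_funM => //; apply: measurable_maxe; last exact: measurable_cst.
apply: (measurableT_comp measurable_lne).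
apply: emeasurable_funM => //; exact: measurable_cst.
Qed.

(** The logarithm is at most a small power: [ln y <= y `^ e / e]. *)
Lemma top_dominated_log_integrable : top_dominated -> log_integrable.
Proof.
move=> /gain_integrability[e [M [e0 M0 hM]]]; exists (M / e)%R; first exact: divr_gt0.
move=> I; have m0 := mean_gt0 I; have me : (0 < mean I `^ e)%R by rewrite powR_gt0.
have mq : measurable_fun (Q I) (fun z => w z `^ (1 + e)).
  by apply: measurable_fun_Q; exact: weight_poweR_mf.
have c0 : 0 <= ((e * mean I `^ e)^-1)%:E by rewrite lee_fin invr_ge0 mulr_ge0 ?ltW.
apply: (@le_trans _ _ (\int[mu]_(z in Q I) (((e * mean I `^ e)^-1)%:E * w z `^ (1 + e)))).
  apply: ae_ge0_le_integral => //.
  - by move=> z /QD zD; rewrite mule_ge0 ?w0// log_plus_ge0.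
  - exact: measurable_log_excess.
  - by move=> z _; rewrite mule_ge0 ?poweR_ge0.
  - exact: measurable_funeM.
  - apply: filterS (weight_pos_fin I) => z hz /hz[x x0 ->].
    have xm : (0 < x / mean I)%R by rewrite divr_gt0.
    rewrite averageE inver gt_eqF// -EFinM log_plus_EFin// poweR_EFin -!EFinM lee_fin.
    rewrite powRD; last by rewrite (gt_eqF x0) implybT.
    rewrite powRr1 ?(ltW x0)// mulrCA ler_wpM2l ?(ltW x0)//.
    rewrite ge_max mulr_ge0 ?powR_ge0 ?invr_ge0 ?mulr_ge0 ?(ltW me) ?(ltW e0)// andbT.
    rewrite [leRHS](_ : _ = e^-1 * ((mean I `^ e)^-1 * x `^ e))%R; last by field; rewrite !gt_eqF.
    rewrite ler_pdivlMl// -ln_powR.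
    have <- : ((x / mean I) `^ e = (mean I `^ e)^-1 * x `^ e)%R.
      rewrite powRM ?(ltW x0) ?invr_ge0 ?(ltW m0)// mulrC.
      by rewrite -(powR_inv1 (ltW m0)) -powRrM mulN1r powRN.
    set y := ((x / mean I) `^ e)%R; have y0 : (0 < y)%R by rewrite powR_gt0.
    have y1 : (-1 < y - 1)%R by lra.
    by have := le_ln1Dx y1; rewrite addrCA subrr addr0 => /le_trans; apply; lra.
rewrite ge0_integralZl//; last by move=> z _; exact: poweR_ge0.
apply: (le_trans (lee_wpmul2l c0 (hM I))); rewrite integral_mean -!EFinM lee_fin.
by rewrite le_eqVlt; apply/orP; left; apply/eqP; field; rewrite !gt_eqF.
Qed.

Lemma log_integrable_uniformly_integrable : log_integrable -> uniformly_integrable.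
Proof.
(* Above the level [A0 * mean I] the logarithm exceeds [4 * K]. *)
move=> [K K0 h]; pose A0 := expR (4 * K).
apply: (@excess_uniformly_integrable A0); first exact: expR_gt0.
move=> I; have m0 := mean_gt0 I.
have c0 : 0 <= ((4 * K)^-1)%:E by rewrite lee_fin invr_ge0 mulr_ge0// ltW.
have g0 z : Q I z -> 0 <= w z * log_plus (w z / avg w I).
  by move=> /QD zD; rewrite mule_ge0 ?w0// log_plus_ge0.
exists (fun z => ((4 * K)^-1)%:E * (w z * log_plus (w z / avg w I))); split.
- by apply: measurable_funeM; exact: measurable_log_excess.
- by move=> z /g0; exact: mule_ge0.
- apply: filterS (weight_pos_fin I) => z hz /hz[x x0 ->].
  have xm : (0 < x / mean I)%R by rewrite divr_gt0.
  rewrite averageE inver gt_eqF// -EFinM log_plus_EFin// -!EFinM -EFinD lee_fin.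
  have [xL|Lx] := leP x (A0 * mean I)%R.
    by rewrite ler_wpDr// !mulr_ge0 ?invr_ge0 ?mulr_ge0 ?(ltW K0) ?(ltW x0)// le_max lexx orbT.
  apply: ler_wpDl; first by rewrite mulr_ge0 ?expR_ge0 ?(ltW m0).
  rewrite mulrCA ler_peMr ?(ltW x0)// mulrC ler_pdivlMr ?mulr_gt0// mul1r le_max.
  by rewrite -(expRK (4 * K)%R) ler_ln ?posrE ?expR_gt0// ler_pdivlMr// ltW.
- rewrite ge0_integralZl//; last exact: measurable_log_excess.
  apply: (le_trans (lee_wpmul2l c0 (h I))); rewrite integral_mean -!EFinM lee_fin.
  by rewrite le_eqVlt; apply/orP; left; apply/eqP; field; rewrite !gt_eqF.
Qed.

(** * Small powers, Muckenhoupt condition and mean of the logarithm *)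

Definition muckenhoupt := exists p K : R, [/\ (1 < p)%R, (0 < K)%R & forall I,
  avg w I * (avg (fun z => w z `^ (1 - conj_exponent p)) I) `^ (p - 1) <= K%:E].

Definition exp_log_mean := exists2 K : R, (0 < K)%R & forall I,
  avg w I <= K%:E * expeR (avg (fun z => lne (w z)) I).

Let mu_int1 (B : set T) : measurable B -> \int[mu]_(z in B) cst 1 z = mu B.
Proof. by move=> mB; rewrite integral_cst// mul1e. Qed.

(** From a node to its children the measure decays by the factor [1 - eps], while [w `^ e] and
    [w `^ (- e)] grow by at most [C `^ e]: for small [e] the decay prevails. *)
Lemma small_power_averages : exists e M : R, [/\ (0 < e)%R, (0 < M)%R & forall I,
  \int[mu]_(z in Q I) (w z `^ e) <= (M * v I `^ e)%:E * mu (Q I) /\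
  \int[mu]_(z in Q I) (w z `^ (- e)) <= (M * v I `^ (- e))%:E * mu (Q I)].
Proof.
have /andP[e0 e1] := tree_eps tree.
have [e ep Ce] := small_exponent e0.
have [d0 d1] : (0 < 1 - C `^ e * (1 - eps) /\ 0 < C `^ e)%R by rewrite subr_gt0 powR_gt0.
have C1e : (1 <= C `^ e)%R.
  rewrite [leLHS](_ : _ = 1 `^ e)%R; last by rewrite powR1.
  by apply: ge0_ler_powR; rewrite ?nnegrE ?(ltW ep) ?(ltW C0).
have tD J : top_part J `<=` D by move=> z /top_sub; exact: QD.
exists e, (C `^ e / (1 - C `^ e * (1 - eps)))%R; split; [by []|exact: divr_gt0|].
move=> I.
have grow s (b : R) : (0 <= b)%R ->
    (forall J, {ae mu, forall z, top_part J z -> w z `^ s <= (b * v J `^ s)%:E}) ->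
    (forall J J', v J <= C * v J' -> v J' <= C * v J -> v J `^ s <= C `^ e * v J' `^ s)%R ->
    (0 < b)%R ->
    \int[mu]_(z in Q I) (w z `^ s) <= (b / (1 - C `^ e * (1 - eps)) * v I `^ s)%:E * mu (Q I).
  move=> b0 hs grow bp.
  have h := @tree_growth (fun z => w z `^ s) (cst 1) (fun J => b * v J `^ s)%R (C `^ e) eps I
    (weight_poweR_mf _) (fun _ _ => poweR_ge0 _ _) (measurable_cst _) (fun _ _ => lee01).
  rewrite mulrAC -(mu_int1 (mQ I)); apply: h => //.
  - by move=> J; rewrite mu_int1//; exact: (tree_fin tree).
  - by move=> J; rewrite mulr_gt0// powR_gt0.
  - exact: ltW.
  - move=> J; have [h1 h2] := weight_left tw J.
    by rewrite [leRHS]mulrCA; apply: ler_wpM2l => //; exact: grow.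
  - move=> J; have [h1 h2] := weight_right tw J.
    by rewrite [leRHS]mulrCA; apply: ler_wpM2l => //; exact: grow.
  - move=> J; have mt := measurable_top J.
    rewrite mu_int1// -integral_cst//; apply: ae_ge0_le_integral => //.
    + by move=> z _; exact: poweR_ge0.
    + exact: measurable_funS (weight_poweR_mf _).
    + by move=> z _; rewrite lee_fin mulr_ge0// powR_ge0.
  - by move=> J; rewrite !mu_int1//; [exact: (tree_top tree)|exact: measurable_top].
have vge0 J : v J \in Num.nneg by rewrite nnegrE ltW.
split.
- apply: grow => //; first exact: ltW.
    move=> J; apply: filterS (weight_top tw J) => z h /h; case: (w z) => [x||];
      rewrite ?leye_eq ?andbF//.
    rewrite !lee_fin => /andP[vx xv]; rewrite -powRM ?(ltW C0) ?(ltW (v0 _))//.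
    apply: ge0_ler_powR => //; rewrite ?nnegrE ?(ltW ep)//.
      exact: le_trans (ltW (v0 _)) vx.
    by rewrite mulr_ge0 ?(ltW C0) ?(ltW (v0 _)).
  move=> J J' h _; rewrite -powRM ?(ltW C0) ?(ltW (v0 _))//.
  by apply: ge0_ler_powR; rewrite ?nnegrE ?mulr_ge0 ?(ltW C0) ?(ltW (v0 _)) ?(ltW ep).
- apply: (le_trans (grow (- e)%R 1%R ler01 _ _ ltr01)).
  + move=> J; apply: filterS (weight_top tw J) => z h /h; case: (w z) => [x||];
      rewrite ?leye_eq ?andbF//.
    rewrite !lee_fin mul1r => /andP[vx xv]; rewrite !powRN lef_pV2 ?posrE ?powR_gt0//.
      apply: ge0_ler_powR => //; rewrite ?nnegrE ?(ltW ep)//.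
      exact: le_trans (ltW (v0 _)) vx.
    exact: lt_le_trans vx.
  + move=> J J' _ h; rewrite !powRN ler_pdivlMr ?powR_gt0// mulrC ler_pdivrMr ?powR_gt0//.
    rewrite -powRM ?(ltW C0) ?(ltW (v0 _))//.
    by apply: ge0_ler_powR; rewrite ?nnegrE ?mulr_ge0 ?(ltW C0) ?(ltW (v0 _)) ?(ltW ep).
  + apply: lee_wpmul2r; first exact: ltW (tree_pos tree I).
    by rewrite lee_fin ler_wpM2r ?powR_ge0// ler_wpM2r ?invr_ge0 ?(ltW d0).
Qed.

Lemma top_dominated_muckenhoupt : top_dominated -> muckenhoupt.
Proof.
move=> /top_dominatedP[K K0 hK]; have [e [M [e0 M0 hM]]] := small_power_averages.
(* The exponent for which [1 - conj_exponent p] is [- e]. *)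
exists (1 + e^-1)%R, (K * M `^ e^-1)%R; split.
- by rewrite ltrDl invr_gt0.
- by rewrite mulr_gt0// powR_gt0.
move=> I; have vI := v0 I; have [_ h] := hM I.
rewrite addrAC subrr add0r averageE.
have -> : (1 - conj_exponent (1 + e^-1) = - e)%R.
  by rewrite /conj_exponent addrAC subrr add0r; field; rewrite gt_eqF.
move: h; rewrite -avg_leE => h.
have h2 : (avg (fun z => w z `^ (- e)) I) `^ e^-1 <= ((M * v I `^ (- e)) `^ e^-1)%:E.
  rewrite -poweR_EFin; apply: gt0_ler_poweR => //.
  - by rewrite invr_ge0 ltW.
  - rewrite in_itv/= leey andbT mule_ge0 ?inve_ge0 ?(ltW (tree_pos tree I))//.
    by apply: integral_ge0 => z _; exact: poweR_ge0.
  - by rewrite in_itv/= leey andbT lee_fin mulr_ge0 ?powR_ge0 ?ltW.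
apply: (@le_trans _ _ ((K * v I)%:E * ((M * v I `^ (- e)) `^ e^-1)%:E)).
  by apply: lee_pmul => //; rewrite ?lee_fin ?(ltW (mean_gt0 _)) ?poweR_ge0.
rewrite -EFinM lee_fin powRM ?(ltW M0) ?powR_ge0// -powRrM mulNr divff ?gt_eqF//.
by rewrite powR_inv1 ?(ltW vI)// mulrACA divff ?gt_eqF// mulr1.
Qed.

(** The average of the negative power is at least the contribution of the top, which is that
    power of [v I] up to a constant. *)
Lemma muckenhoupt_top_dominated : muckenhoupt -> top_dominated.
Proof.
move=> [p [K [p1 K0 h]]]; apply/top_dominatedP; have /andP[e0 e1] := tree_eps tree.
have p0 : (0 < p - 1)%R by rewrite subr_gt0.
have pE : (1 - conj_exponent p = - (p - 1)^-1)%R.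
  by rewrite /conj_exponent; field; rewrite gt_eqF.
have ep : (0 < eps `^ (p - 1))%R by rewrite powR_gt0.
exists (K * C / eps `^ (p - 1))%R; first by rewrite divr_gt0// mulr_gt0.
move=> I; have m0 := mean_gt0 I; have vI := v0 I.
have Cv : (0 < C * v I)%R by rewrite mulr_gt0.
set s := (p - 1)^-1%R in pE; have s0 : (0 < s)%R by rewrite invr_gt0.
have tD : top_part I `<=` D by move=> z /top_sub; exact: QD.
have mt := measurable_top I.
have pos z : 0 <= w z `^ (- s) by exact: poweR_ge0.
have h1 : ((C * v I) `^ (- s) * eps)%:E <= avg (fun z => w z `^ (- s)) I.
  rewrite avg_geE; apply: (@le_trans _ _ (\int[mu]_(z in top_part I) (w z `^ (- s)))); last first.
    apply: ge0_subset_integral => //; last exact: top_sub.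
    by apply: measurable_fun_Q; exact: weight_poweR_mf.
  apply: (@le_trans _ _ (((C * v I) `^ (- s))%:E * mu (top_part I))).
    by rewrite EFinM -muleA; apply: lee_wpmul2l; [rewrite lee_fin powR_ge0|exact: (tree_top tree)].
  rewrite -integral_cst//; apply: ae_ge0_le_integral => //.
  - by move=> z _; rewrite lee_fin powR_ge0.
  - exact: measurable_funS (weight_poweR_mf _).
  - apply: filterS (weight_top tw I) => z hz /hz; case: (w z) => [x||];
      rewrite ?leye_eq ?andbF//.
    rewrite !lee_fin => /andP[vx xv]; have x0 : (0 < x)%R by exact: lt_le_trans vx.
    rewrite !powRN lef_pV2 ?posrE ?powR_gt0//.
    by apply: ge0_ler_powR => //; rewrite ?nnegrE ?(ltW s0) ?(ltW x0) ?(ltW Cv).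
have h2 : (((C * v I) `^ (- s) * eps) `^ (p - 1))%:E <=
    (avg (fun z => w z `^ (- s)) I) `^ (p - 1).
  rewrite -poweR_EFin; apply: gt0_ler_poweR => //; first exact: ltW.
  - by rewrite in_itv/= leey andbT lee_fin mulr_ge0 ?powR_ge0 ?ltW.
  - rewrite in_itv/= leey andbT mule_ge0 ?inve_ge0 ?(ltW (tree_pos tree I))//.
    by apply: integral_ge0 => z _; exact: pos.
have := h I; rewrite averageE pE => h3.
have : ((mean I)%:E * (((C * v I) `^ (- s) * eps) `^ (p - 1))%:E <= K%:E).
  by apply: le_trans h3; apply: lee_wpmul2l => //; rewrite lee_fin ltW.
rewrite -EFinM lee_fin powRM ?powR_ge0 ?(ltW e0)// -powRrM mulNr mulVf ?gt_eqF//.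
rewrite powR_inv1 ?(ltW Cv)// mulrCA mulrC ler_pdivrMr// => h4.
rewrite [leRHS](_ : _ = K * (C * v I) / eps `^ (p - 1))%R; last by rewrite mulrA mulrAC.
by rewrite ler_pdivlMr.
Qed.

(** As [`|ln y| <= (y `^ e + y `^ (- e)) / e], the averages of small powers bound the mean of
    the distance of [ln w] to [ln (v I)]. *)
Lemma log_mean_close : exists2 c : R, (0 < c)%R & forall I, exists2 t : R,
  avg (fun z => lne (w z)) I = t%:E & (`|t - ln (v I)| <= c)%R.
Proof.
have [e [M [e0 M0 hM]]] := small_power_averages.
exists (2 * M / e)%R; first by rewrite divr_gt0// mulr_gt0.
move=> I; have vI := v0 I; have [h1 h2] := hM I; have q0 := fine_mu_gt0 I.
have mp s : measurable_fun (Q I) (fun z => w z `^ s).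
  by apply: measurable_fun_Q; exact: weight_poweR_mf.
have mln : measurable_fun (Q I) (fun z => lne (w z)).
  by apply: (measurableT_comp measurable_lne); exact: measurable_fun_Q.
pose g z := lne (w z) - (ln (v I))%:E.
have mg : measurable_fun (Q I) g by apply: emeasurable_funB => //; exact: measurable_cst.
pose a := ((v I `^ (- e)) / e)%R; pose b := ((v I `^ e) / e)%R.
have [a0 b0] : (0 <= a /\ 0 <= b)%R by rewrite !divr_ge0 ?powR_ge0 ?ltW.
have abound : \int[mu]_(z in Q I) `|g z| <= (2 * M / e)%:E * mu (Q I).
  apply: (@le_trans _ _ (\int[mu]_(z in Q I) (a%:E * w z `^ e + b%:E * w z `^ (- e)))).
    apply: ae_ge0_le_integral => //.
    - exact: measurableT_comp.
    - by move=> z _; rewrite adde_ge0// mule_ge0 ?poweR_ge0.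
    - by apply: emeasurable_funD; exact: measurable_funeM.
    - apply: filterS (weight_pos_fin I) => z hz /hz[x x0].
      rewrite /g => ->; rewrite lne_EFin// !poweR_EFin -EFinB -!EFinM -EFinD lee_fin.
      have key y : (0 < y)%R -> (ln y <= y `^ e / e)%R.
        move=> y0; rewrite ler_pdivlMr// mulrC -ln_powR.
        have ye : (0 < y `^ e)%R by rewrite powR_gt0.
        have y1 : (-1 < y `^ e - 1)%R by lra.
        by have := le_ln1Dx y1; rewrite addrCA subrr addr0 => /le_trans; apply; lra.
      have k1 := key _ (divr_gt0 x0 vI); have k2 := key _ (divr_gt0 vI x0).
      have pdiv s t : (0 < s)%R -> (0 < t)%R -> ((s / t) `^ e = s `^ e * t `^ (- e))%R.
        move=> s0 t0; rewrite powRM ?invr_ge0 ?(ltW s0) ?(ltW t0)//.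
        by rewrite -(powR_inv1 (ltW t0)) -powRrM mulN1r.
      rewrite pdiv// ln_div ?posrE// in k1; rewrite pdiv// ln_div ?posrE// in k2.
      have n1 : (0 <= a * x `^ e)%R by rewrite mulr_ge0 ?powR_ge0.
      have n2 : (0 <= b * x `^ (- e))%R by rewrite mulr_ge0 ?powR_ge0.
      rewrite (_ : _ / e = a * x `^ e)%R in k1; last by rewrite /a; ring.
      rewrite (_ : _ / e = b * x `^ (- e))%R in k2; last by rewrite /b; ring.
      rewrite ler_norml; apply/andP; split; lra.
  rewrite ge0_integralD//; last first.
  - exact: measurable_funeM.
  - by move=> z _; rewrite mule_ge0 ?poweR_ge0.
  - exact: measurable_funeM.
  - by move=> z _; rewrite mule_ge0 ?poweR_ge0.
  rewrite !ge0_integralZl//; try by move=> z _; exact: poweR_ge0.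
  apply: (@le_trans _ _ (a%:E * ((M * v I `^ e)%:E * mu (Q I)) +
                         b%:E * ((M * v I `^ (- e))%:E * mu (Q I)))).
    by apply: leeD; apply: lee_wpmul2l.
  rewrite (mu_finE I) -!EFinM -EFinD lee_fin /=.
  have p1 : (v I `^ e * v I `^ (- e) = 1)%R by rewrite powRN divff// gt_eqF// powR_gt0.
  rewrite [leLHS](_ : _ = 2 * M / e * fine (mu (Q I)) * (v I `^ e * v I `^ (- e)))%R.
    by rewrite p1 mulr1.
  by rewrite /a /b; ring.
have gi : mu.-integrable (Q I) g.
  by apply/integrableP; split => //; apply: (le_lt_trans abound); rewrite (mu_finE I) -EFinM ltry.
have ci : mu.-integrable (Q I) (cst (ln (v I))%:E).
  apply/integrableP; split; first exact: measurable_cst.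
  by rewrite (integral_cst mu (mQ I) `|(ln (v I))%:E|) (mu_finE I) -EFinM ltry.
have lnE : \int[mu]_(z in Q I) lne (w z) = \int[mu]_(z in Q I) g z + (ln (v I))%:E * mu (Q I).
  rewrite -integral_cst// -integralD//; apply: eq_integral => z _.
  by rewrite /g subeK.
have gfin : \int[mu]_(z in Q I) g z \is a fin_num by exact: integrable_fin_num.
exists (fine (\int[mu]_(z in Q I) g z) / fine (mu (Q I)) + ln (v I))%R.
  rewrite lnE -(fineK gfin) (mu_finE I) inver gt_eqF// -EFinM.
  by congr EFin => /=; field; rewrite gt_eqF.
rewrite addrK normrM normfV (gtr0_norm q0) ler_pdivrMr//.
have := le_abse_integral mu (mQ I) mg; rewrite -(fineK gfin) => /le_trans/(_ abound).
by rewrite (mu_finE I) -EFinM lee_fin.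
Qed.

Lemma exp_log_meanP : top_dominated <-> exp_log_mean.
Proof.
have [c c0 hc] := log_mean_close; rewrite top_dominatedP; split.
  move=> [K K0 h]; exists (K * expR c)%R; first by rewrite mulr_gt0 ?expR_gt0.
  move=> I; have [t -> tc] := hc I; rewrite averageE /= -EFinM lee_fin.
  apply: (le_trans (h I)); rewrite -mulrA ler_wpM2l ?(ltW K0)// -expRD.
  rewrite -{1}(lnK (v0 I : v I \in Num.pos)) ler_expR.
  by move: tc; rewrite ler_norml => /andP[t1 t2]; lra.
move=> [K K0 h]; exists (K * expR c)%R; first by rewrite mulr_gt0 ?expR_gt0.
move=> I; have := h I; have [t -> tc] := hc I; rewrite averageE /= -EFinM lee_fin.
move=> /le_trans; apply; rewrite -mulrA ler_wpM2l ?(ltW K0)//.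
rewrite -{1}(lnK (v0 I : v I \in Num.pos)) -expRD ler_expR.
by move: tc; rewrite ler_norml => /andP[t1 t2]; lra.
Qed.

(** * Medians *)

Lemma ae_le_measure (B1 B2 : set T) : measurable B1 -> measurable B2 ->
  {ae mu, forall z, B1 z -> B2 z} -> mu B1 <= mu B2.
Proof.
move=> m1 m2 h.
have indE (B : set T) : measurable B -> mu B = \int[mu]_(z in setT) (\1_B z)%:E.
  by move=> mB; rewrite integral_indic// setIT.
rewrite (indE _ m1) (indE _ m2); apply: ae_ge0_le_integral => //.
- by apply/measurable_EFinP; exact: measurable_indic.
- by apply/measurable_EFinP; exact: measurable_indic.
apply: filterS h => z hz _; rewrite lee_fin !indicE.
by case: (boolP (z \in B1)) => // /set_mem/hz/mem_set ->.
Qed.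

Lemma measurable_superlevel I (t : R) : measurable [set z | Q I z /\ t%:E < w z].
Proof. exact: emeasurable_fun_o_infty (mQ I) (measurable_fun_Q mw) _. Qed.

Lemma measurable_sublevel I (t : R) : measurable [set z | Q I z /\ w z < t%:E].
Proof. exact: emeasurable_fun_infty_o (mQ I) (measurable_fun_Q mw) _. Qed.

Section Median.
Variable mdn : A -> R.
Hypothesis mdn_median : forall I, [/\ (0 < mdn I)%R,
  mu [set z | Q I z /\ w z < (mdn I)%:E] <= mu (Q I) / 2%:E &
  mu [set z | Q I z /\ (mdn I)%:E < w z] <= mu (Q I) / 2%:E].

Lemma half_body n I (S : set T) : measurable S -> {ae mu, forall z, body n I z -> S z} ->
  mu (strip n I) < (2^-1)%:E * mu (Q I) -> ~~ (mu S <= mu (Q I) / 2%:E).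
Proof.
move=> mS hS hs; apply/negP => hS2; have hb := ae_le_measure (measurable_body n I) mS hS.
have : mu (Q I) = mu (body n I) + mu (strip n I).
  have mb := measurable_body n I; have ms := measurable_strip n I.
  by rewrite -(measureU mu mb ms (setDIK _ _)) setDUK//; exact: body_sub.
have sQ : strip n I `<=` Q I by move=> z [].
move: hs (le_trans hb hS2).
rewrite (mu_sub_finE (measurable_strip n I) sQ) (mu_sub_finE (measurable_body n I) (@body_sub n I)).
rewrite (mu_finE I) inver pnatr_eq0/= -!EFinM -EFinD lte_fin lee_fin => h1 h2 [h3].
by move: h1 h2 h3; lra.
Qed.

(** More than half of [Q I] lies in finitely many generations, where [w] is comparable to
    [v I]. *)
Lemma median_top : exists2 c : R, (0 < c)%R & forall I, (mdn I <= c * v I /\ v I <= c * mdn I)%R.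
Proof.
have h2 : (0 < 2^-1 :> R)%R by rewrite invr_gt0.
have [n hn] := strip_small h2.
have Cn : (0 < C ^+ n)%R by rewrite exprn_gt0.
exists (C ^+ n)%R => // I; have [m0 m1 m2] := mdn_median I; split.
- rewrite leNgt; apply/negP => hm; move: m1; apply/negP; apply: half_body (hn I).
    exact: measurable_sublevel.
  apply: filterS (body_bounds n I) => z h bz; split; first exact: body_sub bz.
  by have /andP[_ /le_lt_trans] := h bz; apply; rewrite lte_fin.
- rewrite leNgt; apply/negP => hm; move: m2; apply/negP; apply: half_body (hn I).
    exact: measurable_superlevel.
  apply: filterS (body_bounds n I) => z h bz; split; first exact: body_sub bz.
  by have /andP[/(lt_le_trans _) + _] := h bz; apply; rewrite lte_fin ltr_pdivlMr// mulrC.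
Qed.

Definition median_dominates := exists2 K : R, (0 < K)%R & forall I, avg w I <= (K * mdn I)%:E.

Lemma median_dominatesP : top_dominated <-> median_dominates.
Proof.
have [c c0 hc] := median_top; rewrite top_dominatedP; split => -[K K0 h].
  exists (K * c)%R; first exact: mulr_gt0.
  move=> I; rewrite averageE lee_fin; apply: (le_trans (h I)).
  by rewrite -mulrA ler_wpM2l ?(ltW K0)//; case: (hc I).
exists (K * c)%R; first exact: mulr_gt0.
move=> I; have := h I; rewrite averageE lee_fin => /le_trans; apply.
by rewrite -mulrA ler_wpM2l ?(ltW K0)//; case: (hc I).
Qed.

End Median.

(** * Level sets *)

Definition level_set_condition := exists b K : R, [/\ (0 < b)%R, (0 < K)%R &
  forall I (t : R), avg w I < t%:E ->
    \int[mu]_(z in [set z | Q I z /\ t%:E < w z]) w z <=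
    (K * t)%:E * mu [set z | Q I z /\ (b * t)%:E < w z]].

Lemma integral_le_level (B : set T) I (t : R) : measurable B -> B `<=` Q I ->
  (0 <= t)%R -> {ae mu, forall z, B z -> w z <= t%:E} ->
  \int[mu]_(z in B) w z <= t%:E * mu B.
Proof.
move=> mB BQ t0 h; have BD : B `<=` D by apply: subset_trans BQ _; exact: QD.
rewrite -integral_cst//; apply: ae_ge0_le_integral => //.
- by move=> z /BD; exact: w0.
- exact: measurable_funS mw.
Qed.

(** Suppose that [v I] is far below the mean, and let [t] be twice the mean. On the body [w] is
    then less than [b * t], so that the set [w > b * t] lies in a thin strip, and by the
    condition the mass above the level [t] is small. The mass of the strip below the level
    [t] is small because the strip is thin, that of the body because [w] is small there:
    together these do not reach the mass of [Q I]. *)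
Lemma level_set_top_dominated : level_set_condition -> top_dominated.
Proof.
move=> [b [K [b0 K0 h]]]; apply/top_dominatedP.
(* With the constants 8 the body and the strip have less than half of the mass each. *)
pose b1 := Num.min b (8^-1)%R.
have b10 : (0 < b1)%R by rewrite lt_min b0 invr_gt0 ltr0n.
have [b1b b18] : (b1 <= b /\ b1 <= 8^-1)%R by rewrite !ge_min !lexx orbT.
have [n hn] : exists n, forall I, mu (strip n I) < ((8 * (1 + K))^-1)%:E * mu (Q I).
  by apply: strip_small; rewrite invr_gt0; lra.
have Cn : (0 < C ^+ n)%R by rewrite exprn_gt0.
exists (C ^+ n / (2 * b1))%R; first by rewrite divr_gt0// mulr_gt0.
move=> I; have m0 := mean_gt0 I; have q0 := fine_mu_gt0 I.
rewrite leNgt; apply/negP => small; pose t := (2 * mean I)%R.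
have t0 : (0 < t)%R by rewrite mulr_gt0.
have hv : (C ^+ n * v I < b1 * t)%R.
  by move: small; rewrite mulrAC ltr_pdivrMr ?mulr_gt0// /t; lra.
have [mb ms] := (measurable_body n I, measurable_strip n I).
have low : {ae mu, forall z, body n I z -> w z <= (b1 * t)%:E}.
  apply: filterS (body_bounds n I) => z hz /hz /andP[_ /le_trans]; apply.
  by rewrite lee_fin ltW.
have bt0 : (0 <= b1 * t)%R by rewrite mulr_ge0// ltW.
have h1 := integral_le_level mb (@body_sub n I) bt0 low.
have mbQ : mu (body n I) <= mu (Q I) by apply: mu_sub_Q => //; exact: body_sub.
have sQ : strip n I `<=` Q I by move=> z [].
have mL := measurable_superlevel I t.
have mS1 : measurable (strip n I `\` [set z | Q I z /\ t%:E < w z]) by exact: measurableD.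
have h2 : \int[mu]_(z in strip n I `\` [set z | Q I z /\ t%:E < w z]) w z <= t%:E * mu (strip n I).
  apply: (@le_trans _ _ (t%:E * mu (strip n I `\` [set z | Q I z /\ t%:E < w z]))).
    apply: (@integral_le_level _ I) => //; [by move=> z [/sQ]|exact: ltW|].
    apply: aeW => z [[Qz _] nt]; rewrite leNgt; apply/negP => lt; exact: nt.
  apply: lee_wpmul2l; first by rewrite lee_fin ltW.
  by apply: le_measure; rewrite ?inE//; move=> z [].
have h3 : \int[mu]_(z in [set z | Q I z /\ t%:E < w z]) w z <= (K * t)%:E * mu (strip n I).
  apply: le_trans (h I t _) _; first by rewrite averageE lte_fin /t; lra.
  apply: lee_wpmul2l; first by rewrite lee_fin mulr_ge0 ?ltW.
  apply: ae_le_measure => //; first exact: measurable_superlevel.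
  apply: filterS low => z hz [Qz bz]; split => // bodz.
  by move: (hz bodz); rewrite leNgt => /negP; apply; apply: le_lt_trans bz; rewrite lee_fin ler_wpM2r// ltW.
have sub : \int[mu]_(z in strip n I) w z <=
    \int[mu]_(z in strip n I `\` [set z | Q I z /\ t%:E < w z]) w z +
    \int[mu]_(z in [set z | Q I z /\ t%:E < w z]) w z.
  have LD : [set z | Q I z /\ t%:E < w z] `<=` D by move=> z [] /QD.
  rewrite -(integral_disjU mw w0)//.
  - apply: integral_mono => //.
    + by move=> z sz; have [k|k] := pselect ([set z | Q I z /\ t%:E < w z] z); [right|left].
    + by move=> z [[/sQ/QD]|/LD].
    + exact: measurableU.
  - by move=> z [/sQ/QD].
  - by rewrite setIC; exact: setDIK.
have := integral_Q_strip mw w0 n I.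
have := le_trans sub (leeD h2 h3).
have := le_trans h1 (lee_wpmul2l _ mbQ); have := hn I.
rewrite (mu_sub_finE ms sQ) (mu_finE I) (weight_finE ms sQ) (weight_finE mb (@body_sub n I)).
rewrite integral_mean -!EFinM -!EFinD lte_fin !lee_fin => k1 /(_ bt0) k2 k3 [k4].
set s := fine (mu (strip n I)) in k1 k3 *; set q := fine (mu (Q I)) in q0 k1 k2 k4 *.
set x := fine (\int[mu]_(z in body n I) w z) in k2 k4.
set y := fine (\int[mu]_(z in strip n I) w z) in k3 k4.
have K1 : (0 < 8 * (1 + K))%R by lra.
rewrite ltr_pdivlMl// in k1; rewrite /= in k1 k2 k4.
have k5 : (b1 * t * q <= 8^-1 * t * q)%R by rewrite ler_pM2r// ler_pM2r.
have k6 : (t * (8 * (1 + K) * s) < t * q)%R by rewrite ltr_pM2l.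
have mq : (0 < mean I * q)%R by rewrite mulr_gt0.
move: k2 k3 k4 k5 k6; rewrite /t => k2 k3 k4 k5 k6.
lra.
Qed.

(** Stopping time: descend until the upper bound [C * v J] of [w] on a top exceeds [t]. Before
    that, [w] is at most [t] on the tops. The top of a stopping node lies in the set
    [w > C^-1 * t] and takes a fixed fraction of the measure of the node, while the mass of
    the node is at most of the order of [t] times this measure. *)
Lemma top_dominated_level_set : top_dominated -> level_set_condition.
Proof.
move=> [K K0 hK]; have /andP[e0 e1] := tree_eps tree.
exists C^-1%R, (K / eps ^+ 2)%R; split; [by rewrite invr_gt0|by rewrite divr_gt0// exprn_gt0|].
move=> I t; rewrite averageE lte_fin => mt; have t0 : (0 < t)%R by exact: lt_trans (mean_gt0 I) mt.
pose E := [set z | D z /\ t%:E < w z].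
have mE : measurable E by exact: emeasurable_fun_o_infty mD mw _.
pose F := w \_ E.
have mF : measurable_fun D F.
  by apply/measurable_restrict => //; apply: measurable_funS mw => // z [].
have F0 z : D z -> 0 <= F z by rewrite /F patchE => zD; case: ifP => // _; exact: w0.
have Fw z : D z -> F z <= w z by rewrite /F patchE => zD; case: ifP => // _; exact: w0.
have -> : [set z | Q I z /\ t%:E < w z] = Q I `&` E.
  apply/seteqP; split => z [Qz]; first by move=> h; exact: (conj Qz (conj (QD Qz) h)).
  by move=> [_ h].
rewrite integral_mkcondr -/F; apply: integral_le_body => // n.
(* A node at which the descent arrives has a top value at most of the order of [t]. *)
have vI : (v I <= t / eps)%R by rewrite ler_pdivlMr// mulrC (le_trans (mean_ge I))// ltW.
elim: n I {mt} vI => [|n IH] I vI.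
  rewrite integral_set0 mule_ge0// lee_fin mulr_ge0 ?(ltW t0)//.
  by rewrite divr_ge0 ?exprn_ge0 ?ltW.
have q0 := fine_mu_gt0 I; have mtop := measurable_top I.
have tD : top_part I `<=` D by move=> z /top_sub; exact: QD.
have mS J := measurable_superlevel J (C^-1 * t).
have Kt0 : 0 <= (K / eps ^+ 2 * t)%:E.
  by rewrite lee_fin mulr_ge0 ?divr_ge0 ?exprn_ge0 ?ltW.
have [hv|hv] := leP (C * v I)%R t; last first.
  apply: (@le_trans _ _ (\int[mu]_(z in Q I) w z)).
    apply: (@le_trans _ _ (\int[mu]_(z in Q I) F z)).
      apply: integral_mono => //; [exact: body_sub|exact: measurable_body].
    apply: ge0_le_integral => //; try exact: measurable_fun_Q.
    - by move=> z /QD; exact: F0.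
    - by move=> z /QD; exact: Fw.
  apply: (le_trans (hK I)); apply: (@le_trans _ _ ((K / eps ^+ 2 * t)%:E * mu (top_part I))).
    apply: (@le_trans _ _ ((K / eps ^+ 2 * t)%:E * (eps%:E * mu (Q I)))); last first.
      by apply: lee_wpmul2l => //; exact: (tree_top tree).
    rewrite (mu_finE I) -!EFinM lee_fin mulrA; apply: ler_wpM2r; first exact: ltW.
    rewrite [leRHS](_ : _ = K * (t / eps))%R; last by field; rewrite gt_eqF.
    by rewrite ler_wpM2l// ltW.
  apply: lee_wpmul2l => //; apply: ae_le_measure => //.
  apply: filterS (weight_top tw I) => z hz tz; split; first exact: top_sub.
  by have /andP[/(lt_le_trans _) + _] := hz tz; apply; rewrite lte_fin ltr_pdivrMl.
have te : (t <= t / eps)%R by rewrite ler_pdivlMr// ler_piMr ?ltW.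
have [_ vl] := weight_left tw I; have [_ vr] := weight_right tw I.
have IHl := IH (l I) (le_trans vl (le_trans hv te)).
have IHr := IH (r I) (le_trans vr (le_trans hv te)).
have Ftop : \int[mu]_(z in top_part I) F z <= 0.
  rewrite -[leRHS](integral0 mu (top_part I)); apply: ae_ge0_le_integral => //.
  - by move=> z /tD; exact: F0.
  - exact: measurable_funS mF.
  - apply: filterS (weight_top tw I) => z hz /hz /andP[_ h].
    rewrite /F patchE; case: ifPn => // /set_mem[_]; rewrite ltNge => /negP[].
    by apply: (le_trans h); rewrite lee_fin.
rewrite integral_bodyS//; apply: (le_trans (leeD Ftop (leeD IHl IHr))).
rewrite add0e -ge0_muleDr//; apply: lee_wpmul2l => //.
rewrite -(measureU mu (mS _) (mS _)).
  apply: le_measure; rewrite ?inE//; first exact: measurableU.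
  by move=> z [[Qz bz]|[Qz bz]]; split => //; [exact: (tree_left tree)|exact: (tree_right tree)].
apply/seteqP; split => z // [[h1 _] [h2 _]].
by rewrite -(tree_disj tree I).
Qed.

(** * The maximal function *)

(** The integral of a nonnegative function is a supremum over the simple functions below it,
    hence monotone even where the measurability of a maximal function is not known. *)
Lemma ge0_le_lower_integral (B : set T) F G : (forall z, B z -> 0 <= F z) ->
  (forall z, B z -> F z <= G z) -> \int[mu]_(z in B) F z <= \int[mu]_(z in B) G z.
Proof.
move=> F0 FG; have G0 z : B z -> 0 <= G z by move=> Bz; exact: le_trans (F0 _ Bz) (FG _ Bz).
rewrite (ge0_integralE mu F0) (ge0_integralE mu G0).
apply: le_ereal_sup => _ [h /= hh <-]; exists h => //= z; apply: (le_trans (hh z)).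
by rewrite !patchE; case: ifPn => // /set_mem; exact: FG.
Qed.

(** [M I] stands for the maximal function of the restriction of [w] to [Q I]. *)
Variable M : A -> T -> \bar R.

Definition maximal_integrable := exists2 K : R, (0 < K)%R & forall I,
  \int[mu]_(z in Q I) M I z <= K%:E * \int[mu]_(z in Q I) w z.

Hypothesis M_ge : forall I J z, Q J `<=` Q I -> Q J z -> avg w J <= M I z.

(** A step function below the maximal function, with one value on each top. *)
Fixpoint lower_step n I : T -> \bar R :=
  if n is n'.+1 then
    (cst (mean I)%:E \_ (top_part I)) \+ ((lower_step n' (l I) \_ (Q (l I))) \+
      (lower_step n' (r I) \_ (Q (r I))))
  else cst 0.

Lemma patch_out (f : T -> \bar R) (B : set T) z : ~ B z -> (f \_ B) z = 0.
Proof. by move=> nB; rewrite patchE; case: ifPn => // /set_mem. Qed.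

Lemma patch_in (f : T -> \bar R) (B : set T) z : B z -> (f \_ B) z = f z.
Proof. by move=> Bz; rewrite patchE; case: ifPn => // /negP; rewrite inE. Qed.

Lemma not_both I z : Q (l I) z -> Q (r I) z -> False.
Proof. by move=> h1 h2; have : (Q (l I) `&` Q (r I)) z by []; rewrite (tree_disj tree). Qed.

Lemma node_patch (f g h : T -> \bar R) I z :
  let k := (f \_ (top_part I)) \+ ((g \_ (Q (l I))) \+ (h \_ (Q (r I)))) in
  [/\ top_part I z -> k z = f z, Q (l I) z -> k z = g z & Q (r I) z -> k z = h z].
Proof.
move=> k; split => hz; rewrite /k /=.
- have [_ n] := hz; have nl : ~ Q (l I) z by move=> h1; apply: n; left.
  have nr : ~ Q (r I) z by move=> h1; apply: n; right.
  by rewrite (patch_in f hz) (patch_out g nl) (patch_out h nr) !adde0.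
- have nt : ~ top_part I z by move=> [_]; apply; left.
  by rewrite (patch_out f nt) (patch_in g hz) (patch_out h (not_both hz)) add0e adde0.
- have nt : ~ top_part I z by move=> [_]; apply; right.
  have nl : ~ Q (l I) z by move=> h1; exact: not_both h1 hz.
  by rewrite (patch_out f nt) (patch_out g nl) (patch_in h hz) !add0e.
Qed.

Lemma measurable_patch (f : T -> \bar R) (B : set T) : measurable B -> measurable_fun D f ->
  measurable_fun D (f \_ B).
Proof. by move=> mB mf; apply/measurable_restrict => //; apply: measurable_funS mf => // z []. Qed.

Lemma patch_ge0 (f : T -> \bar R) (B : set T) z : 0 <= f z -> 0 <= (f \_ B) z.
Proof. by rewrite patchE; case: ifP. Qed.

Lemma lower_step_mf n I : measurable_fun D (lower_step n I).
Proof.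
elim: n I => [|n IH] I /=; first exact: measurable_cst.
apply: emeasurable_funD; first by apply: measurable_patch; [exact: measurable_top|].
by apply: emeasurable_funD; exact: measurable_patch.
Qed.

Lemma lower_step_ge0 n I z : 0 <= lower_step n I z.
Proof.
elim: n I => [|n IH] I //=.
by rewrite !adde_ge0// patch_ge0//= lee_fin ltW// mean_gt0.
Qed.

Lemma lower_step_le n I (X : T -> \bar R) : (forall J z, Q J `<=` Q I -> Q J z -> avg w J <= X z) ->
  (forall z, Q I z -> 0 <= X z) -> forall z, Q I z -> lower_step n I z <= X z.
Proof.
elim: n I => [|n IH] I hX X0 z Qz; first exact: X0.
have [h1 h2 h3] := node_patch (cst (mean I)%:E) (lower_step n (l I)) (lower_step n (r I)) I z.
move: (Qz); rewrite QE => -[hz|[hz|hz]].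
- by rewrite [leLHS]h1// -averageE; exact: hX.
- rewrite [leLHS]h2//; apply: IH => //.
  + move=> J y JQ; apply: hX; exact: subset_trans JQ (tree_left tree (I := I)).
  + by move=> y /(tree_left tree); exact: X0.
- rewrite [leLHS]h3//; apply: IH => //.
  + move=> J y JQ; apply: hX; exact: subset_trans JQ (tree_right tree (I := I)).
  + by move=> y /(tree_right tree); exact: X0.
Qed.

Lemma integral_node_patch (f g h : T -> \bar R) I :
  measurable_fun D f -> measurable_fun D g -> measurable_fun D h ->
  (forall z, 0 <= f z) -> (forall z, 0 <= g z) -> (forall z, 0 <= h z) ->
  \int[mu]_(z in Q I) ((f \_ (top_part I)) \+ ((g \_ (Q (l I))) \+ (h \_ (Q (r I))))) z =
  \int[mu]_(z in top_part I) f z + (\int[mu]_(z in Q (l I)) g z + \int[mu]_(z in Q (r I)) h z).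
Proof.
move=> mf mg mh f0 g0 h0; rewrite integral_Q.
- by congr (_ + (_ + _)); apply: eq_integral => z /set_mem hz;
    have [h1 h2 h3] := node_patch f g h I z; [rewrite h1|rewrite h2|rewrite h3].
- apply: emeasurable_funD; first by apply: measurable_patch; [exact: measurable_top|].
  by apply: emeasurable_funD; exact: measurable_patch.
- by move=> z _; rewrite !adde_ge0// patch_ge0.
Qed.

(** A top has the fraction [eps] of the measure of its node, so each generation contributes
    at least [eps] times the mass of its nodes, hence of the strip. *)
Lemma lower_step_integral n I :
  (eps * n%:R)%:E * \int[mu]_(z in strip n I) w z <= \int[mu]_(z in Q I) lower_step n I z.
Proof.
have /andP[e0 e1] := tree_eps tree.
elim: n I => [|n IH] I; first by rewrite mulr0 mul0e /= integral0.
rewrite integral_node_patch; last 6 first.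
- exact: measurable_cst.
- exact: lower_step_mf.
- exact: lower_step_mf.
- by move=> z /=; rewrite lee_fin ltW// mean_gt0.
- exact: lower_step_ge0.
- exact: lower_step_ge0.
have ms := measurable_strip n.
have sQ J : strip n J `<=` Q J by move=> z [].
rewrite integral_stripS//; apply: le_trans (leeD (lexx _) (leeD (IH (l I)) (IH (r I)))).
have : eps%:E * \int[mu]_(z in Q I) w z <= \int[mu]_(z in top_part I) cst (mean I)%:E z.
  rewrite integral_cst; last exact: measurable_top.
  rewrite integral_mean EFinM muleCA -mu_finE.
  by apply: lee_wpmul2l; [rewrite lee_fin ltW ?mean_gt0|exact: (tree_top tree)].
move=> htop; apply: (le_trans _ (leeD htop (lexx _))).
have : \int[mu]_(z in strip n.+1 I) w z <= \int[mu]_(z in Q I) w z.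
  by apply: integral_mono => //; [move=> z []|exact: measurable_strip].
rewrite integral_stripS//.
rewrite (weight_finE (ms (l I)) (@sQ _)) (weight_finE (ms (r I)) (@sQ _)) (weight_finE (mQ I) (@subset_refl _ _)).
rewrite -?EFinM -!EFinD -?EFinM -?EFinD !lee_fin.
set x := fine _; set y := fine _; set u := fine _ => xyu.
have : (eps * (x + y) <= eps * u)%R by rewrite ler_pM2l.
by rewrite -natr1; lra.
Qed.

(** After [2 * K / eps] generations at most half of the mass is left in the strip. *)
Lemma maximal_top_dominated : maximal_integrable -> top_dominated.
Proof.
move=> [K K0 h]; have /andP[e0 e1] := tree_eps tree.
pose n := (Num.truncn (2 * K / eps)).+1.
have hn : (2 * K <= eps * n%:R)%R.
  by rewrite [leRHS]mulrC -ler_pdivrMr//; exact/ltW/truncnS_gt.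
apply: (@strip_top_dominated n 2^-1); first by rewrite invf_lt1 ?ltr1n.
move=> I; have M0 z : Q I z -> 0 <= M I z.
  move=> Qz; apply: le_trans (M_ge (@subset_refl _ (Q I)) Qz).
  by rewrite averageE lee_fin ltW// mean_gt0.
have : (eps * n%:R)%:E * \int[mu]_(z in strip n I) w z <= K%:E * \int[mu]_(z in Q I) w z.
  apply: le_trans (lower_step_integral n I) _; apply: le_trans (h I).
  apply: ge0_le_lower_integral; first by move=> z _; exact: lower_step_ge0.
  by apply: lower_step_le => // J z; exact: M_ge.
have sQ : strip n I `<=` Q I by move=> z [].
rewrite (weight_finE (measurable_strip n I) sQ) integral_mean -!EFinM !lee_fin.
set x := fine (\int[mu]_(z in strip n I) w z); set u := (mean I * _)%R => hx.
have x0 : (0 <= x)%R by apply: fine_ge0; apply: integral_sub_ge0 => // z /sQ /QD.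
have : (2 * K * x <= eps * n%:R * x)%R by rewrite ler_wpM2r.
move=> h2; have h3 := le_trans h2 hx.
have : (K * (2 * x) <= K * u)%R by rewrite (_ : K * _ = 2 * K * x)%R//; ring.
by rewrite ler_pM2l//; lra.
Qed.

Fixpoint descend n I J : Prop :=
  if n is n'.+1 then descend n' (l I) J \/ descend n' (r I) J else J = I.

(** At a point, [M I] is at most of the order of the largest top value of the nodes that
    contain the point. *)
Hypothesis M_le : exists2 c : R, (0 < c)%R & forall (K b : R) I z, (0 < K)%R ->
  (forall J, mean J <= K * v J)%R -> Q I z ->
  (forall n J, descend n I J -> Q J z -> (v J <= b)%R) -> M I z <= (c * K * b)%:E.

(** The sum of the top values of the nodes that contain a point bounds their supremum, and can
    be integrated node by node. *)
Fixpoint upper_sum n I : T -> \bar R :=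
  if n is n'.+1 then
    (cst (v I)%:E \_ (Q I)) \+ ((upper_sum n' (l I) \_ (Q (l I))) \+
      (upper_sum n' (r I) \_ (Q (r I))))
  else cst 0.

Lemma upper_sum_mf n I : measurable_fun D (upper_sum n I).
Proof.
elim: n I => [|n IH] I /=; first exact: measurable_cst.
apply: emeasurable_funD; first exact: measurable_patch.
by apply: emeasurable_funD; exact: measurable_patch.
Qed.

Lemma upper_sum_ge0 n I z : 0 <= upper_sum n I z.
Proof.
elim: n I => [|n IH] I //=.
by rewrite !adde_ge0// patch_ge0//= lee_fin ltW.
Qed.

Lemma descend_sub n I J : descend n I J -> Q J `<=` Q I.
Proof.
elim: n I => [|n IH] I /=; first by move=> ->.
by move=> [/IH|/IH] h; apply: (subset_trans h); [exact: (tree_left tree)|exact: (tree_right tree)].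
Qed.

Lemma upper_sum_nodeE n I z : upper_sum n.+1 I z = (cst (v I)%:E \_ (Q I)) z +
  ((upper_sum n (l I) \_ (Q (l I))) z + (upper_sum n (r I) \_ (Q (r I))) z).
Proof. by []. Qed.

Lemma upper_sum_ge n I J z : descend n I J -> Q J z -> (v J)%:E <= upper_sum n.+1 I z.
Proof.
elim: n I => [|n IH] I.
  by move=> /= -> Qz; rewrite (patch_in _ Qz) leeDl// adde_ge0// patch_ge0.
have v1 : 0 <= (cst (v I)%:E \_ (Q I)) z by rewrite patch_ge0//= lee_fin ltW.
have u0 J' : 0 <= (upper_sum n.+1 J' \_ (Q J')) z by rewrite patch_ge0// upper_sum_ge0.
move=> [h|h] Qz; have IHz := IH _ h Qz; have Qz' := descend_sub h Qz; rewrite upper_sum_nodeE.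
  apply: (le_trans _ (leeDr _ v1)); rewrite (patch_in _ Qz').
  by apply: (le_trans IHz); exact: leeDl.
apply: (le_trans _ (leeDr _ v1)); rewrite [X in _ + X](patch_in _ Qz').
by apply: (le_trans IHz); exact: leeDr.
Qed.

Lemma upper_sumS n I z : upper_sum n I z <= upper_sum n.+1 I z.
Proof.
elim: n I => [|n IH] I; first exact: upper_sum_ge0.
have mono f g (B : set T) : f z <= g z -> (f \_ B) z <= (g \_ B) z.
  by rewrite !patchE; case: ifP.
by apply: leeD => //; apply: leeD; apply: mono.
Qed.

(** The node [J] contributes [v J * mu (Q J)], at most [eps^-1] times the mass of its top; the
    tops are disjoint. *)
Lemma upper_sum_integral n I :
  \int[mu]_(z in Q I) upper_sum n I z <= (eps^-1)%:E * \int[mu]_(z in Q I) w z.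
Proof.
have /andP[e0 e1] := tree_eps tree.
have ei : 0 <= (eps^-1)%:E by rewrite lee_fin invr_ge0 ltW.
elim: n I => [|n IH] I; first by rewrite integral0 mule_ge0// integral_sub_ge0.
have mp (f : T -> \bar R) B : measurable B -> measurable_fun D f -> measurable_fun (Q I) (f \_ B).
  by move=> mB mf; apply: measurable_fun_Q; exact: measurable_patch.
have p0 m J z : 0 <= (upper_sum m J \_ (Q J)) z by rewrite patch_ge0// upper_sum_ge0.
rewrite [upper_sum n.+1 I]/= ge0_integralD//; last 4 first.
- by move=> z _; rewrite patch_ge0//= lee_fin ltW.
- by apply: mp.
- by move=> z _; rewrite adde_ge0.
- by apply: emeasurable_funD; apply: mp => //; exact: upper_sum_mf.
rewrite ge0_integralD//; last 2 first.
- by apply: mp => //; exact: upper_sum_mf.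
- by apply: mp => //; exact: upper_sum_mf.
rewrite -!integral_mkcondr setIid.
rewrite (setIidr (tree_left tree (I := I))) (setIidr (tree_right tree (I := I))).
have Wge : 0 <= \int[mu]_(z in top_part I) w z by apply: integral_sub_ge0 => // z /top_sub /QD.
rewrite (integral_Q mw w0 I) ge0_muleDr//; last first.
  by rewrite adde_ge0// integral_sub_ge0.
rewrite [X in _ <= _ + X]ge0_muleDr ?integral_sub_ge0//.
apply: leeD; last by apply: leeD; exact: IH.
rewrite integral_cst//; apply: (@le_trans _ _ ((eps^-1)%:E * ((v I)%:E * mu (top_part I)))); last first.
  by apply: lee_wpmul2l => //; exact: integral_top_ge.
apply: (@le_trans _ _ ((eps^-1)%:E * ((v I)%:E * (eps%:E * mu (Q I))))); last first.
  apply: lee_wpmul2l => //; apply: lee_wpmul2l; last exact: (tree_top tree).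
  by rewrite lee_fin ltW.
rewrite (mu_finE I) -!EFinM lee_fin le_eqVlt; apply/orP; left; apply/eqP.
by field; rewrite gt_eqF.
Qed.

Lemma top_dominated_maximal : top_dominated -> maximal_integrable.
Proof.
have /andP[e0 e1] := tree_eps tree.
move=> /top_dominatedP[K K0 hK]; have [c c0 hc] := M_le.
have cK : (0 < c * K)%R by rewrite mulr_gt0.
exists (c * K / eps)%R; first by rewrite divr_gt0.
move=> I; have M0 z : Q I z -> 0 <= M I z.
  move=> Qz; apply: le_trans (M_ge (@subset_refl _ (Q I)) Qz).
  by rewrite averageE lee_fin ltW// mean_gt0.
have nd z : {homo (fun n => upper_sum n I z) : n m / (n <= m)%N >-> n <= m}.
  by apply/nondecreasing_seqP => n; exact: upper_sumS.
have cvgu z := ereal_nondecreasing_is_cvgn (nd z).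
have ub n z : upper_sum n I z <= limn (fun n => upper_sum n I z).
  by rewrite (cvg_lim _ (ereal_nondecreasing_cvgn (nd z)))//; apply: ereal_sup_ubound; exists n.
have mu_ n : measurable_fun (Q I) (upper_sum n I).
  by apply: measurable_fun_Q; exact: upper_sum_mf.
have L0 z : 0 <= limn (fun n => upper_sum n I z) by apply: le_trans (ub 0%N z).
apply: (@le_trans _ _ (\int[mu]_(z in Q I) ((c * K)%:E * limn (fun n => upper_sum n I z)))).
  apply: ge0_le_lower_integral => // z Qz; have := L0 z; have := ub ^~ z.
  case: (limn _) => [b||] // hub _; last by rewrite gt0_muley ?leey// lte_fin.
  rewrite -EFinM; apply: hc => // n J dJ QJ.
  by rewrite -lee_fin; apply: le_trans (hub n.+1); exact: upper_sum_ge.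
have ml : measurable_fun (Q I) (fun z => limn (fun n => upper_sum n I z)).
  apply: (@emeasurable_fun_cvg _ _ _ _ (fun n => upper_sum n I)) => // z _; exact: cvgu.
rewrite ge0_integralZl//; last by rewrite lee_fin ltW.
rewrite [leRHS](_ : _ = (c * K)%:E * ((eps^-1)%:E * \int[mu]_(z in Q I) w z)); last first.
  by rewrite muleA -EFinM.
apply: lee_wpmul2l; first by rewrite lee_fin ltW.
rewrite monotone_convergence//; last by move=> n z _; exact: upper_sum_ge0.
apply: lime_le; last by apply: nearW => n; exact: upper_sum_integral.
apply: ereal_nondecreasing_is_cvgn => n m nm; apply: ge0_le_integral => //.
- by move=> z _; exact: upper_sum_ge0.
- by move=> z _; exact: nd.
Qed.

End CarlesonTree.

(** * Carleson squares, top halves and neighbouring arcs *)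

Section CarlesonGeometry.
Variable R : realType.
Local Notation tau := (2 * pi : R).
Local Notation cis := (@Defs.cis R).
Local Notation mR := (measurableTypeR R).
Implicit Types (X Y : set R) (a b c d : R) (I J : set (R * R)) (z : plane R).

Lemma cmod_polar (p : R * R) : 0 <= p.1 -> cmod (polar p : plane R) = p.1.
Proof. by move=> p0; rewrite /cmod polar_norm sqrtr_sqr ger0_norm. Qed.

Lemma direction_polar (p : R * R) : 0 < p.1 -> direction (polar p : plane R) = cis p.2.
Proof.
move=> p0; rewrite /direction cmod_polar ?ltW// /polar /cis /=.
by congr pair; rewrite mulrAC divff ?mul1r// gt_eqF.
Qed.

Lemma polar_direction z t : 0 < cmod z -> direction z = cis t -> z = polar (cmod z, t).
Proof.
rewrite /direction /cis /polar /= => z0 [<- <-]; case: z z0 => x y z0.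
by congr pair; rewrite /= mulrC divfK// gt_eqF.
Qed.

Lemma sectorP r1 r2 X z : 0 <= r1 ->
  sector r1 r2 X z <-> r1 < cmod z < r2 /\ (cis @` X) (direction z).
Proof.
move=> r10; split.
  move=> [[r t] /= [+ Xt] <-]; rewrite in_itv/= => r12.
  have r0 : 0 < r by case/andP: r12 => /(le_lt_trans r10).
  by rewrite cmod_polar ?ltW// direction_polar//; split => //; exists t.
move=> [r12 [t Xt e]]; have r0 : 0 < cmod z by case/andP: r12 => /(le_lt_trans r10).
by exists (cmod z, t); [split|rewrite -(polar_direction r0)].
Qed.

Lemma measurable_sector_plane r1 r2 X : sigma_compact X ->
  measurable (sector r1 r2 X : set (plane R)).
Proof. by move=> cX; apply: measurable_plane; exact: measurable_sector. Qed.

Lemma area_sector r1 r2 X : 0 <= r1 < r2 -> sigma_compact X ->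
  area (sector r1 r2 X : set (plane R)) = (pi^-1 * (r2 ^+ 2 - r1 ^+ 2) * sector_area X)%:E.
Proof.
move=> r12 cX; rewrite areaE; last exact: measurable_sector.
by rewrite leb2_sector// -EFinM mulrA.
Qed.

Definition len I : R := fine (arc_length I).

Lemma len_lift a b X : arc_lift a b X -> len (cis @` X) = (b - a) / tau.
Proof. by move=> lX; rewrite /len (arc_lengthE lX). Qed.

Lemma arc_len I : is_arc I -> [/\ arc_length I = (len I)%:E, 0 < len I & len I <= 1].
Proof.
move=> /is_arcP[a [b [X [lX -> _]]]]; rewrite (len_lift lX) (arc_lengthE lX).
have t0 := tau_gt0 R; case: lX => ab btau _ _; split => //.
  by rewrite divr_gt0// subr_gt0.
by rewrite ler_pdivrMr// mul1r.
Qed.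

Lemma carleson_squareP I z : is_arc I ->
  carleson_square I z <-> 1 - len I < cmod z < 1 /\ I (direction z).
Proof.
move=> aI; have [lI l0 l1] := arc_len aI; rewrite /carleson_square /= lI lte_fin; split.
  by move=> [h1 h2 h3 h4]; split => //; move: h1; rewrite /disc/=; lra.
move=> [/andP[h1 h2] h3]; split => //; last by lra.
by rewrite gt_eqF//; lra.
Qed.

Lemma top_halfP I z : is_arc I ->
  top_half I z <-> 1 - len I < cmod z < 1 - len I / 2 /\ I (direction z).
Proof.
move=> aI; have [lI l0 l1] := arc_len aI.
rewrite /top_half /= lI inver pnatr_eq0/= -EFinM !lte_fin; split.
  by move=> [h1 h2 h3 /andP[h4 h5]]; split => //; apply/andP; split; lra.
move=> [/andP[h1 h2] h3]; split => //; last by apply/andP; split; lra.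
- by rewrite /disc /=; lra.
- by rewrite gt_eqF//; lra.
Qed.

Lemma carleson_squareE a b X : arc_lift a b X ->
  carleson_square (cis @` X) = sector (1 - len (cis @` X)) 1 X.
Proof.
move=> lX; have aX := arc_lift_arc lX; have [_ _ l1] := arc_len aX.
apply/seteqP; split => z; first by move/(carleson_squareP _ aX)/sectorP; apply; lra.
by move=> /sectorP h; apply/carleson_squareP => //; apply: h; lra.
Qed.

Lemma top_halfE a b X : arc_lift a b X ->
  top_half (cis @` X) = sector (1 - len (cis @` X)) (1 - len (cis @` X) / 2) X.
Proof.
move=> lX; have aX := arc_lift_arc lX; have [_ _ l1] := arc_len aX.
apply/seteqP; split => z; first by move/(top_halfP _ aX)/sectorP; apply; lra.
by move=> /sectorP h; apply/top_halfP => //; apply: h; lra.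
Qed.

Lemma measurable_square I : is_arc I -> measurable (carleson_square I).
Proof.
move=> /is_arcP[a [b [X [lX -> _]]]]; rewrite (carleson_squareE lX).
exact: measurable_sector_plane (arc_lift_compact lX).
Qed.

Lemma measurable_top_half I : is_arc I -> measurable (top_half I).
Proof.
move=> /is_arcP[a [b [X [lX -> _]]]]; rewrite (top_halfE lX).
exact: measurable_sector_plane (arc_lift_compact lX).
Qed.

Lemma area_square a b X : arc_lift a b X -> area (carleson_square (cis @` X)) =
  (pi^-1 * (len (cis @` X) * (2 - len (cis @` X))) * sector_area X)%:E.
Proof.
move=> lX; have [_ l0 l1] := arc_len (arc_lift_arc lX).
rewrite (carleson_squareE lX) area_sector; [|by apply/andP; split; lra|exact: arc_lift_compact lX].
by congr (EFin (_ * _ * _)); ring.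
Qed.

Lemma area_top_half a b X : arc_lift a b X -> area (top_half (cis @` X)) =
  (pi^-1 * (len (cis @` X) * (1 - 3 / 4 * len (cis @` X))) * sector_area X)%:E.
Proof.
move=> lX; have [_ l0 l1] := arc_len (arc_lift_arc lX).
rewrite (top_halfE lX) area_sector; [|by apply/andP; split; lra|exact: arc_lift_compact lX].
by congr (EFin (_ * _ * _)); field.
Qed.

Lemma area_square_gt0 I : is_arc I -> (0 < area (carleson_square I))%E.
Proof.
move=> aI; have [_ l0 l1] := arc_len aI; have [a [b [X [lX e _]]]] := is_arcP aI.
rewrite e (area_square lX) -e lte_fin mulr_gt0 ?(sector_area_gt0 lX)// mulr_gt0 ?invr_gt0 ?pi_gt0//.
by rewrite mulr_gt0//; lra.
Qed.

Lemma area_square_fin I : is_arc I -> (area (carleson_square I) < +oo)%E.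
Proof. by move=> /is_arcP[a [b [X [lX -> _]]]]; rewrite (area_square lX) ltry. Qed.

(** The ratio of the areas decreases with the length of [I]; for the whole circle it is
    exactly one quarter. *)
Lemma area_square_top I : is_arc I ->
  ((4^-1)%:E * area (carleson_square I) <= area (top_half I))%E.
Proof.
move=> aI; have [_ l0 l1] := arc_len aI; have [a [b [X [lX e _]]]] := is_arcP aI.
rewrite e (area_square lX) (area_top_half lX) -e -EFinM lee_fin.
have s0 := sector_area_gt0 lX.
have p0 : 0 < pi^-1 :> R by rewrite invr_gt0 pi_gt0.
rewrite mulrA ler_pM2r// mulrCA ler_pM2l// mulrCA ler_pM2l//; lra.
Qed.

Lemma height_factor_le (h k : R) : 0 < h -> h <= 1 -> 0 < k -> k <= 1 -> h <= 4 * k ->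
  h * (2 - h) <= 8 * (k * (2 - k)).
Proof.
move=> h0 h1 k0 k1 hk.
have k2 : 0 <= k * (1 - k) by rewrite mulr_ge0 ?subr_ge0// ltW.
have h2 : 0 <= h * h by rewrite mulr_ge0// ltW.
lra.
Qed.

(** The factor is 8 for the heights times [2 ^ 3] for the sectors. *)
Lemma area_square_le I J : is_arc I -> is_arc J -> len I <= 4 * len J ->
  (area (carleson_square I) <= 64%:E * area (carleson_square J))%E.
Proof.
move=> aI aJ; have [_ l0 l1] := arc_len aI; have [_ k0 k1] := arc_len aJ.
have [a [b [X [lX eI _]]]] := is_arcP aI; have [c [d [Y [lY eJ _]]]] := is_arcP aJ.
have t0 := tau_gt0 R.
rewrite eI (area_square lX) eJ (area_square lY) -eI -eJ -EFinM lee_fin => IJ.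
have p0 : 0 < pi^-1 :> R by rewrite invr_gt0 pi_gt0.
have s0 := sector_area_gt0 lY.
have sXY : sector_area X <= 2 ^+ 3 * sector_area Y.
  apply: (sector_area_comparable lX lY).
  have := len_lift lX; have := len_lift lY; rewrite -eI -eJ => eY eX.
  rewrite -(ler_pM2r (_ : 0 < tau^-1)) ?invr_gt0// -mulrA -eX -eY expr2; lra.
have h1 := height_factor_le l0 l1 k0 k1 IJ.
rewrite (_ : 64 * _ = pi^-1 * (8 * (len J * (2 - len J))) * (2 ^+ 3 * sector_area Y)); last by ring.
apply: ler_pM; [|exact: sector_area_ge0|by rewrite ler_pM2l|exact: sXY].
by apply: mulr_ge0 (ltW p0) (mulr_ge0 (ltW l0) _); rewrite subr_ge0 (le_trans l1)// ler1n.
Qed.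

(** The top halves of an arc and of one of its halves are disjoint, so that values of a weight
    there are compared through an arc [Z] whose top half meets both. *)
Definition arc_close I J := is_arc I /\ is_arc J /\ exists2 Z, is_arc Z &
  [/\ J `<=` Z, Z `<=` I, len Z / 2 < len J & len I / 2 < len Z].

(** The intermediate arc has its end points half-way between those of [X] and of [Y]. Its
    length is the mean of the two lengths, hence less than twice that of [Y] as soon as [X]
    is less than three times as long as [Y]. *)
Lemma arc_lift_close a b c d X Y : arc_lift a b X -> arc_lift c d Y -> Y `<=` X ->
  b - a < 3 * (d - c) -> arc_close (cis @` X) (cis @` Y).
Proof.
move=> lX lY YX abcd; have t0 := tau_gt0 R.
have [ab btau X1 X2] := lX; have [cd dtau Y1 Y2] := lY.
have ac : a <= c.
  rewrite leNgt; apply/negP => ca; pose s := Num.min ((a + c) / 2) ((c + d) / 2).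
  have : s < a by rewrite gt_min; apply/orP; left; lra.
  have : Y s.
    by apply: Y1; rewrite /= in_itv/= lt_min gt_min; apply/andP; split;
      [apply/andP; split; lra|apply/orP; right; lra].
  by move=> /YX/X2; rewrite /= in_itv/= => /andP[h _] h'; lra.
have db : d <= b.
  rewrite leNgt; apply/negP => bd; pose s := Num.max ((b + d) / 2) ((c + d) / 2).
  have : b < s by rewrite lt_max; apply/orP; left; lra.
  have : Y s.
    by apply: Y1; rewrite /= in_itv/= lt_max gt_max; apply/andP; split;
      [apply/orP; right; lra|apply/andP; split; lra].
  by move=> /YX/X2; rewrite /= in_itv/= => /andP[_ h] h'; lra.
pose Z := X `&` `[(a + c) / 2, (b + d) / 2]%classic.
have lZ : arc_lift ((a + c) / 2) ((b + d) / 2) Z.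
  split; [lra|lra| |by move=> s []].
  move=> s; rewrite /= in_itv/= => /andP[s1 s2]; split.
    by apply: X1; rewrite /= in_itv/=; apply/andP; split; lra.
  by rewrite /= in_itv/=; apply/andP; split; lra.
split; first exact: arc_lift_arc lX.
split; first exact: arc_lift_arc lY.
exists (cis @` Z); first exact: arc_lift_arc lZ.
rewrite !(len_lift lX, len_lift lY, len_lift lZ); split.
- move=> _ [s Ys <-]; exists s => //; split; first exact: YX.
  by have := Y2 _ Ys; rewrite /= !in_itv/= => /andP[s1 s2]; apply/andP; split; lra.
- by move=> _ [s [Xs _] <-]; exists s.
- by rewrite mulrAC ltr_pM2r ?invr_gt0//; lra.
- by rewrite mulrAC ltr_pM2r ?invr_gt0//; lra.
Qed.

Lemma arc_halves I : is_arc I -> exists Il Ir, [/\ is_arc Il, is_arc Ir,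
  len Il = len I / 2 /\ len Ir = len I / 2, I = Il `|` Ir /\ Il `&` Ir = set0 &
  arc_close I Il /\ arc_close I Ir].
Proof.
move=> /is_arcP[a [b [X [lX -> inj]]]]; have t0 := tau_gt0 R.
have lL := arc_lift_left lX; have lR := arc_lift_right lX.
exists (cis @` left_half a b X), (cis @` right_half a b X); split.
- exact: arc_lift_arc lL.
- exact: arc_lift_arc lR.
- by rewrite (len_lift lX) (len_lift lL) (len_lift lR); split; rewrite [RHS]mulrAC; congr (_ * _); lra.
- split; first by rewrite -image_setU halvesU.
  apply/seteqP; split => u // [[s [Xs sm] <-] [t [Xt mt] e]].
  by have := cis_inj (inj _ _ Xt Xs) e => ts; move: mt sm; rewrite /= ts; lra.
- have ab : a < b by case: lX.
  by split; [apply: (arc_lift_close lX lL)|apply: (arc_lift_close lX lR)]; (try by move=> s []); lra.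
Qed.

(** The union of two arcs with a common point is shorter than three times either of them;
    the bound on the total length keeps the union from wrapping around the circle. *)
Lemma arc_union_close I J u : is_arc I -> is_arc J -> I u -> J u ->
  len J <= len I -> len I < 2 * len J -> len I + len J < 1 ->
  exists L, arc_close L I /\ arc_close L J.
Proof.
move=> aI aJ; have t0 := tau_gt0 R.
have [a [b [X [lX -> _]]]] := is_arcP aI; have [c0 [d0 [Y0 [lY0 -> _]]]] := is_arcP aJ.
move=> [x Xx <-] [y Yy /esym/cis_eq_mod[k xy]]; rewrite (len_lift lX) (len_lift lY0).
rewrite -(cis_image_shift Y0 (- k)); set Y := [set s | _].
have lY := arc_lift_shift (- (tau * k%:~R)) lY0.
have -> : Y = [set s | Y0 (s + - (tau * k%:~R))] by rewrite /Y mulrNz mulrN.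
move: lY; set Y' := [set s | Y0 _]; rewrite !opprK.
set c := c0 + _; set d := d0 + _ => lY.
have -> : d0 - c0 = d - c by rewrite /c /d; ring.
have Yx : Y' x by rewrite /Y' /= xy addrK.
rewrite ler_pM2r ?invr_gt0// mulrA ltr_pM2r ?invr_gt0// -mulrDl ltr_pdivrMr// mul1r.
move=> h1 h2 h3; have [ab _ X1 X2] := lX; have [cd _ Y1 Y2] := lY.
have := X2 _ Xx; have := Y2 _ Yx; rewrite /= !in_itv/= => /andP[cx xd] /andP[ax xb].
pose p := Num.min a c; pose q := Num.max b d.
have [pa pc] : p <= a /\ p <= c by rewrite !ge_min !lexx orbT.
have [bq dq] : b <= q /\ d <= q by rewrite !le_max !lexx orbT.
have qp : q - p <= (b - a) + (d - c).
  by rewrite /p /q; case: (leP a c) => ?; case: (leP b d) => ?; lra.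
have lL : arc_lift p q (X `|` Y').
  split; [lra|lra| |].
    move=> s; rewrite /= in_itv/= gt_min lt_max => /andP[s1 s2].
    have [->|] := eqVneq s x; first by left.
    rewrite neq_lt => /orP[sx|xs].
      by case/orP: s1 => s1; [left; apply: X1|right; apply: Y1]; rewrite /= in_itv/=; apply/andP; split; lra.
    by case/orP: s2 => s2; [left; apply: X1|right; apply: Y1]; rewrite /= in_itv/=; apply/andP; split; lra.
  move=> s [/X2|/Y2]; rewrite /= !in_itv/= => /andP[s1 s2]; apply/andP; split; lra.
exists (cis @` (X `|` Y')); split.
  by apply: (arc_lift_close lL lX); [move=> s; left|lra].
by apply: (arc_lift_close lL lY); [move=> s; right|lra].
Qed.

End CarlesonGeometry.

(** * The dyadic tree of Carleson squares *)

Lemma ae_exists d (T : measurableType d) (R : realType) (mu : {measure set T -> \bar R})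
    (P : T -> Prop) (S : set T) : measurable S -> (0 < mu S)%E ->
  (\forall z \ae mu, P z) -> exists2 z, S z & P z.
Proof.
move=> mS S0 [N [mN N0 PN]]; apply: contrapT => none.
have SN : S `<=` N.
  by move=> z Sz; apply: PN => Pz; apply: none; exists z.
have : (mu S <= mu N)%E by apply: le_measure; rewrite ?inE.
by rewrite N0 leNgt S0.
Qed.

Section DiscInstance.
Variable R : realType.
Local Notation mu := (@area R).
Local Notation mR := (measurableTypeR R).

Lemma measurable_disc : measurable (@disc R).
Proof.
have mf : measurable_fun [set: mR * mR] (fun z : mR * mR => z.1 ^+ 2 + z.2 ^+ 2).
  by apply: measurable_funD; apply: measurable_funX;
    [exact: measurable_fst|exact: measurable_snd].
rewrite (_ : @disc R = ((fun z : mR * mR => z.1 ^+ 2 + z.2 ^+ 2) @^-1` `]-oo, 1[%classic : set (mR * mR))).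
  apply: measurable_plane; rewrite -[X in measurable X]setTI.
  by apply: mf => //; exact: measurable_itv.
apply/seteqP; split => z; rewrite /disc /cmod /= in_itv/=.
  move=> h; rewrite ltNge; apply: contraTN h; rewrite -leNgt => h.
  by rewrite -sqrtr1; apply: ler_wsqrtr.
by move=> h; rewrite -sqrtr1 ltr_sqrt.
Qed.

Definition circle_arc := {I : set (R * R) | is_arc I}.
Implicit Types I J : circle_arc.
Definition square I : set (plane R) := carleson_square (sval I).

Definition halving (lft rgt : circle_arc -> circle_arc) := forall I : circle_arc,
  [/\ len (sval (lft I)) = len (sval I) / 2 /\ len (sval (rgt I)) = len (sval I) / 2,
      sval I = sval (lft I) `|` sval (rgt I),
      sval (lft I) `&` sval (rgt I) = set0 &
      arc_close (sval I) (sval (lft I)) /\ arc_close (sval I) (sval (rgt I))].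

Lemma exists_halving : exists lft rgt, halving lft rgt.
Proof.
have H (I : circle_arc) : exists p : circle_arc * circle_arc, [/\ len (sval p.1) = len (sval I) / 2 /\
      len (sval p.2) = len (sval I) / 2,
      sval I = sval p.1 `|` sval p.2, sval p.1 `&` sval p.2 = set0 &
      arc_close (sval I) (sval p.1) /\ arc_close (sval I) (sval p.2)].
  have [Il [Ir [al ar h1 [h2 h3] h4]]] := arc_halves (svalP I).
  by exists (exist _ Il al, exist _ Ir ar).
have [f hf] := choice H.
by exists (fun I => (f I).1), (fun I => (f I).2).
Qed.

Variables (lft rgt : circle_arc -> circle_arc).
Hypothesis hlr : halving lft rgt.
Local Notation top := (top_part square lft rgt).

Lemma squareP (I : circle_arc) z : square I z <->
  1 - len (sval I) < cmod z < 1 /\ sval I (direction z).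
Proof. exact: carleson_squareP (svalP I). Qed.

Lemma square_lft I : square (lft I) `<=` square I.
Proof.
have [[h1 _] h2 _ _] := hlr I; have [_ l0 _] := arc_len (svalP I).
move=> z /squareP[/andP[z1 z2] hz]; apply/squareP; split; first by apply/andP; split; lra.
by rewrite h2; left.
Qed.

Lemma square_rgt I : square (rgt I) `<=` square I.
Proof.
have [[_ h1] h2 _ _] := hlr I; have [_ l0 _] := arc_len (svalP I).
move=> z /squareP[/andP[z1 z2] hz]; apply/squareP; split; first by apply/andP; split; lra.
by rewrite h2; right.
Qed.

Lemma top_partP I z : top I z <->
  1 - len (sval I) < cmod z <= 1 - len (sval I) / 2 /\ sval I (direction z).
Proof.
have [[h1 h2] h3 _ _] := hlr I; have [_ l0 l1] := arc_len (svalP I); split.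
  move=> [/squareP[/andP[z1 z2] hz] nz]; split => //; apply/andP; split => //.
  rewrite leNgt; apply/negP => h; apply: nz.
  by move: hz; rewrite h3 => -[hz|hz]; [left|right]; apply/squareP; split => //;
    apply/andP; split; lra.
move=> [/andP[z1 z2] hz]; split; first by apply/squareP; split => //; apply/andP; split; lra.
by move=> [|] /squareP[/andP[z3 z4] _]; lra.
Qed.

Lemma disc_tree : carleson_tree mu square lft rgt (@disc R) 4^-1.
Proof.
split.
- exact: measurable_disc.
- by move=> I z [].
- by move=> I; exact: measurable_square (svalP I).
- exact: square_lft.
- exact: square_rgt.
- move=> I; have [_ _ h _] := hlr I; apply/seteqP; split => z // [/squareP[_ h1] /squareP[_ h2]].
  by have : (sval (lft I) `&` sval (rgt I)) (direction z) by []; rewrite h.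
- by move=> I; exact: area_square_gt0 (svalP I).
- by move=> I; exact: area_square_fin (svalP I).
(* After [n] halvings the squares are too low to reach [z]. *)
- move=> I z Iz; have z1 : 0 < 1 - cmod z by case/squareP: Iz => /andP[_]; rewrite subr_gt0.
  have [n hn] : exists n, len (sval I) <= 2 ^+ n * (1 - cmod z).
    exists (Num.truncn (len (sval I) / (1 - cmod z))).+1.
    rewrite -ler_pdivrMr//; have := truncnS_gt (len (sval I) / (1 - cmod z)).
    by move=> /ltW /le_trans; apply; rewrite -natrX ler_nat ltnW// ltn_expl.
  exists n; elim: n I Iz hn => [|n IH] I Iz hn.
    by case/squareP: (Iz) => /andP[h _] _; rewrite expr0 mul1r in hn; lra.
  have [h|h] := pselect ((square (lft I) `|` square (rgt I)) z); last by left.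
  have [[h1 h2] _ _ _] := hlr I; rewrite exprS in hn.
  by right; case: h => h; [left|right]; apply: IH => //; rewrite ?h1 ?h2; lra.
- by apply/andP; split; lra.
- move=> I; have aI := svalP I; apply: (le_trans (area_square_top aI)).
  apply: le_measure; rewrite ?inE.
  + exact: measurable_top_half.
  + apply: measurableD; first exact: measurable_square.
    by apply: measurableU; [exact: measurable_square (svalP _)|exact: measurable_square (svalP _)].
  + move=> z /(top_halfP _ aI)[/andP[z1 z2] hz]; apply/top_partP; split => //.
    by apply/andP; split => //; exact: ltW.
Qed.

(** The top part of a node is its top half together with a piece of circle, which is a null
    set. *)
Lemma top_part_ae (w : plane R -> \bar R) (P : \bar R -> Prop) I :
  {ae mu, forall z, top_half (sval I) z -> P (w z)} -> {ae mu, forall z, top I z -> P (w z)}.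
Proof.
have aI := svalP I; have [a [b [X [lX eI _]]]] := is_arcP aI; have [_ l0 l1] := arc_len aI.
pose c := 1 - len (sval I) / 2; have c0 : 0 < c by rewrite /c; lra.
pose circ : set (mR * mR) := polar @` ([set c] `*` X).
have mc : measurable circ.
  by apply: measurable_polar_image; [exact: sigma_compact1|exact: arc_lift_compact lX].
have nc : {ae mu, forall z, ~ circ z}.
  exists (circ : set (plane R)); split; first exact: measurable_plane.
    by rewrite areaE// leb2_polar_circle ?mule0//; exact: arc_lift_compact lX.
  by move=> z /contrapT.
move=> h; apply: filterS2 h nc => z h nz /top_partP[/andP[z1 z2] hz].
apply: h; apply/(top_halfP _ aI); split => //; rewrite z1/= lt_neqAle z2 andbT.
apply/eqP => zc; apply: nz; move: hz; rewrite eI => -[t Xt /esym dt].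
have z0 : 0 < cmod z by rewrite zc.
by exists (c, t) => //=; rewrite /c -zc -(polar_direction z0 dt).
Qed.

End DiscInstance.

(** * Values at the top and local maximal functions *)

Section TopValues.
Variables (R : realType) (w : plane R -> \bar R).
Hypothesis hw : weight w.
Local Notation mu := (@area R).

Definition is_top_value (C : R) (v : set (R * R) -> R) := forall I, is_arc I ->
  0 < v I /\ {ae mu, forall z, top_half I z -> ((v I)%:E <= w z <= (C * v I)%:E)%E}.

Lemma area_top_half_gt0 I : is_arc I -> (0 < mu (top_half I))%E.
Proof.
move=> aI; apply: lt_le_trans (area_square_top aI).
by rewrite mule_gt0 ?area_square_gt0// lte_fin invr_gt0 ltr0n.
Qed.

Lemma weight_ae_top I : is_arc I ->
  \forall z \ae mu, top_half I z -> exists2 x : R, 0 < x & w z = x%:E.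
Proof.
move=> aI; case: hw => _ _; apply: filterS => z hz [dz _ _ _].
have /andP[] := hz dz; case: (w z) => [x||]// x0 _.
by exists x.
Qed.

(** Half the essential infimum of [w] on the top half, which is positive and finite because
    [w] is so almost everywhere. The margin of a factor 2 on both sides turns essential bounds
    into bounds almost everywhere. *)
Lemma exists_top_value : almost_constant_on_top_halves w ->
  exists2 C : R, 1 <= C & exists v, is_top_value C v.
Proof.
move=> [C0 C01 hC]; have C00 : 0 < C0 by exact: lt_le_trans C01.
exists (4 * C0); first lra.
suff H (I : set (R * R)) : exists x : R, is_arc I ->
    0 < x /\ {ae mu, forall z, top_half I z -> (x%:E <= w z <= (4 * C0 * x)%:E)%E}.
  by have [v hv] := choice H; exists v => I aI; exact: hv.
have [aI|naI] := pselect (is_arc I); last by exists 0.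
have mT := measurable_top_half aI; have T0 := area_top_half_gt0 aI.
have hT := weight_ae_top aI; have := hC _ aI.
set i := ess_inf_on _ _; set s := ess_sup_on _ _ => hsi.
have i0 : (0 <= i)%E.
  apply: ereal_sup_ubound => /=; apply: aeW => z [dz _ _ _].
  by case: hw => _ h _; exact: h.
have inf_lt (x : \bar R) : (x < i)%E -> {ae mu, forall z, top_half I z -> (x <= w z)%E}.
  move=> /ereal_sup_gt[y /= hy xy]; apply: filterS hy => z h tz.
  exact: le_trans (ltW xy) (h tz).
have sup_lt (x : \bar R) : (s < x)%E -> {ae mu, forall z, top_half I z -> (w z <= x)%E}.
  move=> /ereal_inf_lt[y /= hy xy]; apply: filterS hy => z h tz.
  exact: le_trans (h tz) (ltW xy).
case: i i0 hsi inf_lt => [i||]// i0 hsi inf_lt; last first.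
  have H : \forall z \ae mu, forall n, top_half I z -> (n%:R%:E <= w z)%E.
    by apply: ae_foralln => n; apply: inf_lt; rewrite ltry.
  have [z tz [h1 h2]] := ae_exists mT T0 (filterI H hT).
  have [x x0 wx] := h2 tz; have := h1 (Num.truncn x).+1 tz.
  by rewrite wx lee_fin leNgt truncnS_gt.
rewrite lee_fin le_eqVlt in i0; case/predU1P: i0 => [i0|i0].
  rewrite -i0 mule0 in hsi.
  have H : \forall z \ae mu, forall n, top_half I z -> (w z <= (n.+1%:R^-1)%:E)%E.
    apply: ae_foralln => n; apply: sup_lt; apply: (le_lt_trans hsi).
    by rewrite lte_fin invr_gt0.
  have [z tz [h1 h2]] := ae_exists mT T0 (filterI H hT).
  have [x x0 wx] := h2 tz; have := h1 (Num.truncn x^-1) tz.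
  rewrite wx lee_fin leNgt => /negP[].
  by rewrite -[ltRHS]invrK ltf_pV2 ?posrE ?invr_gt0//; exact: truncnS_gt.
exists (i / 2) => _; split; first by rewrite divr_gt0.
have h1 := inf_lt (i / 2)%:E _; have h2 := sup_lt (2 * C0 * i)%:E _.
have {}h1 : {ae mu, forall z, top_half I z -> ((i / 2)%:E <= w z)%E}.
  by apply: h1; rewrite lte_fin; lra.
have {}h2 : {ae mu, forall z, top_half I z -> (w z <= (2 * C0 * i)%:E)%E}.
  apply: h2; apply: (le_lt_trans hsi); rewrite -EFinM lte_fin.
  have : 0 < C0 * i by rewrite mulr_gt0.
  lra.
apply: filterS2 h1 h2 => z h1 h2 tz; rewrite h1//=.
by rewrite (_ : 4 * C0 * (i / 2) = 2 * C0 * i) ?h2//; field.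
Qed.

Variables (C : R) (v : set (R * R) -> R).
Hypotheses (C1 : 1 <= C) (hv : is_top_value C v).

(** The top halves share a set of positive area, on which [w] compares the two values. *)
Lemma top_value_overlap I J : is_arc I -> is_arc J -> J `<=` I -> len I / 2 < len J ->
  v I <= C * v J /\ v J <= C * v I.
Proof.
move=> aI aJ JI IJ; have [vI hI] := hv aI; have [vJ hJ] := hv aJ.
have [_ l0 l1] := arc_len aI; have [_ k0 k1] := arc_len aJ.
have [c [d [Y [lY eJ _]]]] := is_arcP aJ.
have cY := arc_lift_compact lY.
have r1 : 0 <= 1 - len J < 1 - len I / 2 by apply/andP; split; lra.
pose S := sector (1 - len J) (1 - len I / 2) Y : set (plane R).
have mS : measurable S by exact: measurable_sector_plane.
have S0 : (0 < mu S)%E.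
  rewrite area_sector// lte_fin mulr_gt0 ?(sector_area_gt0 lY)// mulr_gt0 ?invr_gt0 ?pi_gt0//.
  by case/andP: r1 => r0 r1; rewrite subr_gt0 ltr_pXn2r ?nnegrE// ltW// (le_lt_trans r0).
have [z Sz [h1 h2]] := ae_exists mS S0 (filterI hI hJ).
have r0 : 0 <= 1 - len J by lra.
have [/andP[z1 z2] zJ] := (sectorP _ _ _ r0).1 Sz; rewrite -eJ in zJ.
have len_le : len J <= len I.
  rewrite -lee_fin; have [<- _ _] := arc_len aI; have [<- _ _] := arc_len aJ.
  rewrite /arc_length; apply: lee_wpmul2r; first by rewrite inve_ge0 lee_fin ltW ?tau_gt0.
  by apply: le_outer_measure => u [u1 u2]; split => //; exact: JI.
have tI : top_half I z.
  by apply/(top_halfP _ aI); split; [apply/andP; split; lra|exact: JI].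
have tJ : top_half J z.
  by apply/(top_halfP _ aJ); split => //; apply/andP; split; lra.
have /andP[a1 a2] := h1 tI; have /andP[b1 b2] := h2 tJ.
by split; rewrite -lee_fin; [apply: le_trans a1 b2|apply: le_trans b1 a2].
Qed.

Lemma top_value_close I J : arc_close I J -> v I <= C ^+ 2 * v J /\ v J <= C ^+ 2 * v I.
Proof.
move=> [aI [aJ [Z aZ [JZ ZI ZJ IZ]]]].
have [h1 h2] := top_value_overlap aI aZ ZI IZ.
have [h3 h4] := top_value_overlap aZ aJ JZ ZJ.
have C0 : 0 <= C by exact: le_trans C1.
split; rewrite expr2 -mulrA.
  by apply: (le_trans h1); rewrite ler_wpM2l.
by apply: (le_trans h4); rewrite ler_wpM2l.
Qed.

Variables (lft rgt : circle_arc R -> circle_arc R).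
Hypothesis hlr : halving lft rgt.
Local Notation square := (@square R).
Implicit Types I J : circle_arc R.

Lemma disc_weight : tree_weight mu square lft rgt (@disc R) w (v \o sval) (C ^+ 2).
Proof.
have [mw w0 _] := hw; have C0 : 0 < C by exact: lt_le_trans C1.
split => //.
- by rewrite exprn_ege1.
- by move=> I; case: (hv (svalP I)).
- by move=> I; have [_ _ _ [h _]] := hlr I; exact: top_value_close.
- by move=> I; have [_ _ _ [_ h]] := hlr I; exact: top_value_close.
- move=> I; have [vI h] := hv (svalP I).
  apply: (top_part_ae hlr (P := fun y => ((v (sval I))%:E <= y <= (C ^+ 2 * v (sval I))%:E)%E)).
  apply: filterS h => z h /h /andP[-> /le_trans]; apply.
  rewrite lee_fin expr2 -mulrA ler_peMl// mulr_ge0// ltW//.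
Qed.

Lemma exists_descendant n I u : sval I u -> exists J,
  [/\ descend lft rgt n I J, sval J u & len (sval J) = len (sval I) / 2 ^+ n].
Proof.
elim: n I => [|n IH] I Iu; first by exists I; rewrite expr0 divr1.
have [[h1 h2] h3 _ _] := hlr I.
have half x : x / 2 / 2 ^+ n = x / 2 ^+ n.+1 :> R by rewrite exprS invfM mulrA.
move: Iu; rewrite {1}h3 => -[/IH|/IH] [J [d Ju e]]; exists J.
  by split => //; [left|rewrite e h1 half].
by split => //; [right|rewrite e h2 half].
Qed.

Definition local_maximal I z := maximal (w \_ (square I)) z.

Lemma patch_average I J : square J `<=` square I ->
  average (fun x => `|(w \_ (square I)) x|%E) (square J) = average w (square J).
Proof.
move=> JI; rewrite /average; congr (_ / _)%E; apply: eq_integral => z /set_mem Jz.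
rewrite patchE mem_set; last exact: JI.
by rewrite gee0_abs//; case: hw => _ + _; apply; case: Jz.
Qed.

Lemma local_maximal_ge I J z : square J `<=` square I -> square J z ->
  (average w (square J) <= local_maximal I z)%E.
Proof.
move=> JI Jz; rewrite -(patch_average JI); apply: ereal_sup_ubound.
by exists (sval J) => //; split => //; exact: svalP.
Qed.

Hypothesis wint : integrable_weight w.

Lemma integral_square_fin I : (\int[mu]_(z in square I) w z < +oo)%E.
Proof.
have [mw w0 _] := hw.
apply: (@le_lt_trans _ _ (\int[mu]_(z in @disc R) w z)%E).
  apply: ge0_subset_integral => //; [exact: measurable_square (svalP I)|exact: measurable_disc|].
  by move=> z [].
have /integrableP[_] := wint; congr (_ < _)%E; apply: eq_integral => z /set_mem dz.
by rewrite gee0_abs// w0.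
Qed.

(** An average over a square that is not much smaller than [square I] is at most of the order
    of the mean over [square I]. The arc of a smaller one is compared, through the union of
    the two arcs, with the descendant of [I] of about its length that contains the direction
    of [z]. *)
Lemma local_maximal_le : exists2 c : R, 0 < c & forall (K b : R) I z, 0 < K ->
  (forall J, mean mu square w J <= K * v (sval J)) -> square I z ->
  (forall n J, descend lft rgt n I J -> square J z -> v (sval J) <= b) ->
  (local_maximal I z <= (c * K * b)%:E)%E.
Proof.
have tree := disc_tree hlr; have [mw w0 _] := hw.
have tw := disc_weight; have wfin := integral_square_fin.
have C0 : 0 < C by exact: lt_le_trans C1.
have C4 : 1 <= C ^+ 4 by rewrite exprn_ege1.
exists (64 * C ^+ 4); first by rewrite mulr_gt0// exprn_gt0.
move=> K b I z K0 hK Iz hb.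
have b0 : 0 < b by apply: lt_le_trans (hb 0%N I erefl Iz); case: (hv (svalP I)).
apply: ge_ereal_sup => _ [J' [aJ' zJ'] <-].
pose J1 : circle_arc R := exist _ J' aJ'.
have mQ J := measurable_square (svalP J).
have QD J : square J `<=` @disc R by move=> y [].
pose N := (\int[mu]_(y in square J1 `&` square I) w y)%E.
have mJI : measurable (square J1 `&` square I) by apply: measurableI; exact: mQ.
have mwQ J : measurable_fun (square J) w by exact: (measurable_fun_Q tree).
have NI : (N <= \int[mu]_(y in square I) w y)%E.
  apply: (integral_mono tree mw w0); [exact: subIsetr|exact: QD|exact: mJI|exact: mQ].
have NJ : (N <= \int[mu]_(y in square J1) w y)%E.
  apply: (integral_mono tree mw w0); [exact: subIsetl|exact: QD|exact: mJI|exact: mQ].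
have -> : average (fun x => `|(w \_ (square I)) x|%E) (carleson_square J') =
    (N / mu (square J1))%E.
  rewrite /average /N integral_mkcondr; congr (_ / _)%E.
  apply: eq_integral => y /set_mem /(QD J1) dy; rewrite gee0_abs// patchE.
  by case: ifP => // _; exact: w0.
have [_ l0 l1] := arc_len (svalP I); have [_ k0 k1] := arc_len aJ'.
have bound J : mean mu square w J <= K * C ^+ 4 * b ->
    ((mean mu square w J)%:E <= (64 * C ^+ 4 * K * b)%:E)%E.
  move=> h; rewrite lee_fin; apply: (le_trans h).
  rewrite (_ : 64 * C ^+ 4 * K * b = 64 * (K * C ^+ 4 * b)); last by ring.
  by rewrite ler_peMl ?ler1n// !mulr_ge0 ?exprn_ge0 ?ltW.
have [big|small] := leP (len (sval I)) (4 * len J').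
  rewrite (avg_leE tree); apply: (le_trans NI).
  rewrite (integral_mean tree tw wfin) EFinM -(mu_finE tree).
  have vb : mean mu square w I <= K * b.
    by apply: (le_trans (hK I)); rewrite ler_wpM2l ?(ltW K0)//; exact: (hb 0%N).
  apply: (@le_trans _ _ ((K * b)%:E * (64%:E * mu (square J1)))%E).
    apply: lee_pmul => //; first by rewrite lee_fin (ltW (mean_gt0 tree tw wfin I)).
    exact: (area_square_le (svalP I) aJ').
  rewrite muleA -EFinM; apply: lee_wpmul2r => //; rewrite lee_fin.
  rewrite (_ : 64 * C ^+ 4 * K * b = C ^+ 4 * (K * b * 64)); last by ring.
  by rewrite ler_peMl// !mulr_ge0 ?ltW.
have [n [n1 n2]] : exists n, len J' <= len (sval I) / 2 ^+ n /\ len (sval I) / 2 ^+ n < 2 * len J'.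
  have ex : exists n, len (sval I) / 2 ^+ n.+1 < len J'.
    exists (Num.truncn (len (sval I) / len J')); rewrite ltr_pdivrMr ?exprn_gt0// mulrC.
    rewrite -ltr_pdivrMr//; apply: (lt_trans (truncnS_gt _)).
    by rewrite -natrX ltr_nat ltn_expl.
  case: (ex_minnP ex) => [[|n] hn hmin].
    by rewrite expr1 in hn; lra.
  exists n.+1; split; last by move: hn; rewrite (exprS _ n.+1) invfM mulrCA; lra.
  by rewrite leNgt; apply/negP => /hmin; rewrite ltnn.
have /squareP[/andP[z1 z2] dzI] := Iz.
have /(carleson_squareP _ aJ')[/andP[z3 _] dzJ'] := zJ'.
have [J [dJ dzJ eJ]] := exists_descendant n dzI.
have Jz : square J z by apply/squareP; split => //; rewrite z2 andbT eJ; lra.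
have [||| L [LJ LJ']] := arc_union_close (svalP J) aJ' dzJ dzJ'.
- by rewrite eJ.
- by rewrite eJ.
- by rewrite eJ; lra.
have v1 : v J' <= C ^+ 4 * v (sval J).
  have [h1 _] := top_value_close LJ; have [_ h2] := top_value_close LJ'.
  apply: (le_trans h2); rewrite (exprD C 2 2) -mulrA ler_wpM2l// exprn_ge0//; exact: ltW.
apply: (@le_trans _ _ (mean mu square w J1)%:E).
  by rewrite (avg_leE tree) (mu_finE tree) -EFinM -(integral_mean tree tw wfin).
apply: bound; apply: (le_trans (hK J1)); rewrite -mulrA ler_wpM2l ?(ltW K0)//.
by apply: (le_trans v1); rewrite ler_wpM2l ?exprn_ge0 ?(ltW C0)//; exact: hb dJ Jz.
Qed.

End TopValues.

Theorem theorem1p4 (R : realType) (w : plane R -> \bar R)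
    (m : set (plane R) -> R)
    (hw : weight w)
    (hm : forall I : set (R * R), is_arc I ->
            is_median w (carleson_square I) (m (carleson_square I)))
    (hac : almost_constant_on_top_halves w) :
  [<-> propP1 w; propP2 w; propP3 w; propP4 w; propP5 w m; propP6 w; propP7 w;
       propP8 w].
Proof.
have [C C1 [v hv]] := exists_top_value hw hac.
have [lft [rgt hlr]] := exists_halving R.
have tree := disc_tree hlr; have tw := disc_weight hw C1 hv hlr.
pose V (I : circle_arc R) := v (sval I).
pose P0 := integrable_weight w /\ top_dominated (@area R) (@square R) w V.
suff : [/\ P0 <-> propP1 w, P0 <-> propP2 w, P0 <-> propP3 w & P0 <-> propP4 w] /\
       [/\ P0 <-> propP5 w m, P0 <-> propP6 w, P0 <-> propP7 w & P0 <-> propP8 w].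
  by move=> [[e1 e2 e3 e4] [e5 e6 e7 e8]]; tfae; tauto.
have wf := integral_square_fin hw.
split; split; split.
- move=> [wi /(top_dominated_muckenhoupt tree tw (wf wi))[p [K [p1 K0 h]]]]; split => //.
  by exists p, K; split => // I aI; exact: (h (exist _ I aI)).
- move=> [wi [p [K [p1 K0 h]]]]; split => //.
  apply: (muckenhoupt_top_dominated tree tw (wf wi)); exists p, K; split => // I.
  exact: h (svalP I).
- move=> [wi /(exp_log_meanP tree tw (wf wi))[K K0 h]]; split => //.
  by exists K => // I aI; exact: (h (exist _ I aI)).
- move=> [wi [K K0 h]]; split => //.
  by apply/(exp_log_meanP tree tw (wf wi)); exists K => // I; exact: h (svalP I).
- move=> [wi /(top_dominated_reverse_hoelder tree tw (wf wi))[p [K [p1 K0 h]]]]; split => //.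
  by exists p, K; split => // I aI; exact: (h (exist _ I aI)).
- move=> [wi [p [K [p1 K0 h]]]]; split => //.
  apply: (controlled_top_dominated tree tw (wf wi)).
  apply: (uniformly_integrable_controlled tree tw (wf wi)).
  apply: (reverse_hoelder_uniformly_integrable tree tw (wf wi)).
  by exists p, K; split => // I; exact: h (svalP I).
- move=> [wi /(top_dominated_reverse_hoelder tree tw (wf wi)) h]; split => //.
  have := reverse_hoelder_uniformly_integrable tree tw (wf wi) h.
  move=> /(uniformly_integrable_controlled tree tw (wf wi))[a [b [a01 b01 {}h]]].
  by exists a, b; split => // I E aI; exact: (h (exist _ I aI)).
- move=> [wi [a [b [a01 b01 h]]]]; split => //.
  apply: (controlled_top_dominated tree tw (wf wi)); exists a, b; split => // I E.
  exact: h (svalP I).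
- move=> [wi hd]; split => //.
  have /(median_dominatesP tree tw (wf wi) (mdn := fun I => m (square I))) := hd.
  case=> [I|K K0 h]; first exact: hm (svalP I).
  by exists K => // I aI; exact: (h (exist _ I aI)).
- move=> [wi [K K0 h]]; split => //.
  apply/(median_dominatesP tree tw (wf wi) (mdn := fun I => m (square I))).
    by move=> I; exact: hm (svalP I).
  by exists K => // I; exact: h (svalP I).
- move=> [wi /(top_dominated_log_integrable tree tw (wf wi))[K K0 h]]; split => //.
  by exists K => // I aI; exact: (h (exist _ I aI)).
- move=> [wi [K K0 h]]; split => //.
  apply: (controlled_top_dominated tree tw (wf wi)).
  apply: (uniformly_integrable_controlled tree tw (wf wi)).
  apply: (log_integrable_uniformly_integrable tree tw (wf wi)).
  by exists K => // I; exact: h (svalP I).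
- move=> [wi hd]; split => //.
  have [K K0 h] := top_dominated_maximal tree tw (wf wi) (@local_maximal_ge _ _ hw)
    (local_maximal_le hw C1 hv hlr wi) hd.
  by exists K => // I aI; exact: (h (exist _ I aI)).
- move=> [wi [K K0 h]]; split => //.
  apply: (maximal_top_dominated tree tw (wf wi) (@local_maximal_ge _ _ hw)).
  by exists K => // I; exact: h (svalP I).
- move=> [wi /(top_dominated_level_set tree tw (wf wi))[b [K [b0 K0 h]]]]; split => //.
  by exists b, K; split => // I l aI; exact: (h (exist _ I aI)).
- move=> [wi [b [K [b0 K0 h]]]]; split => //.
  apply: (level_set_top_dominated tree tw (wf wi)); exists b, K; split => // I l.
  exact: h (svalP I).
Qed.
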